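(* Let $d \ge 1$ be an integer, let $U$ be a bounded domain in $\mathbb{C}^d$, let $x \in \overline{U}$, let $\frac{2d}{2d-1} < p < \infty$, and let $q = \frac{p}{p-1}$. For $n \ge 1$ let $A_n(x) = \{z \in \mathbb{C}^d : 2^{-(n+1)} < |z-x| < 2^{-n}\}$. If $$\sum_{n=1}^\infty 2^{n(2d-1)q}\, \Gamma_q(A_n(x) \setminus U) < \infty,$$ where $\Gamma_q$ denotes the Sobolev $q$-capacity, then $x$ is a bounded point evaluation for $L^p_a(U)$.
   Context: Here $|\cdot|$ is the Euclidean norm on $\mathbb{C}^d \cong \mathbb{R}^{2d}$, $dV$ is Lebesgue measure on $\mathbb{C}^d \cong \mathbb{R}^{2d}$, $\nabla$ is the gradient with respect to the $2d$ real coordinates, and a domain is a nonempty connected open set. Sobolev $q$-capacity: for a compact set $K \subseteq \mathbb{C}^d$, $$\Gamma_q(K) = \inf_u \int |\nabla u|^q \, dV,$$ where the infimum is taken over all (real-valued) Lipschitz continuous functions $u$ on $\mathbb{C}^d$ with compact support and $u \ge 1$ on $K$. For a non-compact set $E \subseteq \mathbb{C}^d$, $\Gamma_q(E) = \sup_K \Gamma_q(K)$, where the supremum is over all compact subsets $K$ of $E$. Function space: $O(\overline{U})$ denotes the set of functions analytic on $\overline{U}$, i.e. (complex-valued) holomorphic in some open neighborhood of $\overline{U}$ (the neighborhood may depend on the function). $L^p_a(U)$ denotes the closure of $O(\overline{U})$ in the $L^p(U)$ norm, $\|f\|_{L^p(U)} = \left(\int_U |f|^p\, dV\right)^{1/p}$.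 Bounded point evaluation: a point $x \in \overline{U}$ is a bounded point evaluation for $L^p_a(U)$ if the linear functional $f \mapsto f(x)$, defined on the dense subspace $O(\overline{U})$, is bounded in the $L^p(U)$ norm (and so extends to a bounded linear functional on $L^p_a(U)$); that is, if there is a real constant $C > 0$ such that $|f(x)| \le C \|f\|_{L^p(U)}$ for all $f \in O(\overline{U})$. *)

(* Defs.v *)
From HB Require Import structures.
From mathcomp Require Import all_boot all_order all_algebra.
From mathcomp Require Import all_classical all_reals all_analysis.
From mathcomp Require Import complex.

Set Implicit Arguments.
Unset Strict Implicit.
Unset Printing Implicit Defensive.

Import Order.TTheory GRing.Theory Num.Theory.
Import numFieldNormedType.Exports.

Local Open Scope classical_set_scope.
Local Open Scope ring_scope.

(* R[i] packed as a numClosedFieldType: through this constant R[i] carries the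
   norm topology, and the vectors 'rV[C R]_d form a normedModType over C R
   (with the sup norm, whose topology is the Euclidean one). *)
Definition C (R : realType) : numClosedFieldType := complex R.

Definition cabs (R : realType) (a : C R) : R := ComplexField.Normc.normc a.

Definition enorm (R : realType) (d : nat) (z : 'rV[C R]_d) : R :=
  Num.sqrt (\sum_(j < d) cabs (z 0 j) ^+ 2).

(* The sigma-algebra on C^d is generated by the 2d real coordinates, i.e. it is
   the Borel sigma-algebra of R^2d. *)
Section measurable_Cn.
Context (R : realType) (d : nat).

Definition coordinate_cylinder : set (set 'rV[C R]_d) :=
  [set A | exists j : 'I_d, exists2 B : set (measurableTypeR R), measurable B &
     A = [set z : 'rV[C R]_d | B (complex.Re (z 0 j))] \/
     A = [set z : 'rV[C R]_d | B (complex.Im (z 0 j))]].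

HB.instance Definition _ := @isMeasurable.Build
  (sigma_display coordinate_cylinder) 'rV[C R]_d
  <<s coordinate_cylinder >>
  (@sigma_algebra0 _ setT _) (@sigma_algebraC _ _)
  (@sigma_algebra_bigcup _ setT _).

End measurable_Cn.

Section cons_Cn.
Context (R : realType) (d : nat).

Definition cons_Cn
    (t : 'rV[C R]_d * measurableTypeR R * measurableTypeR R) : 'rV[C R]_d.+1 :=
  \row_(j < d.+1)
    if unlift ord0 j is Some k then t.1.1 0 k else Complex t.1.2 t.2.

Lemma measurable_cons_Cn : measurable_fun [set: _] cons_Cn.
Proof.
pose T : Type := ('rV[C R]_d * measurableTypeR R * measurableTypeR R)%type.
have m1 (A : set 'rV[C R]_d) : measurable A ->
    measurable ((fun t : T => t.1.1) @^-1` A).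
  move=> mA; rewrite -[X in measurable X]setTI.
  exact: (measurableT_comp measurable_fst measurable_fst).
have m2 (B : set (measurableTypeR R)) : measurable B ->
    measurable ((fun t : T => t.1.2) @^-1` B).
  move=> mB; rewrite -[X in measurable X]setTI.
  exact: (measurableT_comp measurable_snd measurable_fst).
have m3 (B : set (measurableTypeR R)) : measurable B ->
    measurable ((fun t : T => t.2) @^-1` B).
  by move=> mB; rewrite -[X in measurable X]setTI; exact: measurable_snd.
apply: (@measurability _ _ _ _ _ _ (@coordinate_cylinder R d.+1)) => //.
move=> _ [D [j [B mB E]] <-]; rewrite setTI.
have [k jk|j0] := unliftP ord0 j.
  have [] : measurable [set z : 'rV[C R]_d | B (complex.Re (z 0 k))] /\
            measurable [set z : 'rV[C R]_d | B (complex.Im (z 0 k))].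
    by split; apply: sub_sigma_algebra; exists k, B => //; [left|right].
  move=> /m1 mRe /m1 mIm.
  case: E => ->.
    apply: (eq_ind _ measurable mRe).
    by apply/seteqP; split=> t /=; rewrite mxE jk liftK.
  apply: (eq_ind _ measurable mIm).
  by apply/seteqP; split=> t /=; rewrite mxE jk liftK.
case: E => ->.
  apply: (eq_ind _ measurable (m2 B mB)).
  by apply/seteqP; split=> t /=; rewrite mxE j0 unlift_none.
apply: (eq_ind _ measurable (m3 B mB)).
by apply/seteqP; split=> t /=; rewrite mxE j0 unlift_none.
Qed.

End cons_Cn.

Section lebesgue_step.
Context (R : realType) (d : nat) (mu : {measure set 'rV[C R]_d -> \bar R}).

Definition lebesgue_step : set 'rV[C R]_d.+1 -> \bar R :=
  pushforward (mu \x @lebesgue_measure R \x @lebesgue_measure R)%E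
    (@cons_Cn R d).

Let step0 : lebesgue_step set0 = 0%E.
Proof. by rewrite /lebesgue_step /pushforward preimage_set0 measure0. Qed.

Let step_ge0 A : (0 <= lebesgue_step A)%E.
Proof. by rewrite /lebesgue_step /pushforward measure_ge0. Qed.

Let step_sigma_additive : semi_sigma_additive lebesgue_step.
Proof.
pose f : {mfun _ >-> _} :=
  HB.pack_for {mfun _ >-> _} (@cons_Cn R d)
    (isMeasurableFun.Build _ _ _ _ _ (@measurable_cons_Cn R d)).
exact: (@measure_semi_sigma_additive _ _ _ (pushforward _ f)).
Qed.

HB.instance Definition _ := isMeasure.Build _ _ _ lebesgue_step
  step0 step_ge0 step_sigma_additive.

End lebesgue_step.

(* Lebesgue measure on C^d = R^2d: the 2d-fold product of Lebesgue measure on R,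
   built one complex coordinate at a time. *)
Fixpoint lebesgue_Cn (R : realType) (d : nat) :
    {measure set 'rV[C R]_d -> \bar R} :=
  if d is d'.+1 then lebesgue_step (lebesgue_Cn R d')
  else dirac (0 : 'rV[C R]_0).

(* The derivative at z along v, for real parameters; the 2d real coordinate
   directions of C^d are the vectors e_j and 'i e_j. *)
Definition real_derive (R : realType) (d : nat) (u : 'rV[C R]_d -> R)
    (z v : 'rV[C R]_d) : R :=
  derive1 (fun t : R => u (z + (Complex t 0 : C R) *: v)) 0.

Definition gradient_norm (R : realType) (d : nat) (u : 'rV[C R]_d -> R)
    (z : 'rV[C R]_d) : R :=
  Num.sqrt (\sum_(j < d)
    (real_derive u z (delta_mx 0 j) ^+ 2 +
     real_derive u z ((Complex 0 1 : C R) *: delta_mx 0 j) ^+ 2)).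

Definition lipschitz_Cn (R : realType) (d : nat) (u : 'rV[C R]_d -> R) : Prop :=
  exists k : R, forall y z, `|u y - u z| <= k * enorm (y - z).

Definition compact_support (R : realType) (d : nat) (u : 'rV[C R]_d -> R)
    : Prop :=
  compact (closure [set z | u z != 0]).

(* gradient_norm u takes unspecified values where a partial derivative fails to
   exist; for Lipschitz u this is a null set, hence harmless in the integral. *)
Definition capacity_compact (R : realType) (d : nat) (q : R)
    (K : set 'rV[C R]_d) : \bar R :=
  ereal_inf [set (\int[lebesgue_Cn R d]_z ((gradient_norm u z) `^ q)%:E)%E
            | u in [set u : 'rV[C R]_d -> R |
                     [/\ lipschitz_Cn u, compact_support u &
                         forall z, K z -> 1 <= u z]]].

Definition capacity (R : realType) (d : nat) (q : R) (E : set 'rV[C R]_d)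
    : \bar R :=
  if pselect (compact E) then capacity_compact q E
  else ereal_sup [set capacity_compact q K
                 | K in [set K | compact K /\ K `<=` E]].

(* O(closure U): only the values of f near closure U matter. *)
Definition analytic_on_closure (R : realType) (d : nat) (U : set 'rV[C R]_d)
    (f : 'rV[C R]_d -> C R) : Prop :=
  exists V : set 'rV[C R]_d,
    [/\ open V, closure U `<=` V & forall z, V z -> differentiable f z].

Definition Lp_norm (R : realType) (d : nat) (U : set 'rV[C R]_d) (p : R)
    (f : 'rV[C R]_d -> C R) : \bar R :=
  'N[lebesgue_Cn R d]_p%:E[EFin \o ((fun z => cabs (f z)) \_ U)]%E.

Definition bounded_point_evaluation (R : realType) (d : nat)
    (U : set 'rV[C R]_d) (p : R) (x : 'rV[C R]_d) : Prop :=
  exists2 c : R, 0 < c & forall f : 'rV[C R]_d -> C R,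
    analytic_on_closure U f -> ((cabs (f x))%:E <= c%:E * Lp_norm U p f)%E.

Definition bounded_domain (R : realType) (d : nat) (U : set 'rV[C R]_d)
    : Prop :=
  [/\ U !=set0, open U, connected U & bounded_set U].

Definition annulus (R : realType) (d : nat) (x : 'rV[C R]_d) (n : nat)
    : set 'rV[C R]_d :=
  [set z | 2 ^- n.+1 < enorm (z - x) < 2 ^- n].

(* Main.v *)
From HB Require Import structures.
Require Import Defs.
From mathcomp Require Import all_boot all_order all_algebra.
From mathcomp Require Import all_classical all_reals all_analysis.
From mathcomp Require Import measurable_realfun complex.
From mathcomp Require Import ring lra.

Set Implicit Arguments.
Unset Strict Implicit.
Unset Printing Implicit Defensive.

Import Order.TTheory GRing.Theory Num.Theory.
Import numFieldNormedType.Exports.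

Local Open Scope classical_set_scope.
Local Open Scope ring_scope.

(** Let f be analytic near the closure of U, with real and imaginary parts a and b.

    The value at x is recovered from a regularised Bochner-Martinelli kernel.  The field
    (z - x) / (|z - x|^2 + e^2)^d has a divergence [chi] that concentrates at x as e tends
    to 0, so the Cauchy-Riemann equations give, for every Lipschitz function phi of bounded
    support in the region where f is defined, that the integral of a phi [chi] is minus the
    integral of a [flux] that is bounded by 2 |f| |z - x|^(1-2d) |grad phi|
    ([repr_kernel], [flux_bound]).  If phi is 1 near x, the first integral is at least a fixed
    positive multiple of a(x), up to an error that vanishes with e ([mass_lower]).  It remains
    to choose phi so that the flux lives essentially on U and is controlled there by the
    p-norm of f.

    The capacities provide such a phi.  In each dyadic shell about x take a competitor that is
    almost optimal for the capacity of the part of the shell outside U, multiply it by a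
    cutoff of the shell, and let v be the maximum of these functions over the first N shells.
    The gradient of the cutoff costs a factor 2^n on the n-th shell, which Hardy's inequality
    absorbs ([hardy], [exists_shell_function]); it requires q < 2d, which is the condition
    p > 2d/(2d-1).  On the n-th shell |z - x|^(1-2d) is of order 2^(n(2d-1)), so the
    convergence of the series says that |z - x|^(1-2d) |grad v| has q-norm bounded by a
    constant that depends neither on N nor on f ([barrier]).

    Let phi be the product of 1 - v, of a cutoff near x and of a cutoff tau that is 1 near U and
    vanishes where f is not defined ([test_fun]).  On U only v and the cutoff near x have a
    gradient, and Young's inequality bounds the flux by the p-norm of f.  Outside U the
    function phi vanishes, and so does its gradient almost everywhere, except on a bad set: the
    ball of radius 2^-(N+1), which the first N shells enclose, and thin layers about the
    dyadic spheres, which compact subsets of the open annuli do not reach.  There f is bounded,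
    by a constant that depends on f, but the volume of the bad set times the size
    2^((N+2)(2d-1)) of the kernel is of order 2^-N, so this contribution disappears as N tends
    to infinity ([exists_test_fun]).  The resulting bound of a(x) applies to b(x) and to the
    opposite values by rotating the pair (a, b) ([point_norm_le]).

    Two foundations are built on the way.  The Cauchy-Riemann equations are needed in weak form
    although differentiability is only assumed at each point; Goursat's subdivision argument,
    carried out with a partition into tent functions, provides this ([weak_pairing0]).  And
    Lipschitz functions have partial derivatives almost everywhere, which follows on each line
    from the Radon-Nikodym theorem ([lipschitz_ae_derivable], [lip_ae_pderivable]). *)

(** * Lipschitz functions on the line *)

Section lip1.
Context {R : realType}.
Variables (u : R -> R) (k : R).
Hypothesis k0 : 0 < k.
Hypothesis uL : forall s t, `|u s - u t| <= k * `|s - t|.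

(** Adding [k * t] to a [k]-Lipschitz function makes it nondecreasing, so that it is
    the cumulative function of a Stieltjes measure. *)
Definition tilt (t : R) := u t + k * t.

Lemma tilt_nd : nondecreasing tilt.
Proof.
move=> s t st; rewrite /tilt.
have := uL s t; rewrite ler_norml => /andP[_].
by rewrite distrC (ger0_norm (x:=t - s)) ?subr_ge0//; lra.
Qed.

Lemma tilt_le s t : s <= t -> tilt t - tilt s <= 2 * k * (t - s).
Proof.
move=> st; rewrite /tilt.
have := uL t s; rewrite ler_norml => /andP[_].
by rewrite (ger0_norm (x:=t - s)) ?subr_ge0//; lra.
Qed.

Lemma tilt_cont : continuous tilt.
Proof.
move=> x; apply/cvgrPdist_le => e e0.
near=> y.
have h : `|tilt x - tilt y| <= 2 * k * `|x - y|.
  rewrite /tilt opprD addrACA -mulrBr (le_trans (ler_normD _ _))// normrM (gtr0_norm k0).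
  by have := uL x y; have := normr_ge0 (u x - u y); have := mulr_ge0 (ltW k0) (normr_ge0 (x-y)); lra.
apply: le_trans h _.
have : `|x - y| <= e / (2 * k + 1).
  near: y; apply: (@cvgr_dist_le _ _ _ (nbhs x) _ id) => //.
  by rewrite divr_gt0// addr_gt0// mulr_gt0.
rewrite ler_pdivlMr ?addr_gt0 ?mulr_gt0//.
have := normr_ge0 (x - y); lra.
Unshelve. all: by end_near. Qed.

Lemma tilt_rc : right_continuous tilt.
Proof. by apply: right_continuousW; exact: tilt_cont. Qed.

HB.instance Definition _ := isCumulative.Build R _ R tilt tilt_nd tilt_rc.

Let nu := lebesgue_stieltjes_measure tilt.
Let mu := @lebesgue_measure R.

(** A cover by half-open intervals has Stieltjes content at most [2 * k] times its
    length, because of [tilt_le]; the infimum over the covers of a Lebesgue null set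
    is therefore 0. *)
Lemma nu_dom : nu `<< mu.
Proof.
have k20 : 0 < 2 * k by rewrite mulr_gt0.
apply/null_content_dominatesP => A mA mA0.
apply/eqP; rewrite eq_le measure_ge0 andbT.
suff h : (nu A <= (2 * k)%:E * mu A)%E.
  by rewrite (le_trans h)// (_ : mu A = 0%E) ?mule0.
rewrite -lee_pdivrMl//.
apply: le_ereal_inf_tmp => _ [F [mF AF] <-].
rewrite lee_pdivrMl// -nneseriesZl//.
apply: (@le_trans _ _ (\sum_(n <oo) wlength tilt (F n))%E).
  by apply: ereal_inf_lbound; exists F.
apply: lee_nneseries => [n _ _|n _]; first exact: wlength_ge0.
have /ocitvP [->|[[a b] /= ab ->]] := mF n.
  by rewrite /= !wlength0; rewrite ?mule0.
rewrite !wlength_itv_bnd ?(ltW ab)// -EFinM lee_fin.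
exact/tilt_le/ltW.
Qed.

Lemma nu_itv a b : a <= b -> nu `]a, b] = (tilt b - tilt a)%:E.
Proof.
move=> ab; rewrite /nu /lebesgue_stieltjes_measure /measure_extension/=.
rewrite measurable_mu_extE/=; last exact: is_ocitv.
by rewrite wlength_itv_bnd.
Qed.

(** The restriction to [-M, M] makes the Stieltjes measure finite, so that its
    Radon-Nikodym density is integrable.  The first fundamental theorem of calculus
    then differentiates the primitive of this density almost everywhere, and the
    primitive is [u] up to an affine function. *)
Lemma ae_derivable_itv (M : R) :
  {ae mu, forall x : R, (-M < x)%R -> (x < M)%R -> derivable u x 1}.
Proof.
have [M0|M0] := leP M 0.
  by apply: aeW => x /= h1 h2; have := lt_trans h1 h2; lra.
have mD : measurable (`]-M, M]%classic : set (measurableTypeR R)) by exact: measurable_itv.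
have foo : (nu `](-M)%R, M]%classic < +oo)%E by rewrite nu_itv ?ltry//; lra.
pose nuM : {finite_measure set _ -> \bar R} := mfrestr mD foo.
have dom : nuM `<< mu.
  apply/null_content_dominatesP => A mA mA0.
  rewrite /nuM /= /mfrestr /mrestr.
  apply/eqP; rewrite eq_le measure_ge0 andbT.
  have /null_content_dominatesP := nu_dom => /(_ A mA mA0) <-.
  by rewrite le_measure ?inE//; apply: measurableI.
have [h [h0 hfin hint hE]] := radon_nikodym_sigma_finite dom.
pose g x := fine (h x).
have gE : EFin \o g = h by apply/funext => x /=; rewrite fineK.
have gint : mu.-integrable setT (EFin \o g) by rewrite gE.
have giy : (forall y, mu.-integrable `]-oo, y] (EFin \o g)).
  by move=> y; apply: integrableS gint => //; exact: measurable_itv.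
have loc : locally_integrable setT g by apply: open_integrable_locally => //; exact: openT.
have := FTC1Ny giy loc.
apply: filterS; first exact: (ae_filter_ringOfSetsType mu).
move=> x /= [dF _] xM Mx.
apply: (@near_eq_derivable _ _ _ (fun y => (fun y => \int[mu]_(t in [set` `]-oo, y]]) g t)%R y + tilt (-M) - k * y)).
  near=> y.
  have yM : -M < y by near: y; apply: lt_nbhsr.
  have My : y < M by near: y; apply: lt_nbhsl.
  rewrite /Rintegral [X in fine X](_ : _ = (tilt y - tilt (-M))%:E); last first.
    under eq_integral do rewrite fineK ?hfin//.
    rewrite -hE; last exact: measurable_itv.
    rewrite /nuM /= /mfrestr /mrestr -nu_itv ?(ltW yM)//; congr (nu _).
    apply/seteqP; split => z /=; rewrite !in_itv/=; first by case=> -> /andP[-> _].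
    by move=> /andP[-> zy]; split => //; rewrite (le_trans zy)// ltW.
  by rewrite /= /tilt; lra.
apply: derivableB; last first.
  by apply: derivableM.
apply: derivableD => //.
Unshelve. all: by end_near. Qed.

End lip1.

Lemma lipschitz_ae_derivable (R : realType) (u : R -> R) (k : R) :
  (forall s t, `|u s - u t| <= k * `|s - t|) ->
  {ae @lebesgue_measure R, forall x, derivable u x 1}.
Proof.
move=> uL.
have uL' s t : `|u s - u t| <= (`|k| + 1) * `|s - t|.
  rewrite (le_trans (uL s t))// ler_wpM2r//.
  by have := ler_norm k; lra.
have k0 : 0 < `|k| + 1 by have := normr_ge0 k; lra.
have := ae_foralln (fun n : nat => ae_derivable_itv k0 uL' n%:R).
apply: filterS => x /= h.
have := archi_boundP (normr_ge0 x); rewrite ltr_norml => /andP[].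
exact: (h (Num.bound `|x|)).
Qed.

(** * Real coordinates of complex vectors *)

Section cs.
Context {R : realType} {I : finType}.
Implicit Types a b : I -> R.

Lemma sum_sqr_ge0 a : 0 <= \sum_i a i ^+ 2.
Proof. by apply: sumr_ge0 => i _; exact: sqr_ge0. Qed.

Lemma cauchy_schwarz_sum a b :
  \sum_i a i * b i <= Num.sqrt (\sum_i a i ^+ 2) * Num.sqrt (\sum_i b i ^+ 2).
Proof.
set A := \sum_i a i ^+ 2; set B := \sum_i b i ^+ 2; set P := \sum_i a i * b i.
have A0 : 0 <= A := sum_sqr_ge0 a.
have B0 : 0 <= B := sum_sqr_ge0 b.
have H : 0 <= B * (A * B - P ^+ 2).
  have -> : B * (A * B - P ^+ 2) = \sum_i (B * a i - P * b i) ^+ 2.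
    transitivity (\sum_i (B ^+ 2 * a i ^+ 2 - (2 * B * P) * (a i * b i) + P ^+ 2 * b i ^+ 2)).
      rewrite big_split/= sumrB -!mulr_sumr -/A -/B -/P; ring.
    by apply: eq_bigr => i _; ring.
  exact: sum_sqr_ge0.
have [B00|Bn0] := eqVneq B 0.
  have b0 i : b i = 0.
    apply/eqP; rewrite -sqrf_eq0; apply/eqP.
    by apply: (psumr_eq0P _ B00) => // j _; exact: sqr_ge0.
  rewrite [P]big1 ?mulr_ge0 ?sqrtr_ge0// => i _.
  by rewrite b0 mulr0.
have Bp : 0 < B by rewrite lt_neqAle eq_sym Bn0.
rewrite pmulr_rge0// subr_ge0 in H.
rewrite -sqrtrM// (le_trans (ler_norm _))// -sqrtr_sqr ler_wsqrtr//.
Qed.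

Lemma sqrt_sum_triangle a b :
  Num.sqrt (\sum_i (a i + b i) ^+ 2) <=
  Num.sqrt (\sum_i a i ^+ 2) + Num.sqrt (\sum_i b i ^+ 2).
Proof.
have h := cauchy_schwarz_sum a b.
set s := Num.sqrt (\sum_i a i ^+ 2) in h *.
set t := Num.sqrt (\sum_i b i ^+ 2) in h *.
have s0 : 0 <= s := sqrtr_ge0 _.
have t0 : 0 <= t := sqrtr_ge0 _.
rewrite -[leRHS]ger0_norm ?addr_ge0// -sqrtr_sqr ler_wsqrtr//.
have -> : \sum_i (a i + b i) ^+ 2 = s ^+ 2 + 2 * (\sum_i a i * b i) + t ^+ 2.
  rewrite !sqr_sqrtr ?sum_sqr_ge0// mulr_sumr -!big_split/=.
  by apply: eq_bigr => i _; ring.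
by rewrite sqrrD; lra.
Qed.

End cs.

Section coord.
Context {R : realType} {d : nat}.
Notation T := 'rV[C R]_d.
(** The 2d real coordinates: [(j, false)] is the real part of the complex coordinate
    [j] and [(j, true)] its imaginary part. *)
Definition ix : finType := ('I_d * bool)%type.

Definition co (i : ix) (z : T) : R :=
  if i.2 then complex.Im (z 0 i.1) else complex.Re (z 0 i.1).

(** Multiplication by a real scalar, since ['rV[C R]_d] is a module over [C R] only. *)
Definition rs (t : R) (v : T) : T := (Complex t 0 : C R) *: v.

(** The directions in which [gradient_norm] takes its partial derivatives. *)
Definition ev (i : ix) : T :=
  if i.2 then (Complex 0 1 : C R) *: delta_mx 0 i.1 else delta_mx 0 i.1.

Lemma coD i z w : co i (z + w) = co i z + co i w.
Proof. by rewrite /co !mxE; case: i.2; case: (z _ _); case: (w _ _). Qed.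

Lemma coN i z : co i (- z) = - co i z.
Proof. by rewrite /co !mxE; case: i.2; case: (z _ _). Qed.

Lemma coB i z w : co i (z - w) = co i z - co i w.
Proof. by rewrite coD coN. Qed.

Lemma co0 i : co i 0 = 0.
Proof. by rewrite /co !mxE; case: i.2. Qed.

Lemma co_rs i t z : co i (rs t z) = t * co i z.
Proof.
rewrite /co /rs !mxE; case: i.2; case: (z _ _) => a b /=; ring.
Qed.

Lemma co_ev i j : co i (ev j) = (i == j)%:R.
Proof.
case: i => i bi; case: j => j bj; rewrite /co /ev/=.
rewrite xpair_eqE.
case: bj; case: bi => /=; rewrite !mxE/=; case: (i == j) => /=; rewrite ?mulr1n ?mulr0n/=; ring.
Qed.

Lemma co_inj z w : (forall i, co i z = co i w) -> z = w.
Proof.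
move=> h; apply/matrixP => a j; rewrite ord1.
have := h (j, false); have := h (j, true); rewrite /co/=.
by case: (z 0 j) => ? ?; case: (w 0 j) => ? ? /= -> ->.
Qed.

Lemma cabs2 (a : C R) : cabs a ^+ 2 = complex.Re a ^+ 2 + complex.Im a ^+ 2.
Proof.
rewrite /cabs; case: a => a b /=; rewrite sqr_sqrtr//.
by rewrite addr_ge0// sqr_ge0.
Qed.

Lemma sum_ix (F : ix -> R) : \sum_i F i = \sum_(j < d) (F (j, false) + F (j, true)).
Proof.
under [RHS]eq_bigr do rewrite addrC.
transitivity (\sum_(p : ix) F (p.1, p.2)); first by apply: eq_bigr => -[].
rewrite -(pair_bigA _ (fun i j => F (i, j)))/=; apply: eq_bigr => j _.
by rewrite big_bool.
Qed.

Lemma enormE z : enorm z = Num.sqrt (\sum_i co i z ^+ 2).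
Proof.
by rewrite /enorm sum_ix; congr Num.sqrt; apply: eq_bigr => j _; rewrite cabs2.
Qed.

Lemma enorm_ge0 (z : T) : 0 <= enorm z. Proof. exact: sqrtr_ge0. Qed.

Lemma enorm2 z : enorm z ^+ 2 = \sum_i co i z ^+ 2.
Proof. by rewrite enormE sqr_sqrtr// sum_sqr_ge0. Qed.

Lemma ler_enormD (z w : T) : enorm (z + w) <= enorm z + enorm w.
Proof.
rewrite !enormE (le_trans _ (sqrt_sum_triangle _ _))// ler_wsqrtr//.
by apply: ler_sum => i _; rewrite coD.
Qed.

Lemma enormN (z : T) : enorm (- z) = enorm z.
Proof.
by rewrite !enormE; congr Num.sqrt; apply: eq_bigr => i _; rewrite coN sqrrN.
Qed.

Lemma enormBC (z w : T) : enorm (z - w) = enorm (w - z).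
Proof. by rewrite -enormN opprB. Qed.

Lemma enorm0 : enorm (0 : T) = 0.
Proof. by rewrite enormE big1 ?sqrtr0// => i _; rewrite co0 expr0n. Qed.

Lemma ler_enormB3 (z w y : T) : enorm (z - w) <= enorm (z - y) + enorm (y - w).
Proof. by rewrite (le_trans _ (ler_enormD _ _))// addrA subrK. Qed.

Lemma ler_dist_enorm (z w : T) : `|enorm z - enorm w| <= enorm (z - w).
Proof.
rewrite ler_norml; apply/andP; split.
  have := ler_enormD (w - z) z; rewrite subrK enormBC; lra.
have := ler_enormD (z - w) w; rewrite subrK; lra.
Qed.

Lemma enorm_rs t (z : T) : enorm (rs t z) = `|t| * enorm z.
Proof.
rewrite !enormE -sqrtr_sqr -sqrtrM ?sqr_ge0//; congr Num.sqrt.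
by rewrite mulr_sumr; apply: eq_bigr => i _; rewrite co_rs exprMn.
Qed.

Lemma enorm_ev i : enorm (ev i) = 1.
Proof.
rewrite enormE (bigD1 i)//= big1 ?addr0 ?co_ev ?eqxx ?expr1n ?sqrtr1//.
by move=> j ji; rewrite co_ev (negbTE ji) expr0n.
Qed.

Lemma co_le_enorm i z : `|co i z| <= enorm z.
Proof.
rewrite enormE -sqrtr_sqr ler_wsqrtr// (bigD1 i)//= lerDl.
by apply: sumr_ge0 => *; exact: sqr_ge0.
Qed.

Lemma enorm_le_sum z : enorm z <= \sum_i `|co i z|.
Proof.
have s0 : 0 <= \sum_i `|co i z| by apply: sumr_ge0.
rewrite enormE -[leRHS]ger0_norm// -sqrtr_sqr ler_wsqrtr//.
rewrite expr2 mulr_suml; apply: ler_sum => i _.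
rewrite -(real_normK (num_real _)) expr2 ler_wpM2l// (bigD1 i)//= lerDl; exact: sumr_ge0.
Qed.

Lemma enorm_le_max z r : (forall i, `|co i z| <= r) -> enorm z <= (2 * d)%:R * r.
Proof.
move=> h; rewrite (le_trans (enorm_le_sum z))//.
rewrite (le_trans (ler_sum _ (fun i _ => h i)))// sumr_const mulr_natl.
by rewrite card_prod card_ord card_bool mulnC.
Qed.

Lemma gradient_normE (u : T -> R) z :
  gradient_norm u z = Num.sqrt (\sum_i real_derive u z (ev i) ^+ 2).
Proof. by rewrite /gradient_norm sum_ix. Qed.

Lemma rs0 z : rs 0 z = 0.
Proof. by apply: co_inj => i; rewrite co_rs co0 mul0r. Qed.

Lemma rsD s t z : rs (s + t) z = rs s z + rs t z.
Proof. by apply: co_inj => i; rewrite coD !co_rs mulrDl. Qed.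

Lemma rsN t z : rs (- t) z = - rs t z.
Proof. by apply: co_inj => i; rewrite coN !co_rs mulNr. Qed.

End coord.

(** * Lebesgue measure *)

Section co_meas.
Context {R : realType} {d : nat}.
Notation T := 'rV[C R]_d.

Lemma measurable_co (i : @ix d) : measurable_fun [set: T] (co i : T -> measurableTypeR R).
Proof.
move=> _ B mB; rewrite setTI.
apply: sub_sigma_algebra; exists i.1, B => //.
by case: i => i []; [right|left].
Qed.

(** Openness and continuity are phrased with the Euclidean norm, in which all the
    estimates are written; the topology of row vectors comes from the sup norm. *)
Definition eopen (A : set T) : Prop := forall z, A z ->
  exists2 e, 0 < e & forall w, enorm (w - z) < e -> A w.

Definition cbox (c : {ffun @ix d -> R}) (r : R) : set T :=
  [set z | forall i, `|co i z - c i| < r].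

Lemma measurable_cbox c r : measurable (cbox c r).
Proof.
have -> : cbox c r = \big[setI/setT]_(i : @ix d) (co i @^-1` ball (c i) r).
  apply/seteqP; split => z.
    by move=> h; apply: (big_ind (fun A : set T => A z)) => // i _; rewrite /preimage/= /ball/= /ball_/= distrC; exact: h.
  rewrite /cbox/= => h i; move: h; rewrite (bigD1 i)//= => -[+ _].
  by rewrite /preimage/= /ball/= /ball_/= distrC.
apply: bigsetI_measurable => i _; rewrite -[X in measurable X]setTI.
apply: measurable_co => //; rewrite ball_itv; exact: measurable_itv.
Qed.

(** An open set is the countable union of the boxes it contains that have rational
    centres and half-sides 1/(n+1). *)
Lemma eopen_measurable A : eopen A -> measurable A.
Proof.
move=> oA.
have -> : A = \bigcup_(c : {ffun @ix d -> rat})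
    \bigcup_(n in [set n | cbox [ffun i => ratr (c i)] n.+1%:R^-1 `<=` A])
      cbox [ffun i => ratr (c i)] n.+1%:R^-1.
  apply/seteqP; split=> [z Az|z [c _ [n h zc]]]; last exact: (h z zc).
  have [e e0 eA] := oA z Az.
  pose e' := e / (2 * (2 * d)%:R + 1).
  have D0 : 0 < 2 * (2 * d)%:R + 1 :> R by rewrite ltr_wpDl ?mulr_ge0.
  have e'0 : 0 < e' by rewrite divr_gt0.
  pose n := Num.trunc e'^-1.
  have n0 : 0 < n.+1%:R^-1 :> R by rewrite invr_gt0.
  have ne : n.+1%:R^-1 < e'.
    by rewrite invf_plt ?posrE// /n truncnS_gt.
  have H i : exists q : rat, `|co i z - ratr q| < n.+1%:R^-1.
    have [q] := @rat_in_itvoo R (co i z - n.+1%:R^-1) (co i z) (ltac:(by rewrite ltrBlDr ltrDl)).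
    rewrite in_itv/= => /andP[h1 h2]; exists q.
    move: h1 h2; move: (ratr q) (n.+1%:R^-1) => a b h1 h2; rewrite ger0_norm; lra.
  pose c : {ffun @ix d -> rat} := [ffun i => xchoose (H i)].
  have zc : cbox [ffun i => ratr (c i)] n.+1%:R^-1 z.
    by move=> i; rewrite !ffunE; exact: (xchooseP (H i)).
  exists c => //; exists n => //= w wc; apply: eA.
  apply: (@le_lt_trans _ _ ((2 * d)%:R * (2 * n.+1%:R^-1))).
    apply: enorm_le_max => i; rewrite coB.
    have := wc i; have := zc i; rewrite !ffunE.
    move: (n.+1%:R^-1) (ratr _) => s t.
    by rewrite !ltr_norml ler_norml => /andP[? ?] /andP[? ?]; apply/andP; split; lra.
  have : n.+1%:R^-1 * (2 * (2 * d)%:R + 1) < e by rewrite -ltr_pdivlMr.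
  by move: n0; move: (n.+1%:R^-1) ((2 * d)%:R) => s t; lra.
apply: countable_bigcupT_measurable; first exact: countableP.
move=> c.
apply: bigcup_measurable => n _; exact: measurable_cbox.
Qed.

Definition econt (u : T -> R) : Prop := forall z (e : R), 0 < e ->
  exists2 r, 0 < r & forall w, enorm (w - z) < r -> `|u w - u z| < e.

Lemma econt_measurable (u : T -> R) : econt u ->
  measurable_fun [set: T] (u : T -> measurableTypeR R).
Proof.
move=> cu; apply: (measurability _ (RGenOInfty.measurableE R)) => //.
move=> _ [_ [a ->] <-]; rewrite setTI; apply: eopen_measurable => z /=.
rewrite in_itv/= andbT => az.
have [r r0 h] := cu z (u z - a) (ltac:(by rewrite subr_gt0)).
exists r => // w /h; rewrite /= in_itv/= andbT ltr_norml; lra.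
Qed.

End co_meas.

Section lam.
Context {R : realType}.
(** The translate agrees with Lebesgue measure on half-open intervals, which
    determines it. *)
Lemma lebesgue_measureD (a : R) (A : set (measurableTypeR R)) : measurable A ->
  pushforward (@lebesgue_measure R) (fun t => t + a : measurableTypeR R) A = lebesgue_measure A.
Proof.
move=> mA; apply/esym.
have mp : measurable_fun setT (fun t : measurableTypeR R => t + a : measurableTypeR R).
  by apply: measurable_funD.
pose f : {mfun _ >-> _} := HB.pack_for {mfun measurableTypeR R >-> measurableTypeR R} (fun t : measurableTypeR R => t + a : measurableTypeR R)
      (isMeasurableFun.Build _ _ _ _ _ mp).
apply: (@lebesgue_measure_unique _ (pushforward (@lebesgue_measure R) f)) => //= _ [[b c]] _ <-.
rewrite /pushforward/=.
rewrite [X in _ = lebesgue_measure X](_ : _ = `]b - a, c - a]%classic).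
  rewrite !lebesgue_measure_itv/= !lte_fin ltrD2r; case: ifP => // _.
  by rewrite -!EFinB; congr _%:E; ring.
by apply/seteqP; split => x /=; rewrite !in_itv/= ltrBlDr lerBrDr.
Qed.
End lam.

(** A copy of [lebesgue_Cn] under a constant of its own, to which the structure of
    sigma-finite measure can be attached. *)
Definition leb (R : realType) (d : nat) : set 'rV[C R]_d -> \bar R := lebesgue_Cn R d.
Arguments leb : clear implicits.
HB.instance Definition _ R d := Measure.copy (leb R d) (lebesgue_Cn R d).

Section leb.
Context {R : realType}.

Definition cube d (r : R) : set 'rV[C R]_d := [set z | forall i, `|co i z| <= r].
Arguments cube : clear implicits.

Lemma measurable_cube d r : measurable (cube d r).
Proof.
have -> : cube d r = \big[setI/setT]_(i : @ix d) (co i @^-1` `[-r, r]%classic).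
  apply/seteqP; split => z.
    by move=> h; apply: (big_ind (fun A : set 'rV[C R]_d => A z)) => // i _; rewrite /= in_itv/= -ler_norml; exact: h.
  rewrite /cube/= => h i; move: h; rewrite (bigD1 i)//= => -[+ _].
  by rewrite /= in_itv/= -ler_norml.
apply: bigsetI_measurable => i _; rewrite -[X in measurable X]setTI.
by apply: measurable_co => //; exact: measurable_itv.
Qed.

(** One complex dimension at a time, the cube is a product of a cube and of two
    intervals. *)
Lemma leb_cube d r : 0 <= r -> leb R d (cube d r) = ((2 * r) ^+ (2 * d))%:E.
Proof.
move=> r0; elim: d => [|d IH].
  rewrite muln0 expr0 /leb/= diracE mem_set// => -[] [].
  by [].
rewrite /leb/= /lebesgue_step /pushforward.
rewrite [X in product_measure1 _ _ X](_ : _ = (cube d r `*` `[-r, r]%classic) `*` `[-r, r]%classic).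
  rewrite product_measure1E/=; last 2 first.
  - apply: measurableX; [exact: measurable_cube|exact: measurable_itv].
  - exact: measurable_itv.
  rewrite product_measure1E/=; last 2 first.
  - exact: measurable_cube.
  - exact: measurable_itv.
  rewrite -[X in (X * _ * _)%E]/(leb R d (cube d r)) IH !lebesgue_measure_itv/= lte_fin.
  case: ltP => h.
    by rewrite -!EFinB -!EFinM mulnS exprD; congr _%:E; ring.
  have -> : r = 0 by lra.
  by rewrite mule0 mulr0 mulnS expr0n.

apply/seteqP; split => -[[z a] b]/=.
  move=> h; split; [split|].
  - move=> [j e]; have := h (lift ord0 j, e); rewrite /co /cons_Cn/= mxE liftK.
    by [].
  - by have := h (ord0, false); rewrite /co /cons_Cn/= mxE unlift_none/= in_itv/= ler_norml.
  - by have := h (ord0, true); rewrite /co /cons_Cn/= mxE unlift_none/= in_itv/= ler_norml.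
rewrite !in_itv/= -!ler_norml => -[[h h1] h2] [j e].
rewrite /co /cons_Cn/= mxE.
have [k jk|j0] := unliftP ord0 j; last by case: e.
exact: (h (k, e)).
Qed.

Lemma leb_sigma_finite d : sigma_finite setT (leb R d).
Proof.
exists (fun n => cube d n%:R).
  apply/esym; rewrite -subTset => z _.
  have [n hn] : exists n : nat, enorm z <= n%:R.
    exists (Num.bound (enorm z)); apply/ltW/archi_boundP/enorm_ge0.
  by exists n => // i; exact: le_trans (co_le_enorm _ _) hn.
by move=> n; split; [exact: measurable_cube|rewrite leb_cube ?ltry].
Qed.

HB.instance Definition _ d := Measure_isSigmaFinite.Build _ _ _ (leb R d)
    (leb_sigma_finite d).

Lemma co_trans_measurable d (a : 'rV[C R]_d) :
  measurable_fun setT (fun z : 'rV[C R]_d => z + a).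
Proof.
apply: (@measurability _ _ _ _ _ _ (@coordinate_cylinder R d)) => //.
move=> _ [D [j [B mB E]] <-]; rewrite setTI.
have mB' (c : R) (b : bool) : measurable [set z : 'rV[C R]_d | B (co (j,b) z + c)].
  rewrite -[X in measurable X]setTI.
  have mf : measurable_fun setT (fun z : 'rV[C R]_d => co (j, b) z + c : measurableTypeR R).
    by apply: measurable_funD => //; exact: measurable_co.
  exact: (mf measurableT _ mB).
case: E => ->.
  apply: (eq_ind _ measurable (mB' (co (j, false) a) false)).
  by apply/seteqP; split => z /=; rewrite -coD.
apply: (eq_ind _ measurable (mB' (co (j, true) a) true)).
by apply/seteqP; split => z /=; rewrite -coD.
Qed.

Lemma pushforward_prod d1 d2 (T1 : measurableType d1) (T2 : measurableType d2)
    (m1 : {measure set T1 -> \bar R})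
    (m2 : {sigma_finite_measure set T2 -> \bar R}) (f1 : T1 -> T1) (f2 : T2 -> T2) :
  measurable_fun setT f1 -> measurable_fun setT f2 ->
  (forall A, measurable A -> pushforward m1 f1 A = m1 A) ->
  (forall A, measurable A -> pushforward m2 f2 A = m2 A) ->
  forall A, measurable A ->
    pushforward (m1 \x m2)%E (fun z => (f1 z.1, f2 z.2)) A = (m1 \x m2)%E A.
Proof.
move=> mf1 mf2 h1 h2 A mA.
rewrite /pushforward/= /product_measure1/=.
transitivity (\int[m1]_x ((m2 \o xsection A) \o f1) x)%E.
  apply: eq_integral => x _ /=.
  rewrite -[RHS]h2; last exact: measurable_xsection.
  by rewrite /pushforward; congr (m2 _).
have mx := measurable_fun_xsection m2 mA.
have := @ge0_integral_pushforward _ _ _ _ _ _ mf1 m1 setT _ measurableT mx.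
rewrite preimage_setT => <-//.
by apply: eq_measure_integral => B mB _; exact: h1.
Qed.

(** By induction on the dimension: a product of translation-invariant measures is
    translation invariant ([pushforward_prod]). *)
Lemma leb_trans d (a : 'rV[C R]_d) A : measurable A ->
  pushforward (leb R d) (fun z => z + a) A = leb R d A.
Proof.
elim: d a A => [|d IH] a A mA.
  by rewrite /leb /pushforward/=; congr (_ _); apply/seteqP; split => z /=;
   rewrite (_ : z + a = z)//; apply: co_inj => -[[]].
rewrite /leb/= /lebesgue_step /pushforward.
pose a' : 'rV[C R]_d := \row_j a 0 (lift ord0 j).
pose a1 := co (ord0, false) a; pose a2 := co (ord0, true) a.
pose f1 (z : 'rV[C R]_d * measurableTypeR R) : 'rV[C R]_d * measurableTypeR R :=
  (z.1 + a', z.2 + a1).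
pose f2 (t : measurableTypeR R) : measurableTypeR R := t + a2.

have tE (c : R) B : measurable B ->
    pushforward (@lebesgue_measure R) (fun t : measurableTypeR R => t + c : measurableTypeR R) B =
    (@lebesgue_measure R) B by exact: lebesgue_measureD.
have tM (c : R) : measurable_fun setT (fun t : measurableTypeR R => t + c : measurableTypeR R).
  exact: measurable_funD.
have mf1 : measurable_fun setT f1.
  apply: measurable_fun_pair.
    exact: (measurableT_comp (co_trans_measurable a') measurable_fst).
  exact: (measurableT_comp (tM a1) measurable_snd).
have H1 B : measurable B -> pushforward (leb R d \x @lebesgue_measure R)%E f1 B =
   (leb R d \x @lebesgue_measure R)%E B.
  move=> mB.
  exact: (@pushforward_prod _ _ _ _ (leb R d) (@lebesgue_measure R)
    _ _ (co_trans_measurable a') (tM a1) (IH a') (tE a1) B mB).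
have H2 := @pushforward_prod _ _ _ _ (leb R d \x @lebesgue_measure R)%E (@lebesgue_measure R)
    _ _ mf1 (tM a2) H1 (tE a2).
rewrite -[X in _ = X]H2; last first.
  by rewrite -[X in measurable X]setTI; exact: measurable_cons_Cn.
have K z s t : cons_Cn (z, s, t) + a = cons_Cn (z + a', s + a1, t + a2) :> 'rV[C R]_d.+1.
  apply/matrixP => i j; rewrite ord1 /cons_Cn/= !mxE.
  have [k ->|->] := unliftP ord0 j; first by rewrite !mxE.
  by rewrite /a1 /a2 /co/=; case: (a 0 ord0).
rewrite /pushforward; congr (product_measure1 _ _ _).
by apply/seteqP; split => -[[z s] t] /=; rewrite K.
Qed.

Lemma ge0_integral_trans d (a : 'rV[C R]_d) (f : 'rV[C R]_d -> \bar R) :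
  measurable_fun setT f -> (forall z, 0 <= f z)%E ->
  (\int[leb R d]_z f (z + a)%R = \int[leb R d]_z f z)%E.
Proof.
move=> mf f0.
have := @ge0_integral_pushforward _ _ _ _ _ _ (co_trans_measurable a) (leb R d) setT f measurableT mf.
rewrite preimage_setT => <-//.
have mt := co_trans_measurable a.
by apply: eq_measure_integral => B mB _; exact: leb_trans.
Qed.

Lemma integral_trans d (a : 'rV[C R]_d) (f : 'rV[C R]_d -> \bar R) :
  (leb R d).-integrable setT f ->
  (\int[leb R d]_z f (z + a)%R = \int[leb R d]_z f z)%E.
Proof.
move=> fi; have mf := measurable_int _ fi.
rewrite [RHS]integralE [LHS]integralE; congr (_ - _)%E.
  rewrite -[RHS](ge0_integral_trans a (measurable_funepos mf)) => [|z]; last exact: funepos_ge0.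
  by apply: eq_integral => z _; rewrite !funeposE.
rewrite -[RHS](ge0_integral_trans a (measurable_funeneg mf)) => [|z]; last exact: funeneg_ge0.
  by apply: eq_integral => z _; rewrite !funenegE.
Qed.

End leb.
Arguments cube {R} d r.

(** * Difference quotients of Lipschitz functions *)

Section ae_aux.
Context (dp : measure_display) (X : measurableType dp) (R : realType).
Variable m : {measure set X -> \bar R}.
Implicit Types P Q S : X -> Prop.

Lemma aeS P Q : (forall x, P x -> Q x) ->
  {ae m, forall x, P x} -> {ae m, forall x, Q x}.
Proof. by move=> PQ; apply: negligibleS => x /=; apply: contra_not; exact: PQ. Qed.

Lemma aeS2 P Q S : (forall x, P x -> Q x -> S x) ->
  {ae m, forall x, P x} -> {ae m, forall x, Q x} -> {ae m, forall x, S x}.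
Proof.
move=> PQS hP hQ; apply: negligibleS (negligibleU hP hQ) => x /= nS.
by apply/not_andP => -[Px Qx]; exact: nS (PQS x Px Qx).
Qed.

End ae_aux.

Section lip.
Context {R : realType} {d : nat}.
Notation T := 'rV[C R]_d.
Implicit Types (u : T -> R) (v z : T).

Definition lipk (k : R) u := forall y z, `|u y - u z| <= k * enorm (y - z).

Lemma lip_econt k u : lipk k u -> econt u.
Proof.
move=> uL z e e0; have k1 : 0 < `|k| + 1 by rewrite ltr_wpDl.
exists (e / (`|k| + 1)); first by rewrite divr_gt0.
move=> w; rewrite ltr_pdivlMr// => h.
have H : k * enorm (w - z) <= enorm (w - z) * (`|k| + 1).
  rewrite mulrC ler_wpM2l ?enorm_ge0// (le_trans (ler_norm _))//; lra.
by have := uL w z; lra.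
Qed.

Lemma lip_measurable k u : lipk k u ->
  measurable_fun [set: T] (u : T -> measurableTypeR R).
Proof. by move=> /lip_econt; exact: econt_measurable. Qed.

Definition diffq v u z (h : R) : R := h^-1 * (u (z + rs h v) - u z).

Definition pderivable v u z : Prop := cvg (diffq v u z h @[h --> 0^']).

Lemma diffq_def v u z : diffq v u z =
  (fun h : R => h^-1 *: (((fun t => u (z + rs t v)) \o shift 0) (h *: 1) - (fun t => u (z + rs t v)) 0)).
Proof.
by apply/funext => h; rewrite /diffq /= rs0 !addr0 [in RHS]/GRing.scale/= mulr1.
Qed.

Lemma pderivableP v u z : pderivable v u z <-> derivable (fun t : R => u (z + rs t v)) 0 1.
Proof. by rewrite /derivable /pderivable diffq_def. Qed.

Lemma derE v u z : real_derive u z v = lim (diffq v u z h @[h --> 0^']).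
Proof. by rewrite /real_derive derive1E /derive diffq_def. Qed.

Lemma pderivable_is_derive v u z : pderivable v u z ->
  is_derive (0 : R) (1 : R) (fun t : R => u (z + rs t v)) (real_derive u z v).
Proof. by move=> /pderivableP h; rewrite /real_derive derive1E; apply: DeriveDef. Qed.

Lemma is_derive_pderivable v u z l :
  is_derive (0 : R) (1 : R) (fun t : R => u (z + rs t v)) l ->
  pderivable v u z /\ real_derive u z v = l.
Proof.
move=> h; split; first by apply/pderivableP; case: h.
by rewrite /real_derive derive1E; exact: derive_val.
Qed.

Lemma pderivable_cvg v u z : pderivable v u z -> diffq v u z h @[h --> 0^'] --> real_derive u z v.
Proof. by rewrite derE. Qed.

(** The Cauchy criterion for the difference quotients along rational steps.  Being a
    countable combination of conditions on measurable functions it defines a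
    measurable set, and for a Lipschitz function, whose quotients are continuous in
    the step, it decides the existence of the derivative. *)
Definition rat_cauchy v u : set T :=
  [set z | forall m : nat, exists n : nat, forall r s : rat,
     0 < `|ratr r : R| < n.+1%:R^-1 -> 0 < `|ratr s : R| < n.+1%:R^-1 ->
     `|diffq v u z (ratr r) - diffq v u z (ratr s)| <= m.+1%:R^-1].

Lemma pderivable_rat_cauchy v u z : pderivable v u z -> rat_cauchy v u z.
Proof.
move=> /pderivable_cvg /cvgrPdist_lt h m.
have m0 : 0 < m.+1%:R^-1 / 2 :> R by rewrite divr_gt0// invr_gt0.
have [e /= e0 he] := h _ m0.
pose n := Num.trunc e^-1.
have ne : n.+1%:R^-1 < e by rewrite invf_plt ?posrE// /n truncnS_gt.
exists n => r s /andP[r0 rn] /andP[s0 sn].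
have {}he (t : rat) : 0 < `|ratr t : R| -> `|ratr t : R| < n.+1%:R^-1 ->
    `|real_derive u z v - diffq v u z (ratr t)| < m.+1%:R^-1 / 2.
  move=> t0 tn; apply: he; last by rewrite -normr_gt0.
  by rewrite /ball_/= sub0r normrN (lt_trans tn).
have := he r r0 rn; have := he s s0 sn.
move: (m.+1%:R^-1) (diffq _ _ _ _) (diffq _ _ _ _) (real_derive _ _ _) => M a b c.
rewrite !ltr_norml ler_norml => /andP[? ?] /andP[? ?]; apply/andP; split; lra.
Qed.

Lemma diffq_cont k v u z h0 : lipk k u -> h0 != 0 ->
  diffq v u z h @[h --> h0] --> diffq v u z h0.
Proof.
move=> uL h00; apply: cvgM; first by apply: cvgV.
apply: cvgB; last exact: cvg_cst.
apply/cvgrPdist_le => e e0.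
have k1 : 0 < `|k| * enorm v + 1 by rewrite ltr_wpDl// mulr_ge0// enorm_ge0.
near=> h.
rewrite (le_trans (uL _ _))//.
rewrite opprD addrACA subrr add0r -rsN -rsD enorm_rs.
apply: (@le_trans _ _ ((`|k| * enorm v + 1) * `|h0 - h|)).
  rewrite mulrCA mulrC ler_wpM2r// (le_trans (ler_wpM2r (enorm_ge0 _) (ler_norm _)))//.
  by rewrite lerDl.
rewrite mulrC -ler_pdivlMr//; near: h.
by apply: (@cvgr_dist_le _ _ _ (nbhs h0) _ id) => //; rewrite divr_gt0.
Unshelve. all: by end_near. Qed.

(** The criterion for rational steps passes to all real steps by density, because the
    difference quotient is continuous in the step away from 0. *)
Lemma rat_cauchy_pderivable k v u z : lipk k u -> rat_cauchy v u z -> pderivable v u z.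
Proof.
move=> uL gd.
apply: cauchy_cvg; apply: cauchy_exP => e e0.
pose m := Num.trunc e^-1.
have me : m.+1%:R^-1 < e by rewrite invf_plt ?posrE// /m truncnS_gt.
have [n hn] := gd m.
have n0 : 0 < n.+1%:R^-1 :> R by rewrite invr_gt0.
have [r0] := @rat_in_itvoo R 0 n.+1%:R^-1 n0.
rewrite in_itv/= => /andP[r00 r0n].
have r0p : 0 < `|ratr r0 : R| < n.+1%:R^-1 by rewrite gtr0_norm// r00.
exists (diffq v u z (ratr r0)).
near=> h.
have hn0 : 0 < `|h| < n.+1%:R^-1.
  apply/andP; split.
    by rewrite normr_gt0; near: h; exact: nbhs_dnbhs_neq.
  by near: h; apply: dnbhs0_lt.
rewrite /ball/= /ball_/=.
apply: le_lt_trans me.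
apply/ler_addgt0Pr => e' e'0.
have h0 : h != 0 by case/andP: hn0; rewrite normr_gt0.
have /cvgrPdist_lt/(_ _ e'0) := @diffq_cont k v u z h uL h0.
move=> [e2 /= e20 H].
pose e3 := Num.min e2 (Num.min `|h| (n.+1%:R^-1 - `|h|)).
have e30 : 0 < e3 by rewrite !lt_min e20 subr_gt0.
have [s] := @rat_in_itvoo R (h - e3) h (ltac:(by rewrite ltrBlDr ltrDl)).
rewrite in_itv/= => /andP[s1 s2].
have sh : `|h - ratr s| < e3 by rewrite ger0_norm; lra.
have := H (ratr s); rewrite /ball_/= => {}H.
have s0 : 0 < `|ratr s : R| < n.+1%:R^-1.
  move: sh; rewrite !lt_min => /and3P[_ sh1 sh2].
  have := ler_distD (ratr s) h 0; rewrite !subr0 => t1.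
  have := ler_distD h (ratr s) 0; rewrite !subr0 (distrC (ratr s)) => t2.
  apply/andP; split.
    by rewrite -(ltrD2l `|h - ratr s|) addr0 (lt_le_trans sh1).
  by rewrite (le_lt_trans t2)// -ltrBrDr.
have h1 := hn r0 s r0p s0.
have h2 : `|diffq v u z (ratr s) - diffq v u z h| < e'.
  by rewrite distrC; apply: H; rewrite (lt_le_trans sh)// /e3 ge_min lexx.
apply: (@le_trans _ _ (`|diffq v u z (ratr r0) - diffq v u z (ratr s)| +
                       `|diffq v u z (ratr s) - diffq v u z h|)).
  exact: ler_distD.
exact: (lerD h1 (ltW h2)).
Unshelve. all: by end_near. Qed.

Lemma diffq_lip k v u h : lipk k u -> exists k', lipk k' (fun z => diffq v u z h).
Proof.
move=> uL; exists (`|h^-1| * (2 * k)) => y z; rewrite /diffq -mulrBr normrM -mulrA ler_wpM2l//.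
have -> : u (y + rs h v) - u y - (u (z + rs h v) - u z) =
   (u (y + rs h v) - u (z + rs h v)) - (u y - u z) by ring.
rewrite (le_trans (ler_normB _ _))//.
have := uL (y + rs h v) (z + rs h v); rewrite opprD addrACA subrr addr0.
by have := uL y z; lra.
Qed.

Lemma measurable_diffq k v u h : lipk k u ->
  measurable_fun [set: T] (fun z => diffq v u z h : measurableTypeR R).
Proof. by move=> uL; have [k' /lip_measurable] := diffq_lip v h uL. Qed.

Lemma measurable_bigcap_rat (F : rat -> set T) :
  (forall r, measurable (F r)) -> measurable (\bigcap_r F r).
Proof.
move=> mF; rewrite -[X in measurable X]setCK setC_bigcap; apply: measurableC.
apply: countable_bigcupT_measurable; first exact: countableP.
by move=> r; exact: measurableC.
Qed.

Lemma measurable_rat_cauchy k v u : lipk k u -> measurable (rat_cauchy v u).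
Proof.
move=> uL.
have -> : rat_cauchy v u = \bigcap_m \bigcup_n \bigcap_(r : rat) \bigcap_(s : rat)
   [set z | 0 < `|ratr r : R| < n.+1%:R^-1 -> 0 < `|ratr s : R| < n.+1%:R^-1 ->
     `|diffq v u z (ratr r) - diffq v u z (ratr s)| <= m.+1%:R^-1].
  apply/seteqP; split => z.
    by move=> h m _; have [n hn] := h m; exists n => // r _ s _ /=; exact: hn.
  by move=> h m; have [n _ hn] := h m I; exists n => r s; exact: (hn r I s I).
apply: bigcapT_measurable => m; apply: bigcupT_measurable => n.
apply: measurable_bigcap_rat => r; apply: measurable_bigcap_rat => s.
have [c1|c1] := pselect (0 < `|ratr r : R| < n.+1%:R^-1); last first.
  by rewrite [X in measurable X](_ : _ = setT)//; apply/seteqP; split => // z _ /c1.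
have [c2|c2] := pselect (0 < `|ratr s : R| < n.+1%:R^-1); last first.
  by rewrite [X in measurable X](_ : _ = setT)//; apply/seteqP; split => // z _ _ /c2.
have mf : measurable_fun setT (fun z => `|diffq v u z (ratr r) - diffq v u z (ratr s)| : measurableTypeR R).
  by apply: measurableT_comp => //; apply: measurable_funB; exact: measurable_diffq uL.
rewrite [X in measurable X](_ : _ = setT `&`
   (fun z => `|diffq v u z (ratr r) - diffq v u z (ratr s)| : measurableTypeR R) @^-1` `]-oo, m.+1%:R^-1]%classic).
  by apply: mf => //; exact: measurable_itv.
apply/seteqP; split => z /=; rewrite in_itv/=; first by move=> h; split => //; exact: h.
by case.
Qed.

End lip.

(** * Almost everywhere derivatives and integrals *)

Section ae.
Context {R : realType} {d : nat}.
Notation T := 'rV[C R]_d.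
Notation mu := (leb R d).
Notation lam := (@lebesgue_measure R).
Implicit Types (u : T -> R) (v z : T).

Lemma measurable_line v :
  measurable_fun setT (fun p : T * measurableTypeR R => p.1 + rs p.2 v : T).
Proof.
apply: (@measurability _ _ _ _ _ _ (@coordinate_cylinder R d)) => //.
move=> _ [D [j [B mB E]] <-]; rewrite setTI.
have mf (i : @ix d) : measurable_fun setT
    (fun p : T * measurableTypeR R => co i p.1 + p.2 * co i v : measurableTypeR R).
  apply: measurable_funD; first exact: (measurableT_comp (measurable_co i) measurable_fst).
  exact: (measurable_funM measurable_snd (measurable_cst _)).
have mB' (b : bool) : measurable [set p : T * measurableTypeR R | B (co (j,b) (p.1 + rs p.2 v))].
  have -> : [set p : T * measurableTypeR R | B (co (j,b) (p.1 + rs p.2 v))] =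
      setT `&` (fun p : T * measurableTypeR R => co (j, b) p.1 + p.2 * co (j, b) v : measurableTypeR R) @^-1` B.
    by apply/seteqP; split => p /=; rewrite coD co_rs; [split|case].
  by apply: mf.
case: E => ->.
  exact: (eq_ind _ measurable (mB' false)).
exact: (eq_ind _ measurable (mB' true)).
Qed.

(** Tonelli's theorem for the indicator of [z + rs t v \in A] with [t] in [0, 1].
    Integrating over [z] first gives the measure of [A] for each [t], by translation
    invariance; integrating over [t] first gives 0. *)
Lemma null_lines (A : set T) v : measurable A ->
  (forall z, {ae lam, forall t : R, ~ A (z + rs t v)}) -> mu A = 0%E.
Proof.
move=> mA h.
pose f (p : T * measurableTypeR R) : \bar R :=
  (\1_A (p.1 + rs p.2 v) * \1_(`[0, 1]%classic : set R) p.2)%:E.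
have mI : measurable_fun setT (fun p : T * measurableTypeR R => \1_A (p.1 + rs p.2 v) : measurableTypeR R).
  exact: (measurableT_comp (measurable_indic mA) (measurable_line v)).
have mJ : measurable_fun setT (\1_(`[0, 1]%classic : set R) : measurableTypeR R -> measurableTypeR R).
  by apply: measurable_indic; exact: measurable_itv.
have mf : measurable_fun setT f.
  apply/measurable_EFinP; apply: measurable_funM => //.
  exact: (measurableT_comp mJ measurable_snd).
have f0 p : (0 <= f p)%E by rewrite lee_fin mulr_ge0.
have := fubini_tonelli (m1 := mu) (m2 := lam) f mf f0.
rewrite [RHS](_ : _ = mu A) => [<-|].
  rewrite integral0_eq// => z _.
  transitivity (\int[lam]_y cst 0%E y)%E; last by rewrite integral_cst// mul0e.
  apply: ae_eq_integral => //.
    exact: (measurable_fun_pair2 z mf).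
  apply: aeS (h z) => t /= nA _; rewrite /f/= indicE memNset ?mul0r//.
transitivity (\int[lam]_y (mu A * (\1_(`[0, 1]%classic : set R) y)%:E))%E.
  apply: eq_integral => t _; rewrite /f/=.
  transitivity (\int[mu]_x ((\1_A (x + rs t v)%R)%:E * (\1_(`[0, 1]%classic : set R) t)%:E))%E.
    by apply: eq_integral => x _; rewrite EFinM.
  have mAt : measurable_fun setT (fun x : T => (\1_A (x + rs t v))%:E : \bar R).
    apply/measurable_EFinP.
    exact: (measurableT_comp (measurable_indic mA) (co_trans_measurable (rs t v))).
  rewrite ge0_integralZr//.
  congr (_ * _)%E.
  rewrite (@ge0_integral_trans _ _ (rs t v) (fun x => (\1_A x)%:E)).
  - by rewrite integral_indic// setIT.
  - by apply/measurable_EFinP; exact: measurable_indic.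
  - by move=> x; rewrite lee_fin.
have mJ' : measurable_fun setT (fun t : measurableTypeR R => (\1_(`[0, 1]%classic : set R) t)%:E : \bar R).
  exact/measurable_EFinP.
rewrite ge0_integralZl//.
rewrite integral_indic//.
have L : lam `[0, 1]%classic = 1%E.
  by rewrite lebesgue_measure_itv/= lte_fin ltr01 oppr0 adde0.
rewrite setIT -[RHS]mule1; congr (_ * _)%E; exact: L.
Qed.

(** On each line parallel to [v] this is the one-dimensional statement, and a
    measurable set that is null on those lines is null. *)
Lemma lip_ae_pderivable k v u : lipk k u -> {ae mu, forall z, pderivable v u z}.
Proof.
move=> uL; exists (~` rat_cauchy v u); split.
- by apply: measurableC; exact: measurable_rat_cauchy uL.
- apply: (@null_lines _ v); first by apply: measurableC; exact: measurable_rat_cauchy uL.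
  move=> z.
  have L s t : `|u (z + rs s v) - u (z + rs t v)| <= (k * enorm v) * `|s - t|.
    rewrite (le_trans (uL _ _))// opprD addrACA subrr add0r -rsN -rsD enorm_rs.
    by rewrite mulrCA mulrC.
  have := lipschitz_ae_derivable L; apply: aeS => t ht; rewrite /setC/=; apply.
  apply: pderivable_rat_cauchy; rewrite /pderivable.
  suff -> : diffq v u (z + rs t v) = (fun h : R => h^-1 *:
      (((fun s => u (z + rs s v)) \o shift t) (h *: 1) - (fun s => u (z + rs s v)) t)).
    exact: ht.
  apply/funext => h; rewrite /diffq /= [in RHS]/GRing.scale/= mulr1.
  by rewrite rsD (addrC (rs h v)) addrA.
- by move=> z /= nz h; apply: nz; exact: rat_cauchy_pderivable uL h.
Qed.

Lemma der_point v u z : ~ pderivable v u z -> real_derive u z v = point.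
Proof. by move=> h; rewrite derE; exact: dvgP. Qed.

(** Where the derivative fails to exist [real_derive] has a fixed value, so it is
    everywhere the limit of the measurable functions [g n]. *)
Lemma measurable_der k v u : lipk k u ->
  measurable_fun [set: T] (fun z => real_derive u z v : measurableTypeR R).
Proof.
move=> uL.
pose g n z : R := if z \in rat_cauchy v u then diffq v u z n.+1%:R^-1 else point.
apply: (@measurable_fun_cvg _ _ _ _ (g : nat -> T -> measurableTypeR R)).
- move=> n; apply: measurable_fun_if => //.
  + apply: (measurable_fun_bool true).
    by rewrite setTI preimage_mem_true; exact: measurable_rat_cauchy uL.
  + by apply: measurable_funTS; exact: measurable_diffq uL.
- move=> z _; rewrite /g; have [hz|hz] := boolP (z \in rat_cauchy v u).
    have /cvgrPdist_lt H := pderivable_cvg (rat_cauchy_pderivable uL (set_mem hz)).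
    apply/cvgrPdist_lt => e /H [r /= r0 {}H]; near=> n.
    apply: H; last by rewrite invr_eq0.
    rewrite /ball_/= sub0r normrN ger0_norm ?invr_ge0//.
    by near: n; exact: near_infty_natSinv_lt (PosNum r0).
  rewrite der_point; first exact: cvg_cst.
  by move=> /pderivable_rat_cauchy /mem_set; exact/negP.
Unshelve. all: by end_near. Qed.

(** The integrals of these functions are finite real numbers, which keeps extended reals
    out of the estimates; [M] bounds both the values and the support. *)
Definition bmc (f : T -> R) : Prop :=
  measurable_fun [set: T] (f : T -> measurableTypeR R) /\
  exists M, forall z, `|f z| <= M /\ (M < enorm z -> f z = 0).

Definition intg (f : T -> R) : R := Rintegral mu setT f.

Lemma bmc_integrable f : bmc f -> mu.-integrable setT (EFin \o f).
Proof.
move=> [mf [M hM]].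
have M0 : 0 <= M by rewrite (le_trans _ (hM 0).1).
have mC : measurable (cube d M : set T) by exact: measurable_cube.
have hfin : (mu (cube d M) < +oo)%E by rewrite leb_cube// ltry.
have : mu.-integrable (cube d M) (EFin \o f).
  apply: measurable_bounded_integrable => //.
  - exact: measurable_funTS.
  - exists M; split; first exact: num_real.
    by move=> x Mx y _; apply: le_trans (ltW Mx); exact: (hM y).1.
move=> /(integrable_mkcond _ mC).1.
suff -> : (EFin \o f) \_ (cube d M) = EFin \o f by [].
apply/funext => z; rewrite patchE/=; case: ifPn => //.
rewrite notin_setE => hz; rewrite (hM z).2//.
rewrite ltNge; apply/negP => zM; apply: hz => i.
exact: le_trans (co_le_enorm i z) zM.
Qed.

Lemma bmcD f g : bmc f -> bmc g -> bmc (fun z => f z + g z).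
Proof.
move=> [mf [M hM]] [mg [N hN]]; split; first exact: measurable_funD.
have M0 : 0 <= M by rewrite (le_trans _ (hM 0).1).
have N0 : 0 <= N by rewrite (le_trans _ (hN 0).1).
exists (M + N) => z; split.
  by rewrite (le_trans (ler_normD _ _))// lerD// ?(hM z).1 ?(hN z).1.
by move=> h; rewrite (hM z).2 ?(hN z).2 ?addr0//; lra.
Qed.

Lemma bmcM f g : bmc f -> measurable_fun [set: T] (g : T -> measurableTypeR R) ->
  (forall r, exists N, forall z, enorm z <= r -> `|g z| <= N) ->
  bmc (fun z => g z * f z).
Proof.
move=> [mf [M hM]] mg gb; split; first exact: measurable_funM.
have M0 : 0 <= M by rewrite (le_trans _ (hM 0).1).
have [N hN] := gb M.
exists (Num.max M (N * M)) => z; split; last first.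
  by rewrite gt_max => /andP[h _]; rewrite (hM z).2 ?mulr0.
have [h|h] := ltP M (enorm z); first by rewrite (hM z).2// mulr0 normr0 le_max M0.
by rewrite normrM le_max ler_pM ?orbT// ?(hM z).1// hN.
Qed.

Lemma bmcZ c f : bmc f -> bmc (fun z => c * f z).
Proof.
by move=> hf; apply: (bmcM hf (measurable_cst c)) => r; exists `|c|.
Qed.

Lemma bmcN f : bmc f -> bmc (fun z => - f z).
Proof.
move=> /(bmcZ (-1)); suff -> : (fun z => -1 * f z) = (fun z => - f z) by [].
by apply/funext => z; rewrite mulN1r.
Qed.

Lemma bmcB f g : bmc f -> bmc g -> bmc (fun z => f z - g z).
Proof. by move=> hf hg; apply: bmcD => //; exact: bmcN. Qed.

Lemma bmc_sum (I : Type) (s : seq I) (F : I -> T -> R) :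
  (forall i, bmc (F i)) -> bmc (fun z => \sum_(i <- s) F i z).
Proof.
move=> hF; elim: s => [|i s IH].
  have -> : (fun z => \sum_(i <- [::]) F i z) = cst 0 by apply/funext => z; rewrite big_nil.
  split; first exact: measurable_cst.
  by exists 0 => z; rewrite normr0.
have -> : (fun z => \sum_(j <- i :: s) F j z) = (fun z => F i z + \sum_(j <- s) F j z).
  by apply/funext => z; rewrite big_cons.
exact: bmcD.
Qed.

Lemma intgD f g : bmc f -> bmc g -> intg (fun z => f z + g z) = intg f + intg g.
Proof. by move=> hf hg; rewrite /intg RintegralD//; exact: bmc_integrable. Qed.

Lemma intgB f g : bmc f -> bmc g -> intg (fun z => f z - g z) = intg f - intg g.
Proof. by move=> hf hg; rewrite /intg RintegralB//; exact: bmc_integrable. Qed.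

Lemma intgZ c f : bmc f -> intg (fun z => c * f z) = c * intg f.
Proof. by move=> hf; rewrite /intg RintegralZl//; exact: bmc_integrable. Qed.

Lemma intg_sum (I : Type) (s : seq I) (F : I -> T -> R) :
  (forall i, bmc (F i)) -> intg (fun z => \sum_(i <- s) F i z) = \sum_(i <- s) intg (F i).
Proof.
move=> hF; elim: s => [|i s IH].
  rewrite big_nil /intg /Rintegral integral0_eq// => z _; by rewrite big_nil.
rewrite big_cons -IH -intgD//; last exact: bmc_sum.
by congr intg; apply/funext => z; rewrite big_cons.
Qed.

Lemma le_intg f g : bmc f -> bmc g -> (forall z, f z <= g z) -> intg f <= intg g.
Proof. by move=> hf hg h; rewrite /intg le_Rintegral//; exact: bmc_integrable. Qed.

Lemma intg_ae f g : bmc f -> bmc g -> {ae mu, forall z, f z = g z} -> intg f = intg g.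
Proof.
move=> [mf _] [mg _] h; rewrite /intg /Rintegral; congr fine.
apply: ae_eq_integral => //; [exact/measurable_EFinP|exact/measurable_EFinP|].
by apply: aeS h => z /= -> _.
Qed.

(** The almost everywhere inequality becomes an everywhere inequality after replacing
    [g] by the maximum of [f] and [g]. *)
Lemma le_intg_ae f g : bmc f -> bmc g -> {ae mu, forall z, f z <= g z} -> intg f <= intg g.
Proof.
move=> hf hg h.
have mx : bmc (fun z => Num.max (f z) (g z)).
  case: hf hg => mf [M hM] [mg [N hN]]; split; first exact: measurable_maxr.
  have M0 : 0 <= M by rewrite (le_trans _ (hM 0).1).
  have N0 : 0 <= N by rewrite (le_trans _ (hN 0).1).
  exists (Num.max M N) => z; split.
    case: (leP (f z) (g z)) => _; rewrite le_max; first by rewrite (hN z).1 orbT.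
    by rewrite (hM z).1.
  by rewrite gt_max => /andP[h1 h2]; rewrite (hM z).2// (hN z).2// maxxx.
rewrite (@le_trans _ _ (intg (fun z => Num.max (f z) (g z))))//.
  by apply: le_intg => // z; rewrite le_max lexx.
rewrite le_eqVlt; apply/orP; left; apply/eqP; apply: intg_ae => //.
by apply: aeS h => z fg; apply/max_idPr.
Qed.

Lemma intg_ge0 f : (forall z, 0 <= f z) -> 0 <= intg f.
Proof. by move=> h; apply: Rintegral_ge0. Qed.

Lemma intg_norm f : bmc f -> `|intg f| <= intg (fun z => `|f z|).
Proof. by move=> hf; apply: le_normr_Rintegral => //; exact: bmc_integrable. Qed.

Lemma intgE f : bmc f -> (\int[mu]_z (f z)%:E)%E = (intg f)%:E.
Proof.
move=> hf; rewrite /intg /Rintegral fineK//.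
by apply: integrable_fin_num => //; exact: bmc_integrable.
Qed.

End ae.

(** * Calculus of derivatives along a direction *)

Section has_pder.
Context {R : realType} {d : nat}.
Notation T := 'rV[C R]_d.
Notation mu := (leb R d).
Implicit Types (u f g : T -> R) (v z : T).

(** A derivative with its value, stated as a limit so that the usual rules apply
    pointwise to functions that are differentiable in some directions only. *)
Definition has_pder v u z (l : R) : Prop := diffq v u z h @[h --> 0^'] --> l.

Lemma has_pderP v u z l : has_pder v u z l <->
  is_derive (0 : R) (1 : R) (fun t : R => u (z + rs t v)) l.
Proof.
split.
  move=> h; have dh : pderivable v u z by apply/cvg_ex; exists l.
  have -> : l = real_derive u z v by rewrite derE; apply/esym/cvg_lim.
  exact: pderivable_is_derive.
by move=> /is_derive_pderivable [h <-]; exact: pderivable_cvg.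
Qed.

Lemma has_pder_pderivable v u z : pderivable v u z -> has_pder v u z (real_derive u z v).
Proof. exact: pderivable_cvg. Qed.

Lemma has_pder_der v u z l : has_pder v u z l -> real_derive u z v = l.
Proof. by move=> /has_pderP/is_derive_pderivable []. Qed.

Lemma has_pderW v u z l : has_pder v u z l -> pderivable v u z.
Proof. by move=> h; apply/cvg_ex; exists l. Qed.

Lemma has_pder_cst v c z : has_pder v (fun=> c) z 0.
Proof. by apply/has_pderP; exact: is_derive_cst. Qed.

Lemma has_pderD v f g z a b : has_pder v f z a -> has_pder v g z b ->
  has_pder v (fun y => f y + g y) z (a + b).
Proof. by move=> /has_pderP hf /has_pderP hg; apply/has_pderP; exact: is_deriveD. Qed.

Lemma has_pderB v f g z a b : has_pder v f z a -> has_pder v g z b ->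
  has_pder v (fun y => f y - g y) z (a - b).
Proof. by move=> /has_pderP hf /has_pderP hg; apply/has_pderP; exact: is_deriveB. Qed.

Lemma has_pderM v f g z a b : has_pder v f z a -> has_pder v g z b ->
  has_pder v (fun y => f y * g y) z (f z * b + g z * a).
Proof.
move=> /has_pderP hf /has_pderP hg; apply/has_pderP.
have := is_deriveM hf hg; rewrite /= rs0 addr0; exact.
Qed.

Lemma has_pderZ v f z c a : has_pder v f z a -> has_pder v (fun y => c * f y) z (c * a).
Proof.
move=> hf; have := has_pderM (has_pder_cst v c z) hf; rewrite mulr0 addr0; exact.
Qed.

Lemma has_pder_sum v (I : Type) (s : seq I) (F : I -> T -> R) z (a : I -> R) :
  (forall i, has_pder v (F i) z (a i)) ->
  has_pder v (fun y => \sum_(i <- s) F i y) z (\sum_(i <- s) a i).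
Proof.
move=> h; elim: s => [|i s IH].
  rewrite big_nil; under [X in has_pder _ X]eq_fun do rewrite big_nil; exact: has_pder_cst.
rewrite big_cons; under [X in has_pder _ X]eq_fun do rewrite big_cons.
exact: has_pderD.
Qed.

Lemma has_pder_comp v u z l (phi : R -> R) l' : has_pder v u z l ->
  is_derive (u z) (1 : R) phi l' -> has_pder v (fun y => phi (u y)) z (l' * l).
Proof.
move=> /has_pderP hu hp; apply/has_pderP.
have e : (fun t : R => u (z + rs t v)) 0 = u z by rewrite rs0 addr0.
rewrite -e in hp.
rewrite mulrC.
have := @is_derive1_comp R phi (fun t : R => u (z + rs t v)) 0 l' l hp hu.
by rewrite mulrC.
Qed.

Lemma has_pder_co v i z : has_pder v (co i) z (co i v).
Proof.
apply/has_pderP.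
have -> : (fun t : R => co i (z + rs t v)) = cst (co i z) + (co i v \*: id).
  by apply/funext => t; rewrite coD co_rs mulrC.
have H : is_derive (0 : R) (1 : R) (cst (co i z) + (co i v \*: id)) (0 + co i v *: 1).
  exact: is_deriveD.
by apply: (is_derive_eq H); rewrite add0r [LHS]mulr1.
Qed.

Lemma has_pder_near v u w z l e : 0 < e ->
  (forall y, enorm (y - z) < e -> u y = w y) -> has_pder v u z l -> has_pder v w z l.
Proof.
move=> e0 h; apply: cvg_trans; apply: near_eq_cvg.
have D0 : 0 < enorm v + 1 by rewrite ltr_wpDl// enorm_ge0.
near=> t; rewrite /diffq; congr (_ * (_ - _)); apply: h.
  rewrite addrAC subrr add0r enorm_rs.
  apply: (@le_lt_trans _ _ (`|t| * (enorm v + 1))); first by rewrite ler_wpM2l// lerDl.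
  rewrite -ltr_pdivlMr//; near: t; apply: dnbhs0_lt; exact: divr_gt0.
by rewrite subrr enorm0.
Unshelve. all: by end_near. Qed.

Lemma der_near v u w z e : 0 < e ->
  (forall y, enorm (y - z) < e -> u y = w y) -> real_derive u z v = real_derive w z v.
Proof.
move=> e0 h.
have [hu|nu] := pselect (pderivable v u z).
  by apply/esym/has_pder_der; apply: has_pder_near e0 h _; exact: has_pder_pderivable.
rewrite (der_point nu) der_point// => hw; apply: nu; apply: has_pderW.
by apply: (@has_pder_near v w u z _ e e0 _ (has_pder_pderivable hw)) => y /h.
Qed.

(** Passing to the limit in the inequality between difference quotients. *)
Lemma has_pder_le v f g z a b : (forall y, `|f y - f z| <= `|g y - g z|) ->
  has_pder v f z a -> has_pder v g z b -> `|a| <= `|b|.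
Proof.
move=> h ha hb; apply: (ler_cvg_to (cvg_norm ha) (cvg_norm hb)).
by apply: nearW => t; rewrite /diffq !normrM ler_wpM2l.
Qed.

Lemma has_pder_lip v k u z a : lipk k u -> has_pder v u z a -> `|a| <= k * enorm v.
Proof.
move=> uL ha; apply: (ler_cvg_to (cvg_norm ha) (cvg_cst (k * enorm v))).
near=> t; rewrite /diffq normrM normfV ler_pdivrMl; last first.
  by rewrite normr_gt0; near: t; exact: nbhs_dnbhs_neq.
by rewrite (le_trans (uL _ _))// addrAC subrr add0r enorm_rs mulrCA.
Unshelve. all: by end_near. Qed.

(** Fermat's rule: both one-sided difference quotients at a minimum have a sign. *)
Lemma has_pder_min v h z a : (forall y, 0 <= h y) -> h z = 0 -> has_pder v h z a -> a = 0.
Proof.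
move=> h0 hz ha; apply/eqP; rewrite eq_le; apply/andP; split.
  have [//|a0] := leP a 0.
  move: ha => /cvgrPdist_lt/(_ a a0) [e /= e0 H].
  have e2 : 0 < e / 2 by rewrite divr_gt0.
  have i0 : 0 <= (e / 2)^-1 by rewrite invr_ge0 ltW.
  have := H (- (e / 2)); rewrite /ball_/= sub0r opprK gtr0_norm//.
  have l : e / 2 < e by lra.
  have n0 : - (e / 2) != 0 by rewrite oppr_eq0 gt_eqF.
  move=> /(_ l n0); rewrite ltr_norml /diffq hz subr0 invrN mulNr => /andP[_].
  by have := mulr_ge0 i0 (h0 (z + rs (- (e/2)) v)); lra.
have [//|a0] := leP 0 a.
have a0' : 0 < - a by rewrite oppr_gt0.
move: ha => /cvgrPdist_lt/(_ (-a) a0') [e /= e0 H].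
have e2 : 0 < e / 2 by rewrite divr_gt0.
  have i0 : 0 <= (e / 2)^-1 by rewrite invr_ge0 ltW.
have := H (e / 2); rewrite /ball_/= sub0r normrN gtr0_norm//.
have l : e / 2 < e by lra.
have n0 : e / 2 != 0 by rewrite gt_eqF.
move=> /(_ l n0); rewrite ltr_norml /diffq hz subr0 => /andP[].
by have := mulr_ge0 i0 (h0 (z + rs (e/2) v)); lra.
Qed.

(** The difference between the maximum and the function that attains it is nonnegative
    and vanishes at [z], so Fermat's rule identifies the derivatives. *)
Lemma has_pder_max v f g z a b c : has_pder v f z a -> has_pder v g z b ->
  has_pder v (fun y => Num.max (f y) (g y)) z c ->
  c = if g z <= f z then a else b.
Proof.
move=> ha hb hc; case: (leP (g z) (f z)) => H.
  apply/eqP; rewrite -subr_eq0; apply/eqP.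
  apply: (@has_pder_min v (fun y => Num.max (f y) (g y) - f y) z); last exact: has_pderB.
  - by move=> y; rewrite subr_ge0 le_max lexx.
  - by apply/eqP; rewrite subr_eq0; apply/eqP/max_idPl.
apply/eqP; rewrite -subr_eq0; apply/eqP.
apply: (@has_pder_min v (fun y => Num.max (f y) (g y) - g y) z); last exact: has_pderB.
- by move=> y; rewrite subr_ge0 le_max lexx orbT.
- by apply/eqP; rewrite subr_eq0; apply/eqP/max_idPr/ltW.
Qed.

End has_pder.

(** * Integration by parts *)

Section ibp.
Context {R : realType} {d : nat}.
Notation T := 'rV[C R]_d.
Notation mu := (leb R d).
Implicit Types (u f g : T -> R) (v z : T).

(** A positive constant is required because it serves as a denominator. *)
Definition lip u := exists2 k, 0 < k & lipk k u.

Lemma lipschitz_lip u : lipschitz_Cn u -> lip u.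
Proof.
move=> [k uk]; exists (`|k| + 1); first by rewrite ltr_wpDl.
move=> y z; rewrite (le_trans (uk y z))// ler_wpM2r ?enorm_ge0//.
by have := ler_norm k; lra.
Qed.

Lemma lipW k u : 0 <= k -> lipk k u -> lip u.
Proof. by move=> _ h; apply: lipschitz_lip; exists k. Qed.

Definition bsupp (M : R) u := forall z, M < enorm z -> u z = 0.

(** Kernels and weights are Lipschitz on bounded sets only; multiplied by a function
    of bounded support they become Lipschitz ([lipM_bsupp]). *)
Definition loclip g := forall r, exists2 k, 0 < k & forall y z,
  enorm y <= r -> enorm z <= r -> `|g y - g z| <= k * enorm (y - z).

Lemma lip_loclip u : lip u -> loclip u.
Proof. by move=> [k k0 uk] r; exists k. Qed.

Lemma loclip_econt g : loclip g -> econt g.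
Proof.
move=> gl z e e0; have [k k0 gk] := gl (enorm z + 1).
exists (Num.min 1 (e / k)); first by rewrite lt_min ltr01 divr_gt0.
move=> w; rewrite lt_min => /andP[w1 we].
have wz : enorm w <= enorm z + 1.
  by have := ler_enormD (w - z) z; rewrite subrK; lra.
have zz : enorm z <= enorm z + 1 by lra.
by rewrite (le_lt_trans (gk _ _ wz zz))// mulrC -ltr_pdivlMr.
Qed.

Lemma loclip_measurable g : loclip g ->
  measurable_fun [set: T] (g : T -> measurableTypeR R).
Proof. by move=> /loclip_econt; exact: econt_measurable. Qed.

Lemma loclip_bounded g : loclip g ->
  forall r, exists N, forall z, enorm z <= r -> `|g z| <= N.
Proof.
move=> gl r; have [k k0 gk] := gl (Num.max r 0).
exists (`|g 0| + k * Num.max r 0) => z zr.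
have z1 : enorm z <= Num.max r 0 by rewrite le_max zr.
have z0 : enorm (0 : T) <= Num.max r 0 by rewrite enorm0 le_max lexx orbT.
have := gk _ _ z1 z0; rewrite subr0 => h.
have : k * enorm z <= k * Num.max r 0 by rewrite ler_wpM2l// ltW.
have := ler_normD (g z - g 0) (g 0); rewrite subrK; lra.
Qed.

Lemma loclip_cst c : loclip (fun=> c).
Proof. by move=> r; exists 1 => // y z _ _; rewrite subrr normr0 mul1r enorm_ge0. Qed.

Lemma loclip_co i : loclip (co i).
Proof.
by move=> r; exists 1 => // y z _ _; rewrite mul1r -coB; exact: co_le_enorm.
Qed.

Lemma loclipD f g : loclip f -> loclip g -> loclip (fun z => f z + g z).
Proof.
move=> lf lg r; have [k k0 fk] := lf r; have [l l0 gl] := lg r.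
exists (k + l); first exact: addr_gt0.
move=> y z yr zr; rewrite opprD addrACA mulrDl (le_trans (ler_normD _ _))//.
by rewrite lerD// ?fk ?gl.
Qed.

Lemma loclipM f g : loclip f -> loclip g -> loclip (fun z => f z * g z).
Proof.
move=> lf lg r; have [k k0 fk] := lf r; have [l l0 gl] := lg r.
have [F hF] := loclip_bounded lf r; have [G hG] := loclip_bounded lg r.
exists (k * (`|G| + 1) + (`|F| + 1) * l).
  by rewrite addr_gt0// mulr_gt0// ltr_wpDl.
move=> y z yr zr.
have -> : f y * g y - f z * g z = (f y - f z) * g y + f z * (g y - g z) by ring.
rewrite (le_trans (ler_normD _ _))// [leRHS]mulrDl !normrM lerD//.
  rewrite mulrAC ler_pM ?fk//.
  by rewrite (le_trans (hG y yr))// (le_trans (ler_norm _))// lerDl.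
rewrite -mulrA ler_pM ?gl//.
by rewrite (le_trans (hF z zr))// (le_trans (ler_norm _))// lerDl.
Qed.

Lemma loclipN f : loclip f -> loclip (fun z => - f z).
Proof.
move=> lf; have := loclipM (loclip_cst (-1)) lf.
by under eq_fun do rewrite mulN1r.
Qed.

Lemma loclipB f g : loclip f -> loclip g -> loclip (fun z => f z - g z).
Proof. by move=> lf lg; apply: loclipD => //; exact: loclipN. Qed.

Lemma loclip_sum (I : Type) (s : seq I) (F : I -> T -> R) :
  (forall i, loclip (F i)) -> loclip (fun z => \sum_(i <- s) F i z).
Proof.
move=> h; elim: s => [|i s IH].
  by under eq_fun do rewrite big_nil; exact: loclip_cst.
by under eq_fun do rewrite big_cons; exact: loclipD.
Qed.

Lemma loclip_comp f (phi : R -> R) (c k : R) : loclip f -> 0 < k ->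
  (forall z, c <= f z) ->
  (forall s t, c <= s -> c <= t -> `|phi s - phi t| <= k * `|s - t|) ->
  loclip (fun z => phi (f z)).
Proof.
move=> lf k0 cf h r; have [l l0 fl] := lf r.
exists (k * l); first exact: mulr_gt0.
move=> y z yr zr; rewrite (le_trans (h _ _ _ _))// -mulrA ler_wpM2l ?(ltW k0)//.
exact: fl.
Qed.

Lemma lipD f g : lip f -> lip g -> lip (fun z => f z + g z).
Proof.
move=> [k k0 fk] [l l0 gl]; exists (k + l); first exact: addr_gt0.
move=> y z; rewrite opprD addrACA mulrDl (le_trans (ler_normD _ _))//.
by rewrite lerD// ?fk ?gl.
Qed.

Lemma lip_cst c : lip (fun=> c).
Proof. by exists 1 => // y z; rewrite subrr normr0 mul1r enorm_ge0. Qed.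

Lemma lip_comp f (phi : R -> R) k : 0 < k -> lip f ->
  (forall s t, `|phi s - phi t| <= k * `|s - t|) -> lip (fun z => phi (f z)).
Proof.
move=> k0 [l l0 fl] h; exists (k * l); first exact: mulr_gt0.
by move=> y z; rewrite (le_trans (h _ _))// -mulrA ler_wpM2l ?(ltW k0).
Qed.

Lemma lipN f : lip f -> lip (fun z => - f z).
Proof.
move=> lf; apply: (@lip_comp f -%R 1) => // s t.
by rewrite mul1r -opprD normrN.
Qed.

Lemma lip_max f g : lip f -> lip g -> lip (fun z => Num.max (f z) (g z)).
Proof.
move=> [k k0 fk] [l l0 gl]; exists (k + l); first exact: addr_gt0.
move=> y z; have := fk y z; have := gl y z; have := enorm_ge0 (y - z).
move: (f y) (f z) (g y) (g z) => a b c e E0 h1 h2.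
have H1 : k * enorm (y - z) <= (k + l) * enorm (y - z) by rewrite ler_wpM2r// lerDl ltW.
have H2 : l * enorm (y - z) <= (k + l) * enorm (y - z) by rewrite ler_wpM2r// lerDr ltW.
move: (le_trans h1 H2) (le_trans h2 H1); move: ((k + l) * enorm _) => N.
rewrite !ler_norml => /andP[? ?] /andP[? ?].
by case: (leP a c) => ?; case: (leP b e) => ?; apply/andP; split; lra.
Qed.

(** If one of the points lies outside the support, [g] is only needed at the other one,
    where it is bounded. *)
Lemma lipM_bsupp M f g : lip f -> bsupp M f -> loclip g -> lip (fun z => g z * f z).
Proof.
move=> lf bf lg.
have lfg := loclipM lg (lip_loclip lf).
have [l l0 gl] := lfg M.
have [N hN] := loclip_bounded lg M; have [k k0 fk] := lf.
have N1 : 0 < `|N| + 1 by rewrite ltr_wpDl.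
exists (l + (`|N| + 1) * k); first by rewrite addr_gt0// mulr_gt0.
have H y z : enorm y <= M -> M < enorm z ->
    `|g y * f y - g z * f z| <= (l + (`|N| + 1) * k) * enorm (y - z).
  move=> yM zM; rewrite (bf z zM) mulr0 -(bf z zM) -[g y * f y - _](_ : g y * (f y - f z) = _); last first.
    by rewrite mulrBr (bf z zM) mulr0.
  rewrite normrM mulrDl ler_wpDl//; first by rewrite mulr_ge0 ?enorm_ge0// ltW.
  rewrite -mulrA ler_pM ?fk//.
  by rewrite (le_trans (hN y yM))// (le_trans (ler_norm _))// lerDl.
move=> y z; have [yM|yM] := leP (enorm y) M; have [zM|zM] := leP (enorm z) M.
- rewrite (le_trans (gl _ _ yM zM))// ler_wpM2r ?enorm_ge0// lerDl ltW//.
  by rewrite mulr_gt0.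
- exact: H.
- by rewrite distrC enormBC; exact: H.
- rewrite (bf y yM) (bf z zM) !mulr0 subrr normr0 mulr_ge0 ?enorm_ge0//.
  by rewrite addr_ge0 ?mulr_ge0// ltW.
Qed.

Lemma bsuppMl M f g : bsupp M f -> bsupp M (fun z => g z * f z).
Proof. by move=> bf z /bf ->; rewrite mulr0. Qed.

Lemma bmc_lip M u : lip u -> bsupp M u -> bmc u.
Proof.
move=> lu bu; split; first exact: (loclip_measurable (lip_loclip lu)).
have [N hN] := loclip_bounded (lip_loclip lu) M.
exists (Num.max `|N| M) => z; split; last first.
  by rewrite gt_max => /andP[_ h]; exact: bu.
have [h|h] := leP (enorm z) M; last by rewrite bu// normr0 le_max normr_ge0.
by rewrite le_max (le_trans (hN z h)) ?ler_norm.
Qed.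

Lemma der_out M u v z : bsupp M u -> M < enorm z -> real_derive u z v = 0.
Proof.
move=> bu Mz; have e0 : 0 < enorm z - M by rewrite subr_gt0.
rewrite (@der_near _ _ v u (fun=> 0) z _ e0) ?(has_pder_der (has_pder_cst v 0 z))//.
move=> y yz; apply: bu.
by have := ler_enormB3 z 0 y; rewrite !subr0 (enormBC z); lra.
Qed.

Lemma bmc_der M u v : lip u -> bsupp M u -> bmc (fun z => real_derive u z v).
Proof.
move=> [k k0 uk] bu; split; first exact: measurable_der uk.
exists (Num.max M (Num.max (k * enorm v) `|point : R|)) => z; split; last first.
  by rewrite gt_max => /andP[h _]; exact: der_out bu h.
have [h|h] := pselect (pderivable v u z).
  by rewrite !le_max (has_pder_lip uk (has_pder_pderivable h)) orbT.
by rewrite der_point// !le_max lexx !orbT.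
Qed.

Lemma bmc_trans u a : bmc u -> bmc (fun z => u (z + a)).
Proof.
move=> [mu_ [M hM]]; split.
  exact: (measurableT_comp mu_ (co_trans_measurable a)).
have M0 : 0 <= M by rewrite (le_trans _ (hM 0).1).
exists (M + enorm a) => z; split.
  by rewrite (le_trans (hM _).1)// lerDl enorm_ge0.
move=> h; rewrite (hM _).2//.
by have := ler_enormD (z + a) (- a); rewrite addrK enormN; lra.
Qed.

Lemma intg_trans u a : bmc u -> intg (fun z => u (z + a)) = intg u.
Proof.
move=> hu; rewrite /intg /Rintegral; congr fine.
exact: (integral_trans a (bmc_integrable hu)).
Qed.

(** Each difference quotient has integral 0 by translation invariance, and the
    quotients are dominated by a constant on a fixed cube. *)
Lemma intg_der0 M u v : lip u -> bsupp M u -> intg (fun z => real_derive u z v) = 0.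
Proof.
move=> lu bu; have [k k0 uk] := lu.
have hu := bmc_lip lu bu.
pose t n : R := n.+1%:R^-1.
pose g n z := diffq v u z (t n).
have bg n : bmc (g n).
  by apply: bmcZ; apply: bmcB => //; exact: bmc_trans.
have g0 n : intg (g n) = 0.
  rewrite /g /diffq intgZ; last by apply: bmcB => //; exact: bmc_trans.
  by rewrite intgB ?intg_trans ?subrr ?mulr0//; exact: bmc_trans.
pose B z : R := k * enorm v * \1_(cube d (M + enorm v) : set T) z.
have bB : bmc B.
  split.
    apply: measurable_funM; first exact: measurable_cst.
    by apply: measurable_indic; exact: measurable_cube.
  exists (Num.max (k * enorm v) ((2 * d)%:R * (M + enorm v))) => z; split.
    rewrite le_max /B indicE; case: (_ \in _); rewrite ?mulr1 ?mulr0 ?normr0.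
      by rewrite ger0_norm ?lexx// mulr_ge0 ?enorm_ge0// ltW.
    by rewrite mulr_ge0 ?enorm_ge0// ltW.
  rewrite gt_max => /andP[_ h]; rewrite /B indicE memNset ?mulr0// => hz.
  by have := enorm_le_max hz; rewrite leNgt h.
have t0 n : t n != 0 by rewrite invr_eq0 pnatr_eq0.
have gB n z : `|g n z| <= B z.
  rewrite /B indicE; have [zc|zc] := boolP (z \in _).
    rewrite mulr1 /g /diffq normrM normfV ler_pdivrMl ?normr_gt0 ?t0//.
    by rewrite (le_trans (uk _ _))// addrAC subrr add0r enorm_rs mulrCA.
  rewrite mulr0 /g /diffq.
  have [i zi] : exists i, M + enorm v < `|co i z|.
    move: zc; rewrite notin_setE /cube/= => /existsNP[i /negP]; rewrite -ltNge => zi.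
    by exists i.
  have e1 := lt_le_trans zi (co_le_enorm i z).
  have tn : enorm (rs (t n) v) <= enorm v.
    rewrite enorm_rs ler_piMl ?enorm_ge0// ger0_norm ?invr_ge0//.
    by rewrite invf_le1// ler1n.
  rewrite !bu ?subrr ?mulr0 ?normr0//.
    by have := enorm_ge0 v; lra.
  by have := ler_enormD (z + rs (t n) v) (- rs (t n) v); rewrite addrK enormN; lra.
have [] := @dominated_convergence _ _ _ mu setT measurableT
  (fun n => EFin \o g n) (EFin \o (fun z => real_derive u z v)) (EFin \o B).
- by move=> n; apply/measurable_EFinP; exact: (bg n).1.
- by apply/measurable_EFinP; exact: measurable_der uk.
- apply: aeS (lip_ae_pderivable v uk) => z /has_pder_pderivable/cvgrPdist_lt H _.
  apply: cvg_EFin; first by apply: nearW.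
  apply/cvgrPdist_lt => e /H [r /= r0 {}H]; near=> n.
  apply: H; last by rewrite invr_eq0.
  rewrite /ball_/= sub0r normrN ger0_norm ?invr_ge0//.
  by near: n; exact: near_infty_natSinv_lt (PosNum r0).
- exact: bmc_integrable.
- by apply: aeW => z n _; rewrite /= lee_fin; exact: gB.
move=> _ _.
rewrite (_ : (fun n => _) = cst 0%E); last first.
  by apply/funext => n; rewrite /= intgE// g0.
move=> /cvg_lim; rewrite lim_cst// => /(_ (@ereal_hausdorff R)).
by rewrite /intg /Rintegral => <-.
Unshelve. all: by end_near. Qed.

Lemma ibp M g g' u v : lip u -> bsupp M u -> loclip g ->
  (forall z, has_pder v g z (g' z)) ->
  measurable_fun [set: T] (g' : T -> measurableTypeR R) ->
  (forall r, exists N, forall z, enorm z <= r -> `|g' z| <= N) ->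
  intg (fun z => g z * real_derive u z v) = - intg (fun z => g' z * u z).
Proof.
move=> lu bu lg hg mg' bg'.
have [k k0 uk] := lu.
have lgu := lipM_bsupp lu bu lg.
have bgu := bsuppMl g bu.
have b1 : bmc (fun z => g z * real_derive u z v).
  apply: bmcM; [exact: bmc_der bu|exact: loclip_measurable|exact: loclip_bounded].
have b2 : bmc (fun z => g' z * u z).
  by apply: bmcM => //; exact: bmc_lip bu.
apply/eqP; rewrite -addr_eq0 -intgD//; apply/eqP.
rewrite -(intg_der0 v lgu bgu); apply: intg_ae.
- exact: bmcD.
- exact: bmc_der bgu.
apply: aeS (lip_ae_pderivable v uk) => z /has_pder_pderivable hu.
by rewrite (has_pder_der (has_pderM (hg z) hu)) [u z * _]mulrC.
Qed.

End ibp.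

(** * Tent functions at dyadic scales *)

Section hat.
Context {R : realType}.
Implicit Types s t : R.

Definition hat1 t : R := Num.max 0 (1 - `|t|).

Lemma hat1_ge0 t : 0 <= hat1 t. Proof. by rewrite /hat1 le_max lexx. Qed.

Lemma hat1_le1 t : hat1 t <= 1.
Proof. by rewrite /hat1 ge_max ler01/= gerBl. Qed.

Lemma hat1_out t : 1 <= `|t| -> hat1 t = 0.
Proof. by move=> h; apply/max_idPl; rewrite subr_le0. Qed.

Lemma hat1_lip s t : `|hat1 s - hat1 t| <= `|s - t|.
Proof.
rewrite /hat1; have := ler_dist_dist s t; move: (`|s - t|) => e.
rewrite !ler_norml => /andP[? ?].
by case: (leP 0 (1 - `|s|)) => ?; case: (leP 0 (1 - `|t|)) => ?; apply/andP; split; lra.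
Qed.

(** Weights of the two-scale relation of the tent function: 1 for the middle child and
    1/2 for its two neighbours. *)
Definition two_scale (e : 'I_3) : R := if e == 1%N :> nat then 1 else 2^-1.

Lemma hat1_refine t : hat1 t = \sum_(e < 3) two_scale e * hat1 (2 * t - (e%:R - 1)).
Proof.
rewrite !big_ord_recl big_ord0 /two_scale/= /bump/= !addn0 /hat1.
rewrite [1%:R](_ : _ = 1)//.
have -> : 2%:R - 1 = 1 :> R by lra.
rewrite subrr subr0 sub0r opprK addr0 mul1r.
have a1 := ler_norm t.
case: (lerP 0 t) => t0; [rewrite (ger0_norm t0)|rewrite (ltr0_norm t0)].
- rewrite (ger0_norm (x := 2 * t)); last lra.
  rewrite (ger0_norm (x := 2 * t + 1)); last lra.
  case: (lerP 0 (2 * t - 1)) => t1; [rewrite (ger0_norm t1)|rewrite (ltr0_norm t1)];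
   case: leP => ?; case: leP => ?; case: leP => ?; case: leP => ?; lra.
- rewrite (ltr0_norm (x := 2 * t)); last lra.
  rewrite (ltr0_norm (x := 2 * t - 1)); last lra.
  case: (lerP 0 (2 * t + 1)) => t1; [rewrite (ger0_norm t1)|rewrite (ltr0_norm t1)];
   case: leP => ?; case: leP => ?; case: leP => ?; case: leP => ?; lra.
Qed.

Lemma hat1_partition (n : nat) s : 0 <= s ->
  \sum_(k < n) hat1 (s - k%:R) = Num.min 1 (Num.max 0 (n%:R - s)).
Proof.
move=> s0; elim: n => [|n IH].
  rewrite big_ord0 sub0r (max_idPl _) ?oppr_le0// (min_idPr _)//.
rewrite big_ord_recr/= IH -natr1 /hat1.
move: (n%:R) => N.
case: (lerP 0 (s - N)) => t1; [rewrite (ger0_norm t1)|rewrite (ltr0_norm t1)];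
  rewrite /Num.min /Num.max; case: (ltP 0 (N - s)) => ?; case: (ltP 0 (N + 1 - s)) => ?; do ![case: ltP => ?]; lra.
Qed.

Lemma prod_lip (I : finType) (x y : I -> R) :
  (forall i, 0 <= x i <= 1) -> (forall i, 0 <= y i <= 1) ->
  `|\prod_i x i - \prod_i y i| <= \sum_i `|x i - y i|.
Proof.
move=> hx hy.
suff [] : [/\ 0 <= \prod_i x i <= 1, 0 <= \prod_i y i <= 1 &
   `|\prod_i x i - \prod_i y i| <= \sum_i `|x i - y i|] by [].
apply: (big_ind3 (fun a b c => [/\ 0 <= a <= 1, 0 <= b <= 1 & `|a - b| <= c])).
- by rewrite subrr normr0 ler01 lexx.
- move=> a b c a' b' c' [/andP[a0 a1] /andP[b0 b1] ab] [/andP[a'0 a'1] /andP[b'0 b'1] ab'].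
  split; rewrite ?mulr_ge0 ?mulr_ile1//.
  have -> : a * a' - b * b' = (a - b) * a' + b * (a' - b') by ring.
  rewrite (le_trans (ler_normD _ _))// !normrM lerD//.
    by rewrite (le_trans _ ab)// ler_piMr// ger0_norm.
  by rewrite (le_trans _ ab')// ler_piMl// ger0_norm.
- by move=> i _; rewrite hx hy.
Qed.

End hat.

Section hatn.
Context {R : realType} {d : nat}.
Notation T := 'rV[C R]_d.
Notation I := (@ix d).
Implicit Types (c : I -> R) (z : T).

Definition hat c (n : nat) z : R := \prod_i hat1 (2 ^+ n * (co i z - c i)).

(** The children of a tent centred at [c] at scale [n] are the 3^(2d) tents of half the
    width centred on the half-spacing grid around [c]. *)
Definition child c n (g : {ffun I -> 'I_3}) : I -> R :=
  fun i => c i + ((g i)%:R - 1) * 2 ^- n.+1.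

Lemma hat_refine c n z :
  hat c n z = \sum_(g : {ffun I -> 'I_3}) (\prod_i two_scale (g i)) * hat (child c n g) n.+1 z.
Proof.
rewrite /hat.
transitivity (\prod_(i : I) \sum_(e < 3) two_scale e *
    hat1 (2 ^+ n.+1 * (co i z - (c i + (e%:R - 1) * 2 ^- n.+1))) :> R).
  apply: eq_bigr => i _; rewrite hat1_refine; apply: eq_bigr => e _.
  congr (_ * hat1 _); have P0 : (2 : R) ^+ n != 0 by rewrite expf_neq0.
  by rewrite exprS; move: ((2 : R) ^+ n) (e%:R : R) P0 => P E P0; field.
by rewrite bigA_distr_bigA; apply: eq_bigr => g _; rewrite big_split.
Qed.

(** The weights of the children add up to 2 in each of the 2d real directions.  This is
    the reciprocal of the volume ratio between a parent and a child. *)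
Lemma sum_two_scale : \sum_(g : {ffun I -> 'I_3}) (\prod_i two_scale (g i)) = 2 ^+ (2 * d) :> R.
Proof.
rewrite -(bigA_distr_bigA (fun (i : I) e => two_scale e : R)).
under eq_bigr => i _.
  rewrite !big_ord_recl big_ord0 /two_scale/=.
  rewrite (_ : 2^-1 + (1 + (2^-1 + 0)) = 2 :> R); last by lra.
  over.
by rewrite prodr_const card_prod card_ord card_bool mulnC.
Qed.

Lemma two_scale_ge0 e : 0 <= two_scale e :> R.
Proof. by rewrite /two_scale; case: ifP. Qed.

Lemma hat_ge0 c n z : 0 <= hat c n z.
Proof. by apply: prodr_ge0 => i _; exact: hat1_ge0. Qed.

Lemma hat_le1 c n z : hat c n z <= 1.
Proof. by apply: prodr_ile1 => i _; rewrite hat1_ge0 hat1_le1. Qed.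

Lemma hat_lip c n : lipk ((2 * d)%:R * 2 ^+ n) (hat c n).
Proof.
move=> y z.
have h u (i : I) : 0 <= hat1 (2 ^+ n * (co i u - c i)) <= 1 by rewrite hat1_ge0 hat1_le1.
rewrite (le_trans (prod_lip (h y) (h z)))//.
have cI : (2 * d)%N = #|I| by rewrite card_prod card_ord card_bool mulnC.
rewrite -mulrA mulr_natl cI -sumr_const; apply: ler_sum => i _.
rewrite (le_trans (hat1_lip _ _))// -mulrBr normrM ger0_norm ?exprn_ge0//.
have -> : co i y - c i - (co i z - c i) = co i (y - z) by rewrite coB; ring.
by rewrite ler_wpM2l ?exprn_ge0// co_le_enorm.
Qed.

Lemma hat_out c n z i : 2 ^- n <= `|co i z - c i| -> hat c n z = 0.
Proof.
move=> h; rewrite /hat (bigD1 i)//= hat1_out ?mul0r//.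
by rewrite normrM ger0_norm ?exprn_ge0// -ler_pdivrMl ?exprn_gt0// mulr1.
Qed.

(** Integer translates of the unit tent form a partition of unity on any bounded
    region; [N.*2.+1] of them are enough in each direction. *)
Lemma hat_partition (N : nat) z : (forall i, `|co i z| <= N%:R) ->
  \sum_(g : {ffun I -> 'I_(N.*2.+1)}) hat (fun i => (g i)%:R - N%:R) 0 z = 1.
Proof.
move=> hz; rewrite /hat.
rewrite -(bigA_distr_bigA (fun (i : I) (e : 'I_(N.*2.+1)) => hat1 (2 ^+ 0 * (co i z - (e%:R - N%:R))))).
apply: big1 => i _.
have := hz i; rewrite ler_norml => /andP[h1 h2].
transitivity (\sum_(e < N.*2.+1) hat1 (co i z + N%:R - e%:R)).
  by apply: eq_bigr => e _; congr hat1; rewrite expr0 mul1r; ring.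
have h0 : 0 <= co i z + N%:R by lra.
rewrite hat1_partition//; apply/min_idPl.
by rewrite le_max -natr1 -addnn natrD; apply/orP; right; lra.
Qed.

End hatn.

(** * Weak Cauchy-Riemann equations *)

Section finae.
Context (dp : measure_display) (X : measurableType dp) (R : realType).
Variable m : {measure set X -> \bar R}.

Lemma ae_fin (K : finType) (P : K -> X -> Prop) :
  (forall k, {ae m, forall x, P k x}) -> {ae m, forall x, forall k, P k x}.
Proof.
move=> h.
have : m.-negligible (\big[setU/set0]_(k : K) (~` [set x | P k x])).
  apply: (big_ind (fun A => m.-negligible A)) => [|A B|k _].
  - exact: negligible_set0.
  - exact: negligibleU.
  - exact: h.
apply: negligibleS => x /= /existsNP[k nk].
by rewrite (bigD1 k)//=; left.
Qed.
End finae.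

Section weakdiv.
Context {R : realType} {d : nat}.
Notation T := 'rV[C R]_d.
Notation I := (@ix d).
Notation mu := (leb R d).

(** The real and imaginary parts of an analytic function are differentiable at each point,
    but their derivatives are not known to be continuous or integrable; local boundedness
    is what makes the pairings below finite. *)
Definition locb (a : T -> R) : Prop :=
  measurable_fun [set: T] (a : T -> measurableTypeR R) /\
  forall r, exists N, forall z, enorm z <= r -> `|a z| <= N.

Definition lin (al : I -> R) (y : T) : R := \sum_i al i * co i y.

Definition lin_approx (a : T -> R) (al : I -> R) (z : T) : Prop :=
  forall e, 0 < e -> exists2 r, 0 < r & forall y, enorm (y - z) < r ->
    `|a y - a z - lin al (y - z)| <= e * enorm (y - z).

Lemma lip_sum (K : finType) (c : K -> R) (F : K -> T -> R) :
  (forall k, lip (F k)) -> lip (fun z => \sum_k c k * F k z).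
Proof.
move=> lF.
have H (s : seq K) : lip (fun z => \sum_(k <- s) c k * F k z).
  elim: s => [|k s IH].
    by under eq_fun do rewrite big_nil; exact: lip_cst.
  under eq_fun do rewrite big_cons.
  apply: lipD => //; have [l l0 Fl] := lF k.
  apply: (@lipW _ _ (`|c k| * l)); first by rewrite mulr_ge0// ltW.
  by move=> y z; rewrite -mulrBr normrM -mulrA ler_wpM2l.
exact: H.
Qed.

Variables (a b : T -> R) (v w : T).
Hypotheses (ha : locb a) (hb : locb b).

(** The pairing that integrates by parts to minus the integral of [psi] times the
    difference between the derivatives of [a] along [v] and of [b] along [w]. *)
Definition weak_pairing (psi : T -> R) : R :=
  intg (fun z => a z * real_derive psi z v - b z * real_derive psi z w).

Lemma bmc_weak_pairing M psi : lip psi -> bsupp M psi ->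
  bmc (fun z => a z * real_derive psi z v - b z * real_derive psi z w).
Proof.
case: ha hb => ma la [mb lb] lp bp.
by apply: bmcB; apply: bmcM => //; exact: bmc_der bp.
Qed.

Lemma weak_pairing_sum M (K : finType) (c : K -> R) (F : K -> T -> R) :
  (forall k, lip (F k)) -> (forall k, bsupp M (F k)) ->
  weak_pairing (fun z => \sum_k c k * F k z) = \sum_k c k * weak_pairing (F k).
Proof.
move=> lF bF.
have lS := lip_sum c lF.
have bS : bsupp M (fun z => \sum_k c k * F k z).
  by move=> z Mz; apply: big1 => k _; rewrite bF// mulr0.
have bw k := bmc_weak_pairing (lF k) (bF k).
rewrite /weak_pairing; under [RHS]eq_bigr do rewrite -intgZ//.
rewrite -intg_sum; last by move=> k; exact: bmcZ.
apply: intg_ae; [exact: bmc_weak_pairing bS|by apply: bmc_sum => k; exact: bmcZ|].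
have H x : {ae mu, forall z, forall k, pderivable x (F k) z}.
  by apply: ae_fin => k; have [l l0 Fl] := lF k; exact: lip_ae_pderivable Fl.
apply: aeS2 (H v) (H w) => z hv hw.
have E x : (forall k, pderivable x (F k) z) ->
    real_derive (fun z => \sum_k c k * F k z) z x = \sum_k c k * real_derive (F k) z x.
  move=> hx; apply: has_pder_der; apply: has_pder_sum => k; apply: has_pderZ.
  exact: has_pder_pderivable.
rewrite !E//.
rewrite !mulr_sumr -sumrB; apply: eq_bigr => k _; ring.
Qed.

Variables (psi : T -> R) (M : R).
Hypotheses (lpsi : lip psi) (bpsi : bsupp M psi).

(** The test function localised to a tent; the tents play the role of the triangles of
    Goursat's proof. *)
Definition hcut (c : I -> R) n z := hat c n z * psi z.

Lemma lip_hat c n : lip (@hat R d c n).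
Proof. by apply: lipW (hat_lip c n); rewrite mulr_ge0// exprn_ge0. Qed.

Lemma lip_hcut c n : lip (hcut c n).
Proof. exact: (lipM_bsupp lpsi bpsi (lip_loclip (lip_hat c n))). Qed.

Lemma bsupp_hcut c n : bsupp M (hcut c n).
Proof. exact: bsuppMl. Qed.

Lemma weak_pairing_refine c n : weak_pairing (hcut c n) =
  \sum_(g : {ffun I -> 'I_3}) (\prod_i two_scale (g i)) * weak_pairing (hcut (child c n g) n.+1).
Proof.
rewrite -(@weak_pairing_sum M); last 2 first.
- by move=> g; exact: lip_hcut.
- by move=> g; exact: bsupp_hcut.
congr weak_pairing; apply/funext => z; rewrite /hcut hat_refine mulr_suml.
by apply: eq_bigr => g _; rewrite mulrA.
Qed.

(** A parent is the combination of its children with total weight 2^(2d), so the child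
    with the largest pairing loses at most that factor. *)
Lemma weak_pairing_child c n : exists c' : I -> R,
  (forall i, `|c' i - c i| <= 2 ^- n.+1) /\
  `|weak_pairing (hcut c n)| <= 2 ^+ (2 * d) * `|weak_pairing (hcut c' n.+1)|.
Proof.
pose t (g : {ffun I -> 'I_3}) := `|weak_pairing (hcut (child c n g) n.+1)|.
pose g0 : {ffun I -> 'I_3} := [ffun=> ord0].
have [g _ hg] := @Order.TotalTheory.arg_maxP _ _ _ g0 xpredT t isT.
exists (child c n g); split.
  move=> i; rewrite /child addrAC subrr add0r normrM (@ger0_norm _ (2 ^- n.+1)); last first.
    by rewrite invr_ge0 exprn_ge0.
  rewrite ler_piMl ?invr_ge0 ?exprn_ge0//.
  case: (g i) => -[|[|[|//]]] _ /=; rewrite ?sub0r ?normrN1 ?subrr ?normr0//.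
  by rewrite (_ : 2%:R - 1 = 1 :> R) ?normr1//; lra.
rewrite weak_pairing_refine (le_trans (ler_norm_sum _ _ _))// -sum_two_scale mulr_suml.
apply: ler_sum => g' _; rewrite normrM ger0_norm; last first.
  by apply: prodr_ge0 => i _; exact: two_scale_ge0.
apply: ler_wpM2l; first by apply: prodr_ge0 => i _; exact: two_scale_ge0.
exact: (hg g' isT).
Qed.

Lemma weak_pairing_partition : weak_pairing psi != 0 -> exists c, weak_pairing (hcut c 0) != 0.
Proof.
move=> h; apply: contrapT => hn; move: h; apply/negP; rewrite negbK.
have hc c : weak_pairing (hcut c 0) = 0.
  by apply/eqP; apply: contrapT => /negP k; apply: hn; exists c.
pose N := Num.bound `|M|.
have MN : M <= N%:R.
  by rewrite (le_trans (ler_norm _))// ltW// /N archi_boundP.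
have -> : psi = (fun z => \sum_(g : {ffun I -> 'I_(N.*2.+1)}) 1 * hcut (fun i => (g i)%:R - N%:R) 0 z).
  apply/funext => z; under eq_bigr do rewrite mul1r.
  rewrite /hcut -mulr_suml.
  have [h|h] := leP (enorm z) M; last by rewrite bpsi// mulr0.
  rewrite hat_partition ?mul1r// => i.
  by rewrite (le_trans (co_le_enorm _ _))// (le_trans h).
rewrite (@weak_pairing_sum M); last 2 first.
- by move=> g; exact: lip_hcut.
- by move=> g; exact: bsupp_hcut.
by apply/eqP; apply: big1 => g _; rewrite hc mulr0.
Qed.

Lemma weak_pairing_seq c0 : exists cs : nat -> I -> R, cs 0%N = c0 /\ forall n,
  (forall i, `|cs n.+1 i - cs n i| <= 2 ^- n.+1) /\
  `|weak_pairing (hcut (cs n) n)| <= 2 ^+ (2 * d) * `|weak_pairing (hcut (cs n.+1) n.+1)|.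
Proof.
have [f hf] := choice (fun nc => weak_pairing_child nc.2 nc.1).
by exists (fix cs n := if n is n'.+1 then f (n', cs n') else c0); split => // n; exact: (hf (n, _)).
Qed.

Lemma weak_pairing_seq_ge (cs : nat -> I -> R) :
  (forall n, `|weak_pairing (hcut (cs n) n)| <= 2 ^+ (2 * d) * `|weak_pairing (hcut (cs n.+1) n.+1)|) ->
  forall n, `|weak_pairing (hcut (cs 0%N) 0)| <= (2 ^+ (2 * d)) ^+ n * `|weak_pairing (hcut (cs n) n)|.
Proof.
move=> h; elim=> [|n IH]; first by rewrite expr0 mul1r.
apply: (le_trans IH); rewrite exprSr -mulrA; apply: ler_wpM2l (h n).
by rewrite !exprn_ge0.
Qed.

(** Consecutive centres differ by at most 2^-(n+1), hence they converge, as in the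
    intersection of nested intervals. *)
Lemma nested_lim (cs : nat -> I -> R) :
  (forall n i, `|cs n.+1 i - cs n i| <= 2 ^- n.+1) ->
  exists z : T, forall n i, `|cs n i - co i z| <= 2 ^- n.
Proof.
move=> cs_dist.
pose L i n := cs n i - 2 ^- n; pose U i n := cs n i + 2 ^- n.
have P n : 2 ^- n = 2 ^- n.+1 + 2 ^- n.+1 :> R.
  by rewrite exprS invfM; move: ((2 ^+ n)^-1) => x; lra.
have P0 n : 0 <= 2 ^- n :> R by rewrite invr_ge0 exprn_ge0.
have LS i n k : L i n <= L i (n + k)%N.
  elim: k => [|k IH]; first by rewrite addn0.
  rewrite (le_trans IH)// addnS /L; have := cs_dist (n + k)%N i.
  rewrite ler_norml => /andP[h1 h2]; have := P (n + k)%N; lra.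
have US i n k : U i (n + k)%N <= U i n.
  elim: k => [|k IH]; first by rewrite addn0.
  rewrite (le_trans _ IH)// addnS /U; have := cs_dist (n + k)%N i.
  rewrite ler_norml => /andP[h1 h2]; have := P (n + k)%N; lra.
have LU i n k : L i n <= U i k.
  have := LS i n k; have := US i k n; rewrite addnC /L /U.
  by have := P0 (n + k)%N; lra.
pose zc i := sup (range (L i)).
have hs i : has_sup (range (L i)).
  split; first by exists (L i 0%N), 0%N.
  by exists (U i 0%N) => _ [n _ <-].
have h1 i n : L i n <= zc i by apply: ub_le_sup; [exact: (hs i).2|exists n].
have h2 i n : zc i <= U i n by apply: ge_sup; [exact: (hs i).1|move=> _ [k _ <-]].
exists (\row_j (Complex (zc (j, false)) (zc (j, true)) : C R)) => n i.
have -> : co i (\row_j (Complex (zc (j, false)) (zc (j, true)) : C R)) = zc i.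
  by case: i => j []; rewrite /co/= mxE.
have := h1 i n; have := h2 i n; rewrite /L /U ler_norml => ? ?; apply/andP; split; lra.
Qed.

End weakdiv.

Section weakdiv0.
Context {R : realType} {d : nat}.
Notation T := 'rV[C R]_d.
Notation I := (@ix d).
Implicit Types (a b psi chi : T -> R) (v w z : T).

Lemma bmc_indic_cube (c r : R) z : bmc (fun y => c * \1_(cube d r : set T) (y - z)).
Proof.
apply: bmcZ; apply: (bmc_trans (u := \1_(cube d r : set T))).
split; first by apply: measurable_indic; exact: measurable_cube.
exists (Num.max 1 ((2 * d)%:R * r)) => y; split.
  by rewrite le_max indicE; case: (_ \in _); rewrite ?normr1 ?normr0 ?lexx ?ler01.
rewrite gt_max => /andP[_ h]; rewrite indicE memNset// => hy.
by have := enorm_le_max hy; rewrite leNgt h.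
Qed.

Lemma intg_indic_cube (c r : R) z : 0 <= r ->
  intg (fun y => c * \1_(cube d r : set T) (y - z)) = c * (2 * r) ^+ (2 * d).
Proof.
move=> r0; have hb := bmc_indic_cube 1 r 0.
have hb' : bmc (\1_(cube d r : set T)).
  have e : (fun y => 1 * \1_(cube d r : set T) (y - 0)) = \1_(cube d r : set T) :> (T -> R).
    by apply/funext => y; rewrite mul1r subr0.
  by rewrite -e.
rewrite intgZ; last exact: bmc_trans.
rewrite intg_trans//; congr (_ * _).
apply/eqP; rewrite -eqe -intgE//; apply/eqP.
have mc : measurable (cube d r : set T) by exact: measurable_cube.
rewrite integral_indic// setIT; exact: leb_cube.
Qed.

Lemma lip_affine k al z : lip (fun y : T => k + lin al (y - z)).
Proof.
apply: lipD; first exact: lip_cst.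
rewrite /lin; apply: (@lip_sum R d _ al (fun i y => co i (y - z))) => i.
by exists 1 => // y y'; rewrite mul1r -coB opprB addrA subrK co_le_enorm.
Qed.

Lemma has_pder_affine k al z v y : has_pder v (fun y : T => k + lin al (y - z)) y (lin al v).
Proof.
rewrite -[lin al v]add0r; apply: has_pderD; first exact: has_pder_cst.
rewrite /lin; apply: has_pder_sum => i; apply: has_pderZ.
under [X in has_pder _ X]eq_fun do rewrite coB.
rewrite -[co i v]subr0; apply: has_pderB; [exact: has_pder_co|exact: has_pder_cst].
Qed.

Lemma loclip_locb a : loclip a -> locb a.
Proof. by move=> h; split; [exact: loclip_measurable|exact: loclip_bounded]. Qed.

Lemma locbB a b : locb a -> locb b -> locb (fun z => a z - b z).
Proof.
move=> [ma la] [mb lb]; split; first exact: measurable_funB.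
move=> r; have [N hN] := la r; have [N' hN'] := lb r.
exists (N + N') => z zr; rewrite (le_trans (ler_normB _ _))// lerD ?hN ?hN'//.
Qed.

(** For affine functions integration by parts is available and the two constant
    derivatives cancel. *)
Lemma weak_pairing_affine M psi k k' al be z v w : lip psi -> bsupp M psi ->
  lin al v = lin be w ->
  weak_pairing (fun y => k + lin al (y - z)) (fun y => k' + lin be (y - z)) v w psi = 0.
Proof.
move=> lp bp e.
have l1 := loclip_locb (lip_loclip (lip_affine k al z)).
have l2 := loclip_locb (lip_loclip (lip_affine k' be z)).
have bd x := bmc_der x lp bp.
rewrite /weak_pairing intgB; last 2 first.
- by case: l1 => ? ?; apply: bmcM.
- by case: l2 => ? ?; apply: bmcM.
have K c r : exists N, forall y : T, enorm y <= r -> `|c : R| <= N by exists `|c|.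
have h1 y : has_pder v (fun y : T => k + lin al (y - z)) y (lin al v) by exact: has_pder_affine.
have h2 y : has_pder w (fun y : T => k' + lin be (y - z)) y (lin be w) by exact: has_pder_affine.
rewrite (ibp lp bp (lip_loclip (lip_affine k al z)) h1 (measurable_cst _) (K _)).
rewrite (ibp lp bp (lip_loclip (lip_affine k' be z)) h2 (measurable_cst _) (K _)).
by rewrite e subrr.
Qed.

Lemma weak_pairing_split M psi a b a' b' v w : lip psi -> bsupp M psi ->
  locb a -> locb b -> locb a' -> locb b' ->
  weak_pairing a b v w psi = weak_pairing (fun y => a y - a' y) (fun y => b y - b' y) v w psi +
                   weak_pairing a' b' v w psi.
Proof.
move=> lp bp la lb la' lb'; rewrite /weak_pairing -intgD.
- by congr intg; apply/funext => y; ring.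
- by apply: (bmc_weak_pairing v w _ _ lp bp); exact: locbB.
- exact: (bmc_weak_pairing v w la' lb' lp bp).
Qed.

Lemma weak_pairing_bound a b v w M chi K r z E : locb a -> locb b ->
  lipk K chi -> 0 <= K -> bsupp M chi -> 0 <= r -> 0 <= E ->
  (forall y, ~ cube d r (y - z) -> chi y = 0) ->
  (forall y, cube d r (y - z) -> `|a y| <= E /\ `|b y| <= E) ->
  `|weak_pairing a b v w chi| <= E * K * (enorm v + enorm w) * (2 * r) ^+ (2 * d).
Proof.
move=> la lb cK K0 bc r0 E0 hout hin.
have lc : lip chi by exact: (lipW K0 cK).
have bw := bmc_weak_pairing v w la lb lc bc.
apply: (le_trans (intg_norm bw)).
rewrite -(intg_indic_cube _ z)//.
have derout x y : ~ cube d r (y - z) -> real_derive chi y x = 0.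
  move=> /existsNP[i /negP]; rewrite -ltNge => hi.
  have e0 : 0 < `|co i (y - z)| - r by rewrite subr_gt0.
  rewrite (@der_near _ _ x chi (fun=> 0) y _ e0) ?(has_pder_der (has_pder_cst x 0 y))//.
  move=> y' h; apply: hout => /(_ i); apply/negP; rewrite -ltNge.
  have e2 : co i (y - z) = co i (y' - z) - co i (y' - y) by rewrite !coB; ring.
  have := ler_normB (co i (y' - z)) (co i (y' - y)); rewrite -e2.
  have := co_le_enorm i (y' - y).
  by move: h; move: (enorm _) `|_| `|_| `|_| => *; lra.
apply: le_intg_ae.
- case: bw => mw [N hN]; split; first exact: measurableT_comp.
  by exists N => y; rewrite normr_id; split; [exact: (hN y).1|move=> /(hN y).2 ->; rewrite normr0].
- exact: bmc_indic_cube.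
apply: aeS2 (lip_ae_pderivable v cK) (lip_ae_pderivable w cK) => y /has_pder_pderivable hv /has_pder_pderivable hw.
have [hy|hy] := pselect (cube d r (y - z)); last first.
  by rewrite !derout// !mulr0 subrr normr0 indicE memNset// mulr0.
have [h1 h2] := hin y hy.
rewrite indicE mem_set//= mulr1 (le_trans (ler_normB _ _))// !normrM mulrDr lerD//.
  by rewrite -mulrA ler_pM// (has_pder_lip cK hv).
by rewrite -mulrA ler_pM// (has_pder_lip cK hw).
Qed.

Lemma small_scale (K r : R) : 0 < r -> 0 <= K -> exists n, K * 2 ^- n < r.
Proof.
move=> r0 K0; exists (Num.bound (K / r)).
rewrite ltr_pdivrMr ?exprn_gt0// mulrC -ltr_pdivrMr//.
have := archi_boundP (divr_ge0 K0 (ltW r0)) => /lt_trans; apply.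
by rewrite -natrX ltr_nat ltn_expl.
Qed.

Lemma dist_aux (p1 p2 p3 p4 : R) : 2 * p1 < p2 -> p3 <= p1 -> p2 <= p4 + p3 -> p1 <= p4.
Proof. lra. Qed.

(** Goursat's argument in weak form.  If the pairing were nonzero, successive
    subdivision would give tents at scale 2^-n, shrinking to a point [z], whose pairing
    is at least a fixed multiple of 2^(-2dn).  Near [z] the functions are affine up to
    [eps] times the distance, and the affine part contributes nothing.  The remainder is
    at most [eps] 2^-n, the derivative of the localised test function is of order 2^n,
    and the volume of order 2^(-2dn): the pairing is at most a multiple of
    [eps] 2^(-2dn), a contradiction. *)
Theorem weak_pairing0 a b v w M psi : locb a -> locb b -> lip psi -> bsupp M psi ->
  (forall z, (exists al be, [/\ lin al v = lin be w, lin_approx a al z & lin_approx b be z]) \/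
     (exists2 r, 0 < r & forall y, enorm (y - z) < r -> psi y = 0)) ->
  weak_pairing a b v w psi = 0.
Proof.
move=> la lb lpsi bpsi H; apply/eqP; apply: contrapT => /negP hn.
have [c0 hc0] := weak_pairing_partition la lb lpsi bpsi hn.
have [cs [cs0 hcs]] := weak_pairing_seq v w la lb lpsi bpsi c0.
have hge := weak_pairing_seq_ge (fun n => (hcs n).2).
have [z hz] := nested_lim (fun n => (hcs n).1).
rewrite cs0 in hge.
have P0 n : 0 < 2 ^- n :> R by rewrite invr_gt0 exprn_gt0.
have cout n y : ~ cube d (2 * 2 ^- n) (y - z) -> hcut psi (cs n) n y = 0.
  move=> /existsNP[i /negP]; rewrite -ltNge => hi.
  rewrite /hcut (@hat_out _ _ _ _ _ i) ?mul0r//.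
  have := ler_distD (cs n i) (co i y) (co i z); rewrite -coB.
  exact: dist_aux hi (hz n i).
have [[al [be [e aa bb]]]|[r r0 hr]] := H z; last first.
  have [n hN] := @small_scale ((2 * d)%:R * 2) r r0 (ltac:(by rewrite mulr_ge0)).
  have z0 : hcut psi (cs n) n = fun=> 0.
    apply/funext => y; have [hy|/cout//] := pselect (cube d (2 * 2 ^- n) (y - z)).
    rewrite /hcut hr ?mulr0// (le_lt_trans (enorm_le_max hy))//.
    by rewrite mulrA.
  have := hge n; rewrite z0.
  have -> : weak_pairing a b v w (fun=> 0) = 0.
    rewrite /weak_pairing; under eq_fun do rewrite !(has_pder_der (has_pder_cst _ _ _)) !mulr0 subrr.
    by rewrite /intg /Rintegral integral0_eq.
  by rewrite normr0 mulr0 normr_le0 (negbTE hc0).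
have [N hN] := loclip_bounded (lip_loclip lpsi) M.
have [k k0 pk] := lpsi.
pose N' := `|N|; have N'0 : 0 <= N' by exact: normr_ge0.
have pN y : `|psi y| <= N'.
  have [h|h] := leP (enorm y) M; last by rewrite bpsi// normr0.
  by rewrite (le_trans (hN y h))// ler_norm.
pose D : R := (2 * d)%:R; have D0 : 0 <= D by [].
pose K := k + N' * D; have K0 : 0 <= K by rewrite addr_ge0 ?mulr_ge0// ltW.
have cK n : lipk (K * 2 ^+ n) (hcut psi (cs n) n).
  move=> y y'; rewrite /hcut.
  set h := hat (cs n) n.
  have -> : h y * psi y - h y' * psi y' = h y * (psi y - psi y') + (h y - h y') * psi y' by ring.
  have P1 : 1 <= 2 ^+ n :> R by rewrite exprn_ege1// ler1n.
  have -> : K * 2 ^+ n * enorm (y - y') =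
     (k * enorm (y - y')) * 2 ^+ n + (D * 2 ^+ n * enorm (y - y')) * N' by rewrite /K; ring.
  rewrite (le_trans (ler_normD _ _))// !normrM lerD//.
    rewrite (le_trans (ler_piMl _ _))//.
      by rewrite ger0_norm ?hat_le1 ?hat_ge0.
    by rewrite (le_trans (pk y y'))// ler_peMr// mulr_ge0 ?enorm_ge0// ltW.
  by rewrite ler_pM// hat_lip.
pose Q := D * 2 * K * (enorm v + enorm w) * 4 ^+ (2 * d).
have Q0 : 0 <= Q 
  by rewrite mulr_ge0 ?exprn_ge0// mulr_ge0 ?addr_ge0 ?enorm_ge0// mulr_ge0// mulr_ge0.
have hall eps : 0 < eps -> `|weak_pairing a b v w (hcut psi c0 0)| <= eps * Q.
  move=> eps0.
  have [r1 r10 h1] := aa eps eps0; have [r2 r20 h2] := bb eps eps0.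
  pose r := Num.min r1 r2; have r0 : 0 < r by rewrite lt_min r10.
  have [n hn'] := @small_scale (D * 2) r r0 (ltac:(by rewrite mulr_ge0)).
  have hsmall y : cube d (2 * 2 ^- n) (y - z) -> enorm (y - z) <= D * 2 * 2 ^- n.
    by move=> hy; rewrite (le_trans (enorm_le_max hy))// mulrA.
  rewrite (le_trans (hge n))//.
  have lcut := lip_hcut lpsi bpsi (cs n) n.
  have bcut := bsupp_hcut bpsi (cs n) n.
  pose a' y := a z + lin al (y - z); pose b' y := b z + lin be (y - z).
  have la' : locb a' by exact: (loclip_locb (lip_loclip (lip_affine _ _ _))).
  have lb' : locb b' by exact: (loclip_locb (lip_loclip (lip_affine _ _ _))).
  rewrite (weak_pairing_split v w lcut bcut la lb la' lb') (weak_pairing_affine _ _ _ lcut bcut e) addr0.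
  have B := @weak_pairing_bound _ _ v w M _ (K * 2 ^+ n) (2 * 2 ^- n) z (eps * (D * 2 * 2 ^- n))
     (locbB la la') (locbB lb lb') (cK n).
  apply: (@le_trans _ _ ((2 ^+ (2 * d)) ^+ n * (eps * (D * 2 * 2 ^- n) * (K * 2 ^+ n) *
      (enorm v + enorm w) * (2 * (2 * 2 ^- n)) ^+ (2 * d)))).
    apply: ler_wpM2l; first by rewrite !exprn_ge0.
    apply: B.
    - by rewrite mulr_ge0 ?exprn_ge0.
    - exact: bcut.
    - by rewrite mulr_ge0 ?ltW.
    - by rewrite mulr_ge0 ?(ltW eps0)// mulr_ge0 ?(ltW (P0 n))// mulr_ge0.
    - exact: cout.
    - move=> y hy; have hy' := hsmall y hy.
      have hyr : enorm (y - z) < r by exact: le_lt_trans hn'.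
      move: hyr; rewrite lt_min => /andP[/h1 g1 /h2 g2].
      have epsy : eps * enorm (y - z) <= eps * (D * 2 * 2 ^- n) by rewrite ler_wpM2l// ltW.
      by rewrite /a' /b' !opprD !addrA; split; [exact: le_trans g1 _|exact: le_trans g2 _].
  rewrite le_eqVlt; apply/orP; left; apply/eqP; rewrite /Q.
  have n0 : (2 : R) ^+ n != 0 by rewrite expf_neq0.
  have e1 : (2 ^+ (2 * d)) ^+ n = (2 ^+ n) ^+ (2 * d) :> R by rewrite exprAC.
  have e2 : (2 * (2 * 2 ^- n)) ^+ (2 * d) = 4 ^+ (2 * d) * ((2 ^+ n) ^+ (2 * d))^-1 :> R.
    rewrite mulrA exprMn exprVn; congr (_ ^+ _ * _).
    by rewrite -natrM.
  have n1 : ((2 : R) ^+ n) ^+ (2 * d) != 0 by rewrite expf_neq0.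
  rewrite e1 e2; move: n0 n1; move: (((2 : R) ^+ n) ^+ (2 * d)) ((2 : R) ^+ n) (4 ^+ (2 * d)) (enorm v + enorm w) => S P F V n0 n1.
  by field; rewrite ?n0 ?n1.
pose t := `|weak_pairing a b v w (hcut psi c0 0)|.
have t0 : 0 < t by rewrite normr_gt0.
have Q1 : 0 < 2 * (Q + 1) by rewrite mulr_gt0// ltr_wpDl.
have := hall (t / (2 * (Q + 1))) (divr_gt0 t0 Q1).
rewrite -/t mulrAC ler_pdivlMr// => h.
have Q2 : Q < 2 * (Q + 1) by rewrite mulrDr mulr1 mulr_natl mulr2n -addrA ltrDl ltr_wpDl.
have : t * Q < t * (2 * (Q + 1)) by rewrite ltr_pM2l.
by rewrite ltNge h.
Qed.

End weakdiv0.

(** * Complex differentiability and the Euclidean norm *)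

Section bridge.
Context {R : realType}.
Implicit Types (a b : C R) (s t : R).

(** Norms of complex vectors take values in [C R], through this embedding of the reals. *)
Definition rc t : C R := Complex t 0.

Lemma normC_rc a : `|a| = rc (cabs a).
Proof. by []. Qed.

Lemma rc_le s t : (rc s <= rc t) = (s <= t).
Proof. exact: (@lecR R s t). Qed.

Lemma rc_lt s t : (rc s < rc t) = (s < t).
Proof. exact: (@ltcR R s t). Qed.

Lemma cabs_ge0 a : 0 <= cabs a.
Proof. by case: a => x y; exact: sqrtr_ge0. Qed.

Lemma rcM s t : rc s * rc t = rc (s * t).
Proof. by apply/eqP; rewrite eq_complex /= !mulr0 !mul0r subr0 addr0 !eqxx. Qed.

Lemma posC (e : C R) : 0 < e -> exists2 r : R, 0 < r & e = rc r.
Proof.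
case: e => x y; rewrite (@ltcE R) /= => /andP[/eqP -> x0]; by exists x.
Qed.

Section d.
Context {d : nat}.
Notation T := 'rV[C R]_d.
Implicit Types (z w : T).

Lemma cabs_le_enorm z j : cabs (z 0 j) <= enorm z.
Proof.
have h := cabs_ge0 (z 0 j).
rewrite -[leLHS]ger0_norm// -sqrtr_sqr /enorm ler_wsqrtr// (bigD1 j)//= lerDl.
by apply: sumr_ge0 => i _; exact: sqr_ge0.
Qed.

Lemma norm_le_enorm z : `|z| <= rc (enorm z).
Proof.
rewrite -[`|z|]/(mx_norm z).
have [h|/mx_norm_neq0 [[i j] h]] := eqVneq (mx_norm z) 0; rewrite h.
  by rewrite -[0]/(rc 0) rc_le enorm_ge0.
by rewrite ord1 normC_rc rc_le cabs_le_enorm.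
Qed.

Lemma coord_le_norm z j : `|z 0 j| <= `|z|.
Proof.
rewrite -[`|z|]/(mx_norm z) mx_normE.
have h := le_bigmax (0%:nng) (fun i : 'I_1 * 'I_d => `|z i.1 i.2|%:nng) (0, j).
exact: (h erefl erefl).
Qed.

Lemma enorm_ball z w (e : R) : enorm (w - z) < e -> ball z (rc e) w.
Proof.
move=> h; rewrite -ball_normE /ball_/= -normrN opprB (le_lt_trans (norm_le_enorm _))//.
by rewrite rc_lt.
Qed.

(** With [enorm_nbhs], the sup norm and the Euclidean norm have the same neighbourhoods. *)
Lemma nbhs_enorm z (A : set T) : nbhs z A ->
  exists2 e : R, 0 < e & forall w, enorm (w - z) < e -> A w.
Proof.
move=> /nbhs_ballP [e /= /posC[r r0 ->] h]; exists r => // w wz; apply: h.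
exact: enorm_ball.
Qed.

Lemma enorm_nbhs z (A : set T) (e : R) : 0 < e ->
  (forall w, enorm (w - z) < e -> A w) -> nbhs z A.
Proof.
move=> e0 h; apply/nbhs_ballP.
have D0 : 0 < (2 * d)%:R + 1 :> R by rewrite ltr_wpDl.
exists (rc (e / ((2 * d)%:R + 1))); first by rewrite /= -[0]/(rc 0) rc_lt divr_gt0.
move=> w; rewrite -ball_normE /ball_/= -normrN opprB => hw; apply: h.
apply: (@le_lt_trans _ _ ((2 * d)%:R * (e / ((2 * d)%:R + 1)))).
  apply: enorm_le_max => -[j s].
  have : cabs ((w - z) 0 j) < e / ((2 * d)%:R + 1).
    by rewrite -rc_lt -normC_rc (le_lt_trans (coord_le_norm _ _)).
  move=> /ltW; apply: le_trans.
  have h0 := cabs_ge0 ((w - z) 0 j).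
  rewrite -[leRHS]ger0_norm// -!sqrtr_sqr ler_wsqrtr// cabs2 /co/=.
  by case: s; rewrite ?lerDl ?lerDr sqr_ge0.
by rewrite mulrCA gtr_pMr// ltr_pdivrMr// mul1r ltrDl.
Qed.

Lemma open_eopen (A : set T) : open A -> eopen A.
Proof. by rewrite openE => oA z /oA /nbhs_enorm. Qed.

(** The complex differential is linear over [C R]; comparing its values on the
    directions [(j, false)] and [(j, true)], which differ by the factor i, gives the
    Cauchy-Riemann equations. *)
Lemma differentiable_lin (f : T -> C R) z : differentiable f z ->
  exists (al be : @ix d -> R), [/\ lin_approx (fun y => complex.Re (f y)) al z,
    lin_approx (fun y => complex.Im (f y)) be z,
    forall j, lin al (ev (j, false)) = lin be (ev (j, true)) &
    forall j, lin be (ev (j, false)) = - lin al (ev (j, true))].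
Proof.
move=> /diff_locally hf.
pose L := 'd f z.
pose al i := complex.Re (L (ev i)); pose be i := complex.Im (L (ev i)).
have decomp (y : T) : y = \sum_i rs (co i y) (ev i).
  apply: co_inj => i.
  have -> : co i (\sum_i rs (co i y) (ev i)) = \sum_k co i (rs (co k y) (ev k)).
    elim/big_rec2 : _ => [|k a x _ <-]; first exact: co0.
    by rewrite coD.
  rewrite (bigD1 i)//= big1 ?addr0 ?co_rs ?co_ev ?eqxx ?mulr1// => k ki.
  by rewrite co_rs co_ev eq_sym (negbTE ki) mulr0.
have Lrs t v : L (rs t v) = rc t * L v by rewrite /rs linearZ.
have LE y : L y = Complex (lin al y) (lin be y).
  rewrite {1}(decomp y) linear_sum /lin.
  elim/big_rec3 : _ => // k a b c _ ->; rewrite Lrs /al /be.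
  case: (L (ev k)) => p r; apply/eqP; rewrite eq_complex/= !mul0r subr0 addr0.
  by rewrite !(mulrC (co k y)) !eqxx.
have approx e : 0 < e -> exists2 r : R, 0 < r & forall y, enorm (y - z) < r ->
    cabs (f y - f z - L (y - z)) <= e * enorm (y - z).
  move=> e0.
  have /eqaddoP := hf.
  move=> /(_ (rc e)); rewrite -[0]/(rc 0) rc_lt => /(_ e0) /nbhs_enorm [r r0 h].
  exists r => // y yz; have := h (y - z); rewrite subr0 => /(_ yz) /=.
  move=> H.
  have E : (f \o shift z - (cst (f z) + 'd f z)) (y - z) = f (y - z + z) - (f z + L (y - z)) by [].
  rewrite E subrK opprD addrA in H.
  rewrite -rc_le -normC_rc -rcM.
  apply: (le_trans H).
  by rewrite ler_wpM2l ?norm_le_enorm// -[0]/(rc 0) rc_le ltW.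
exists al, be; split.
- move=> e e0; have [r r0 h] := approx e e0; exists r => // y /h; apply: le_trans.
  rewrite LE; case: (f y) => p1 p2; case: (f z) => q1 q2 /=.
  rewrite -sqrtr_sqr; apply: ler_wsqrtr.
  by rewrite lerDl sqr_ge0.
- move=> e e0; have [r r0 h] := approx e e0; exists r => // y /h; apply: le_trans.
  rewrite LE; case: (f y) => p1 p2; case: (f z) => q1 q2 /=.
  rewrite -sqrtr_sqr; apply: ler_wsqrtr.
  by rewrite lerDr sqr_ge0.
- move=> j; have := LE (ev (j, true)); rewrite {1}/ev/= linearZ.
  have := LE (ev (j, false)); rewrite {1}/ev/= => ->.
  by move=> [] _ <-; rewrite /=; ring.
- move=> j; have := LE (ev (j, true)); rewrite {1}/ev/= linearZ.
  have := LE (ev (j, false)); rewrite {1}/ev/= => ->.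
  by move=> [] <- _; rewrite /=; ring.
Qed.

End d.
End bridge.

(** * Compactness *)

Section compactness.
Context {R : realType} {d : nat}.
Notation T := 'rV[C R]_d.

Lemma eopen_open (A : set T) : eopen A -> open A.
Proof. by move=> oA; rewrite openE => z /oA [e e0 h]; exact: enorm_nbhs e0 h. Qed.

Lemma continuous_pairC : continuous (fun p : R * R => Complex p.1 p.2 : C R).
Proof.
move=> -[a b] A /= /nbhs_ballP [e /= /posC [r r0 ->] h].
have r2 : 0 < r / 2 by rewrite divr_gt0.
apply/nbhs_ballP; exists (r / 2) => //= -[c e'] [/= h1 h2]; apply: h.
change (`|(Complex a b : C R) - (Complex c e' : C R)| < rc r).
rewrite normC_rc rc_lt /cabs/=.
have : (a - c) ^+ 2 + (b - e') ^+ 2 < r ^+ 2.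
  move: h1 h2; rewrite /ball/= !ltr_norml => /andP[? ?] /andP[? ?].
  have s1 : (a - c) ^+ 2 < (r / 2) ^+ 2 by nra.
  have s2 : (b - e') ^+ 2 < (r / 2) ^+ 2 by nra.
  nra.
move=> h3; rewrite -(gtr0_norm r0) -sqrtr_sqr ltr_sqrt// exprn_gt0//.
Qed.

Lemma compact_cube (r : R) : compact (cube d r : set T).
Proof.
pose D : set (C R) := (fun p : R * R => Complex p.1 p.2 : C R) @` (`[-r, r]%classic `*` `[-r, r]%classic).
have cD : compact D.
  apply: continuous_compact; first by apply: continuous_subspaceT; exact: continuous_pairC.
  by apply: compact_setX; exact: segment_compact.
have -> : (cube d r : set T) = [set v | forall j, D (v ord0 j)].
  apply/seteqP; split=> z h.
    move=> j; exists (co (j, false) z, co (j, true) z).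
      by split; rewrite /= in_itv/= -ler_norml; exact: h.
    by rewrite /co/= ; case: (z ord0 j).
  move=> [j s]; have [[p1 p2] /= [h1 h2] e] := h j.
  move: h1 h2; rewrite !in_itv/= -!ler_norml /co/= -e /=.
  by case: s.
by apply: (@rV_compact (C R) d (fun=> D)).
Qed.

Lemma closed_bounded_compact (A : set T) (r : R) : eopen (~` A) ->
  (forall z, A z -> enorm z <= r) -> compact A.
Proof.
move=> /eopen_open oA hA.
have cA : closed A by rewrite -[A]setCK closedC.
apply: (subclosed_compact cA (@compact_cube r)) => z /hA h i.
exact: le_trans (co_le_enorm i z) h.
Qed.

Lemma bounded_set_enorm (A : set T) : bounded_set A ->
  exists M : R, forall z, A z -> enorm z <= M.
Proof.
move=> [M [Mr hM]].
have [m mE] : exists m : R, M = rc m.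
  by move/complex_realP: Mr => [m ->]; exists m.
have := hM (rc (m + 1)); rewrite mE rc_lt ltrDl ltr01 => /(_ isT) h.
exists ((2 * d)%:R * (m + 1)) => z Az; apply: enorm_le_max => -[j s].
have : cabs (z 0 j) <= m + 1.
  by rewrite -rc_le -normC_rc (le_trans (coord_le_norm _ _))//; exact: h.
apply: le_trans.
rewrite -[leRHS]ger0_norm ?cabs_ge0// -!sqrtr_sqr ler_wsqrtr// cabs2 /co/=.
by case: s; rewrite ?lerDl ?lerDr sqr_ge0.
Qed.

Lemma closure_enorm (A : set T) z : closure A z ->
  forall e, 0 < e -> exists2 w, A w & enorm (w - z) < e.
Proof.
move=> Az e e0.
have [w [Aw hw]] := Az [set w | enorm (w - z) < e] (enorm_nbhs e0 (fun w h => h)).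
by exists w.
Qed.

Lemma compact_closure_bounded (U : set T) (r : R) : (forall z, U z -> enorm z <= r) ->
  compact (closure U).
Proof.
move=> hU; apply: (subclosed_compact (@closed_closure _ U) (@compact_cube (r + 1))).
move=> z /closure_enorm /(_ 1 ltr01) [w /hU hw wz] i.
rewrite (le_trans (co_le_enorm i z))//.
by have := ler_enormB3 z 0 w; rewrite !subr0 enormBC; lra.
Qed.

(** Compactness in the form of a uniform radius for a property that persists when the
    radius shrinks. *)
Lemma uniform_nbhd (K : set T) (P : R -> T -> Prop) : compact K ->
  (forall e e' z, e' <= e -> P e z -> P e' z) ->
  (forall z, K z -> exists2 e, 0 < e & forall w, enorm (w - z) < e -> P e w) ->
  exists2 e, 0 < e & forall z, K z -> P e z.
Proof.
move=> /compact_near_coveringP cK mono h.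
have := cK R (0^'+) P _.
have H : forall z, K z -> \forall x' \near z & i \near 0^'+, P i x'.
  move=> z /h [e e0 hP].
  exists ([set w | enorm (w - z) < e], [set i | i < e]).
    split => /=; first exact: (enorm_nbhs e0).
    exact: nbhs_right_lt.
  by move=> [w i] /= [/hP hw ie]; exact: mono (ltW ie) hw.
move=> /(_ _ H) Hn.
near (0 : R)^'+ => e.
exists e; first by near: e; exact: nbhs_right_gt.
by near: e.
Unshelve. all: by end_near. Qed.

Lemma compact_enorm (A : set T) : compact A -> exists M : R, forall z, A z -> enorm z <= M.
Proof.
move=> cA; have [||e e0 h] := @uniform_nbhd A (fun e z => 0 < e -> enorm z <= e^-1) cA.
- move=> e e' z ee h e'0; rewrite (le_trans (h _))//; first exact: lt_le_trans ee.
  by rewrite lef_pV2 ?posrE//; exact: lt_le_trans ee.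
- move=> z _; have p : 0 < enorm z + 1 by rewrite ltr_wpDl// enorm_ge0.
  exists (enorm z + 1)^-1; first by rewrite invr_gt0.
  move=> w wz _; rewrite invrK.
  have : (enorm z + 1)^-1 <= 1 by rewrite invf_le1// lerDr enorm_ge0.
  by have := ler_enormB3 w 0 z; rewrite !subr0; lra.
by exists e^-1 => z Az; exact: h.
Qed.

Lemma compact_support_bsupp (u : T -> R) : compact_support u -> exists M, bsupp M u.
Proof.
move=> /compact_enorm [M hM]; exists M => z Mz.
apply/eqP; apply: contraT => uz; move: Mz; rewrite ltNge hM//.
exact: subset_closure.
Qed.

End compactness.

(** * The regularised Bochner-Martinelli kernel *)

Section morehasd.
Context {R : realType} {d : nat}.
Notation T := 'rV[C R]_d.
Implicit Types (u f g : T -> R) (v z : T).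

Lemma has_pderX v u z l n : has_pder v u z l ->
  has_pder v (fun y => u y ^+ n) z (n%:R * u z ^+ n.-1 * l).
Proof.
move=> hu; elim: n => [|n IH].
  by under [X in has_pder _ X]eq_fun do rewrite expr0; rewrite !mul0r; exact: has_pder_cst.
under [X in has_pder _ X]eq_fun do rewrite exprS.
have -> : n.+1%:R * u z ^+ n.+1.-1 * l = u z * (n%:R * u z ^+ n.-1 * l) + u z ^+ n * l.
  case: n {IH} => [|n] /=; first by rewrite !mul0r mulr0 add0r mul1r.
  by rewrite -[n.+2%:R]natr1 exprS; ring.
exact: has_pderM.
Qed.

Lemma has_pderV v u z l : has_pder v u z l -> u z != 0 ->
  has_pder v (fun y => (u y)^-1) z (- (u z) ^- 2 * l).
Proof.
move=> /has_pderP hu uz; apply/has_pderP.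
have uz' : (fun t : R => u (z + rs t v)) 0 != 0 by rewrite rs0 addr0.
have := is_deriveV uz' hu.
rewrite rs0 addr0 => H; exact: H.
Qed.

End morehasd.

Section kernel.
Context {R : realType} {d : nat}.
Notation T := 'rV[C R]_d.
Notation I := (@ix d).
Variables (x : T) (e : R).
Hypothesis e0 : 0 < e.

Definition kcoord (i : I) (z : T) : R := co i (z - x).
(** The square of the distance to the pole, regularised by [e]; the kernel becomes smooth,
    so that no neighbourhood of the pole has to be excised. *)
Definition reg_sqdist (z : T) : R := \sum_i kcoord i z ^+ 2 + e ^+ 2.
Definition reg_kernel (z : T) : R := (reg_sqdist z ^+ d)^-1.
(** The divergence of the field [kcoord i z * reg_kernel z].  As [e] tends to 0 it
    concentrates at [x] with a mass bounded below. *)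
Definition chi (z : T) : R := 2 * d%:R * e ^+ 2 * reg_kernel z / reg_sqdist z.

Lemma reg_sqdistE z : reg_sqdist z = enorm (z - x) ^+ 2 + e ^+ 2.
Proof. by rewrite /reg_sqdist enorm2. Qed.

Lemma e2_gt0 : 0 < e ^+ 2. Proof. exact: exprn_gt0. Qed.

Lemma reg_sqdist_ge z : e ^+ 2 <= reg_sqdist z.
Proof. by rewrite lerDr; apply: sumr_ge0 => i _; exact: sqr_ge0. Qed.

Lemma reg_sqdist_gt0 z : 0 < reg_sqdist z. Proof. exact: lt_le_trans e2_gt0 (reg_sqdist_ge z). Qed.

Lemma reg_kernel_gt0 z : 0 < reg_kernel z.
Proof. by rewrite invr_gt0 exprn_gt0// reg_sqdist_gt0. Qed.

Lemma loclip_kcoord i : loclip (kcoord i).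
Proof.
rewrite /kcoord; under eq_fun do rewrite coB.
by apply: loclipB; [exact: loclip_co|exact: loclip_cst].
Qed.

Lemma loclipX f n : loclip f -> loclip (fun z : T => f z ^+ n).
Proof.
move=> lf; elim: n => [|n IH].
  by under eq_fun do rewrite expr0; exact: loclip_cst.
by under eq_fun do rewrite exprS; exact: loclipM.
Qed.

Lemma loclip_reg_sqdist : loclip reg_sqdist.
Proof.
apply: loclipD; last exact: loclip_cst.
by apply: loclip_sum => i; apply: loclipX; exact: loclip_kcoord.
Qed.

Lemma loclipV f c : 0 < c -> (forall z : T, c <= f z) -> loclip f -> loclip (fun z => (f z)^-1).
Proof.
move=> c0 hc lf; apply: (@loclip_comp R d _ (fun t => t^-1) c (c ^- 2)) => //.
  by rewrite invr_gt0 exprn_gt0.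
move=> s t cs ct.
have s0 : 0 < s by exact: lt_le_trans cs.
have t0 : 0 < t by exact: lt_le_trans ct.
have -> : s^-1 - t^-1 = (t - s) * (s * t)^-1 by field; rewrite (gt_eqF s0) (gt_eqF t0).
rewrite normrM distrC mulrC ler_wpM2r// ger0_norm ?invr_ge0 ?mulr_ge0 ?(ltW s0) ?(ltW t0)//.
by rewrite lef_pV2 ?posrE ?exprn_gt0 ?mulr_gt0// expr2 ler_pM// ltW.
Qed.

Lemma loclip_reg_kernel : loclip reg_kernel.
Proof.
apply: (@loclipV _ ((e ^+ 2) ^+ d)); first by rewrite exprn_gt0// e2_gt0.
  by move=> z; rewrite lerXn2r ?nnegrE ?(ltW e2_gt0) ?(ltW (reg_sqdist_gt0 z)) ?reg_sqdist_ge.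
by apply: loclipX; exact: loclip_reg_sqdist.
Qed.

Lemma has_pder_kcoord i k z : has_pder (ev k) (kcoord i) z (i == k)%:R.
Proof.
rewrite /kcoord; under [Y in has_pder _ Y]eq_fun do rewrite coB.
rewrite -(co_ev i k) -[co i (ev k)]subr0.
by apply: has_pderB; [exact: has_pder_co|exact: has_pder_cst].
Qed.

Lemma has_pder_reg_sqdist k z : has_pder (ev k) reg_sqdist z (2 * kcoord k z).
Proof.
rewrite -[2 * kcoord k z]addr0; apply: has_pderD; last exact: has_pder_cst.
have -> : 2 * kcoord k z = \sum_i (2%:R * kcoord i z ^+ 2.-1 * (i == k)%:R).
  rewrite (bigD1 k)//= eqxx mulr1 big1 ?addr0// => i ik.
  by rewrite (negbTE ik) mulr0.
by apply: has_pder_sum => i; apply: has_pderX; exact: has_pder_kcoord.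
Qed.

Lemma deriv_Vpow_aux (n : nat) (s y : R) : s != 0 ->
  - (s ^+ n) ^- 2 * (n%:R * s ^+ n.-1 * (2 * y)) = - (2 * n%:R * y * (s ^+ n)^-1 / s).
Proof.
move=> s0; case: n => [|n]; first by rewrite !(mul0r, mulr0) oppr0.
have t0 : s ^+ n != 0 by rewrite expf_neq0.
rewrite /= [s ^+ n.+1]exprS; move: (s ^+ n) t0 (n.+1%:R : R) => t t0 c.
by field; rewrite s0 t0.
Qed.

Lemma has_pder_reg_kernel k z : has_pder (ev k) reg_kernel z (- (2 * d%:R * kcoord k z * reg_kernel z / reg_sqdist z)).
Proof.
have S0 := gt_eqF (reg_sqdist_gt0 z).
have SS : reg_sqdist z ^+ d != 0 by rewrite expf_neq0// S0.
have h : has_pder (ev k) reg_sqdist z (2 * kcoord k z) by exact: has_pder_reg_sqdist.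
have := has_pderV (@has_pderX R d _ _ _ _ d h) SS; rewrite /reg_kernel.
by rewrite deriv_Vpow_aux ?S0//; exact.
Qed.

(** The field (z - x)/|z - x|^(2d) is divergence free away from [x], so only the
    regularisation contributes. *)
Lemma sum_grad_kernel z : \sum_i (reg_kernel z + kcoord i z * - (2 * d%:R * kcoord i z * reg_kernel z / reg_sqdist z)) = chi z.
Proof.
have S0 := gt_eqF (reg_sqdist_gt0 z).
rewrite big_split/= sumr_const card_prod card_ord card_bool.
have -> : \sum_i kcoord i z * - (2 * d%:R * kcoord i z * reg_kernel z / reg_sqdist z) =
   - (2 * d%:R * reg_kernel z / reg_sqdist z) * (reg_sqdist z - e ^+ 2).
  rewrite /reg_sqdist addrK mulr_sumr; apply: eq_bigr => i _; ring.
rewrite -[reg_kernel z *+ _]mulr_natl natrM /chi.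
by move: (reg_kernel z) (reg_sqdist z) S0 => g s S0; field; rewrite S0.
Qed.

End kernel.

(** * Integral representation *)

Section repr.
Context {R : realType} {d : nat}.
Notation T := 'rV[C R]_d.
Notation I := (@ix d).

Definition CR (a b : T -> R) (z : T) : Prop :=
  exists al be : I -> R, [/\ lin_approx a al z, lin_approx b be z,
    forall j, lin al (ev (j, false)) = lin be (ev (j, true)) &
    forall j, lin be (ev (j, false)) = - lin al (ev (j, true))].

Lemma lin_approxN a al z : lin_approx a al z ->
  lin_approx (fun y : T => - a y) (fun i => - al i) z.
Proof.
move=> h e e0; have [r r0 hr] := h e e0; exists r => // y /hr; apply: le_trans.
have -> : lin (fun i => - al i) (y - z) = - lin al (y - z).
  by rewrite /lin -sumrN; apply: eq_bigr => i _; rewrite mulNr.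
by rewrite -!opprD normrN.
Qed.

Lemma linN (al : I -> R) (y : T) : lin (fun i => - al i) y = - lin al y.
Proof. by rewrite /lin -sumrN; apply: eq_bigr => i _; rewrite mulNr. Qed.

(** Multiplication of [a + i b] by [-i]. *)
Lemma CR_rot a b z : CR a b z -> CR b (fun y => - a y) z.
Proof.
move=> [al [be [ha hb h1 h2]]]; exists be, (fun i => - al i); split => //.
- exact: lin_approxN.
- by move=> j; rewrite linN h2.
- by move=> j; rewrite linN h1.
Qed.

Lemma locbN (a : T -> R) : locb a -> locb (fun y => - a y).
Proof.
move=> [ma la]; split; first exact: measurableT_comp.
by move=> r; have [N hN] := la r; exists N => z /hN; rewrite normrN.
Qed.

Lemma flux_alg (al be X Y g c p px py : R) :
  (al * (X * g * px + p * (X * (c * X) + g * 1)) -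
   be * (X * g * py + p * (X * (c * Y) + g * 0))) +
  (be * (Y * g * px + p * (Y * (c * X) + g * 0)) -
   - al * (Y * g * py + p * (Y * (c * Y) + g * 1))) =
  al * (p * ((g + X * (c * X)) + (g + Y * (c * Y)))) +
  g * (al * (X * px + Y * py) - be * (X * py - Y * px)).
Proof. ring. Qed.

Definition grad_co (phi : T -> R) (i : I) (z : T) : R := real_derive phi z (ev i).

Variables (x : T) (e : R) (a b phi : T -> R) (M : R).
Hypotheses (e0 : 0 < e) (la : locb a) (lb : locb b) (lphi : lip phi) (bphi : bsupp M phi).
Hypothesis H : forall z, CR a b z \/
  (exists2 r, 0 < r & forall y, enorm (y - z) < r -> phi y = 0).

Let XX := kcoord x.
Let G := reg_kernel x e.

(** The terms of the representation formula in which the derivative falls on [phi]. *)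
Definition flux (z : T) : R :=
  G z * (a z * (\sum_i XX i z * grad_co phi i z) -
         b z * (\sum_(j < d) (XX (j, false) z * grad_co phi (j, true) z -
                              XX (j, true) z * grad_co phi (j, false) z))).

Let psi i z := (XX i z * G z) * phi z.

Let lXG i : loclip (fun z => XX i z * G z).
Proof. by apply: loclipM; [exact: loclip_kcoord|exact: loclip_reg_kernel]. Qed.

Let lpsi i : lip (psi i).
Proof. exact: (lipM_bsupp lphi bphi (lXG i)). Qed.

Let bpsi i : bsupp M (psi i).
Proof. exact: bsuppMl. Qed.

Let w1 j : weak_pairing a b (ev (j, false)) (ev (j, true)) (psi (j, false)) = 0.
Proof.
apply: (weak_pairing0 la lb (lpsi _) (bpsi _)) => z.
have [[al [be [h1 h2 h3 h4]]]|[r r0 hr]] := H z.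
  by left; exists al, be.
by right; exists r => // y /hr; rewrite /psi => ->; rewrite mulr0.
Qed.

Let w2 j : weak_pairing b (fun y => - a y) (ev (j, false)) (ev (j, true)) (psi (j, true)) = 0.
Proof.
apply: (weak_pairing0 lb (locbN la) (lpsi _) (bpsi _)) => z.
have [/CR_rot [al [be [h1 h2 h3 h4]]]|[r r0 hr]] := H z.
  by left; exists al, be.
by right; exists r => // y /hr; rewrite /psi => ->; rewrite mulr0.
Qed.

Lemma loclip_chi : loclip (chi x e).
Proof.
rewrite /chi; apply: loclipM.
  by apply: loclipM; [exact: loclip_cst|exact: loclip_reg_kernel].
apply: (@loclipV _ _ _ (e ^+ 2)); [exact: exprn_gt0|exact: reg_sqdist_ge|exact: loclip_reg_sqdist].
Qed.

Lemma bmc_grad_co i : bmc (grad_co phi i).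
Proof. exact: bmc_der bphi. Qed.

Lemma bmc_lhs : bmc (fun z => a z * (phi z * chi x e z)).
Proof.
case: la => ma ba; apply: bmcM => //.
have := bmcM (bmc_lip lphi bphi) (loclip_measurable loclip_chi) (loclip_bounded loclip_chi).
by under eq_fun do rewrite mulrC.
Qed.

Lemma bmc_flux : bmc flux.
Proof.
case: la => ma ba; case: lb => mb bb.
have bX i k : bmc (fun z => XX i z * grad_co phi k z).
  apply: bmcM; [exact: bmc_grad_co|exact: (loclip_measurable (loclip_kcoord x i))|].
  exact: (loclip_bounded (loclip_kcoord x i)).
have lG : loclip G by exact: loclip_reg_kernel.
apply: bmcM; [|exact: (loclip_measurable lG)|exact: (loclip_bounded lG)].
by apply: bmcB; apply: bmcM => //; apply: bmc_sum => i //; apply: bmcB.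
Qed.

(** For each complex coordinate, the weak Cauchy-Riemann equation is applied to [(a, b)]
    with the test function [kcoord (j, false)] times [reg_kernel] times [phi], and to
    [(b, -a)] with the one of index [(j, true)].  When these equations are added over
    [j], the terms with a derivative of the kernel combine into its divergence [chi] for
    [a] and cancel for [b]. *)
Lemma repr_kernel : intg (fun z => a z * (phi z * chi x e z)) = - intg flux.
Proof.
have [k k0 pk] := lphi.
apply/eqP; rewrite -addr_eq0 -intgD; [|exact: bmc_lhs|exact: bmc_flux].
apply/eqP.
pose W j z := (a z * real_derive (psi (j, false)) z (ev (j, false)) -
               b z * real_derive (psi (j, false)) z (ev (j, true))) +
              (b z * real_derive (psi (j, true)) z (ev (j, false)) -
               (- a z) * real_derive (psi (j, true)) z (ev (j, true))).
have b1 j := bmc_weak_pairing (ev (j, false)) (ev (j, true)) la lb (lpsi (j, false)) (bpsi (j, false)).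
have b2 j := bmc_weak_pairing (ev (j, false)) (ev (j, true)) lb (locbN la) (lpsi (j, true)) (bpsi (j, true)).
have bW j : bmc (W j) by apply: bmcD.
transitivity (intg (fun z => \sum_(j < d) W j z)); last first.
  rewrite intg_sum// big1// => j _.
  rewrite /W intgD//.
  by have := w1 j; have := w2 j; rewrite /weak_pairing => -> ->; rewrite addr0.
apply: intg_ae.
- by apply: bmcD; [exact: bmc_lhs|exact: bmc_flux].
- exact: bmc_sum.
have hae : {ae leb R d, forall z, forall i, pderivable (ev i) phi z}.
  by apply: ae_fin => i; exact: lip_ae_pderivable pk.
apply: aeS hae => z hz.
pose c := - (2 * d%:R * G z / reg_sqdist x e z).
have dG i : has_pder (ev i) G z (c * XX i z).
  have -> : c * XX i z = - (2 * d%:R * kcoord x i z * reg_kernel x e z / reg_sqdist x e z) by rewrite /c /G /XX; ring.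
  exact: has_pder_reg_kernel.
have dpsi i l : real_derive (psi i) z (ev l) =
    XX i z * G z * grad_co phi l z + phi z * (XX i z * (c * XX l z) + G z * (i == l)%:R).
  apply: has_pder_der; apply: has_pderM; last exact: has_pder_pderivable.
  by apply: has_pderM => //; exact: has_pder_kcoord.
have E j : W j z = a z * (phi z * ((G z + XX (j, false) z * (c * XX (j, false) z)) +
                                    (G z + XX (j, true) z * (c * XX (j, true) z)))) +
   G z * (a z * (XX (j, false) z * grad_co phi (j, false) z + XX (j, true) z * grad_co phi (j, true) z) -
          b z * (XX (j, false) z * grad_co phi (j, true) z - XX (j, true) z * grad_co phi (j, false) z)).
  have q1 : ((j, false) == (j, true) :> I) = false by rewrite xpair_eqE andbF.
  have q2 : ((j, true) == (j, false) :> I) = false by rewrite xpair_eqE andbF.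
  rewrite /W (dpsi (j, false) (j, false)) (dpsi (j, false) (j, true)).
  rewrite (dpsi (j, true) (j, false)) (dpsi (j, true) (j, true)) q1 q2 !eqxx.
  exact: flux_alg.
under eq_bigr do rewrite E.
rewrite big_split/= -!mulr_sumr sumrB -!mulr_sumr /flux.
rewrite -(sum_ix (fun i => XX i z * grad_co phi i z)).
rewrite -(sum_ix (fun i => G z + XX i z * (c * XX i z))).
congr (_ * (_ * _) + _).
rewrite -(sum_grad_kernel x e0 z); apply: eq_bigr => i _.
rewrite /c /G /XX; ring.
Qed.

(** Both sums are scalar products of the vector [z - x] with a rearrangement, up to signs,
    of the gradient of [phi]. *)
Lemma flux_bound F z : `|a z| <= F -> `|b z| <= F ->
  `|flux z| <= 2 * (F * (G z * enorm (z - x) * gradient_norm phi z)).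
Proof.
move=> aF bF.
have G0 : 0 <= G z by exact: ltW (reg_kernel_gt0 x e0 z).
have F0 : 0 <= F by exact: le_trans aF.
have n1 : `|\sum_i XX i z * grad_co phi i z| <= enorm (z - x) * gradient_norm phi z.
  rewrite ler_norml; apply/andP; split.
    rewrite lerNl -sumrN; under eq_bigr do rewrite -mulNr.
    rewrite (le_trans (cauchy_schwarz_sum _ _))// gradient_normE enormE.
    by under eq_bigr do rewrite sqrrN.
  by rewrite (le_trans (cauchy_schwarz_sum _ _))// gradient_normE enormE.
have n2 : `|\sum_(j < d) (XX (j, false) z * grad_co phi (j, true) z -
                              XX (j, true) z * grad_co phi (j, false) z)| <=
    enorm (z - x) * gradient_norm phi z.
  pose Y (i : I) := (if i.2 then - XX (i.1, true) z else XX (i.1, false) z).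
  pose D (i : I) := grad_co phi (i.1, ~~ i.2) z.
  have -> : \sum_(j < d) (XX (j, false) z * grad_co phi (j, true) z -
                              XX (j, true) z * grad_co phi (j, false) z) = \sum_i Y i * D i.
    by rewrite sum_ix; apply: eq_bigr => j _; rewrite /Y /D/= mulNr.
  have eY : \sum_i Y i ^+ 2 = \sum_i XX i z ^+ 2.
    by rewrite !sum_ix; apply: eq_bigr => j _; rewrite /Y/= sqrrN.
  have eD : \sum_i D i ^+ 2 = \sum_i grad_co phi i z ^+ 2.
    by rewrite !sum_ix; apply: eq_bigr => j _; exact: addrC.
  rewrite ler_norml; apply/andP; split.
    rewrite lerNl -sumrN; under eq_bigr do rewrite -mulNr.
    rewrite (le_trans (cauchy_schwarz_sum _ _))// gradient_normE enormE.
    by under eq_bigr do rewrite sqrrN; rewrite eY eD.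
  by rewrite (le_trans (cauchy_schwarz_sum _ _))// gradient_normE enormE eY eD.
rewrite /flux normrM (ger0_norm G0).
set P := enorm _ * _ in n1 n2.
have -> : 2 * (F * (G z * enorm (z - x) * gradient_norm phi z)) = G z * (F * P + F * P).
  by rewrite /P; ring.
apply: ler_wpM2l => //; rewrite (le_trans (ler_normB _ _))// !normrM.
by apply: lerD; apply: ler_pM.
Qed.

End repr.

(** * Real powers *)

Section powr.
Context {R : realType}.
Implicit Types a s t c eta A B q : R.

Lemma powR_mvt a s t : 0 < s -> s < t ->
  exists2 c, s < c < t & t `^ a - s `^ a = a * c `^ (a - 1) * (t - s).
Proof.
move=> s0 st.
have [||c] := @MVT R (@powR R ^~ a) (fun c => a * c `^ (a - 1)) s t st.
- move=> c; rewrite in_itv/= => /andP[sc _].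
  by apply: is_derive1_powR; exact: lt_trans sc.
- apply: derivable_within_continuous => c; rewrite in_itv/= => /andP[sc _].
  by apply: derivable_powR; rewrite in_itv/= andbT (lt_le_trans s0).
by rewrite in_itv/= => h e; exists c.
Qed.

Lemma powR_lip_ge a c s t : 0 < c -> a <= 1 -> c <= s -> c <= t ->
  `|s `^ a - t `^ a| <= `|a| * c `^ (a - 1) * `|s - t|.
Proof.
move=> c0 a1.
wlog st : s t / s <= t.
  move=> h cs ct; have [st|/ltW st] := leP s t; first exact: h.
  by rewrite distrC (distrC s); exact: h.
move=> cs ct; move: st; rewrite le_eqVlt => /orP[/eqP ->|st].
  by rewrite !subrr normr0 mulr0.
have s0 : 0 < s by exact: lt_le_trans cs.
have [m /andP[sm mt] E] := powR_mvt a s0 st.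
rewrite distrC E !normrM (distrC s) ler_wpM2r// ler_wpM2l//.
rewrite ger0_norm ?powR_ge0//.
have m0 : 0 < m by exact: lt_trans sm.
have cm : c <= m by rewrite (le_trans cs)// ltW.
have -> : a - 1 = - (1 - a) by rewrite opprB.
rewrite !powRN lef_pV2 ?posrE ?powR_gt0//.
by apply: ge0_ler_powR; rewrite ?nnegrE ?subr_ge0 ?(ltW c0) ?(ltW m0).
Qed.

Lemma powR_lip01 q s t : 1 < q -> 0 <= s <= 1 -> 0 <= t <= 1 ->
  `|s `^ q - t `^ q| <= q * `|s - t|.
Proof.
move=> q1; have q0 : 0 < q by exact: lt_trans q1.
have e1 : (1 : R) `^ (q - 1) = 1 by rewrite powR1.
wlog st : s t / s <= t.
  move=> h cs ct; have [st|/ltW st] := leP s t; first exact: h.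
  by rewrite distrC (distrC s); exact: h.
move=> /andP[s0 s1] /andP[t0 t1]; move: st; rewrite le_eqVlt => /orP[/eqP ->|st].
  by rewrite !subrr normr0 mulr0.
move: s0; rewrite le_eqVlt => /orP[/eqP s0|s0].
  rewrite -s0 powR0 ?gt_eqF// !sub0r !normrN (ger0_norm t0) ger0_norm ?powR_ge0//.
  rewrite -mulr_powRB1// (@le_trans _ _ (t * 1))//.
    rewrite ler_wpM2l// -[leRHS]e1.
    by apply: ge0_ler_powR; rewrite ?nnegrE ?subr_ge0 ?(ltW q1).
  by rewrite mulr1 ler_peMl// ltW.
have [m /andP[sm mt] E] := powR_mvt q s0 st.
rewrite distrC E !normrM (distrC s) ler_wpM2r// gtr0_norm// ler_piMr ?(ltW q0)//.
rewrite ger0_norm ?powR_ge0// -[leRHS]e1.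
have m0 : 0 < m by exact: lt_trans sm.
have m1 : m <= 1 by rewrite (le_trans (ltW mt)).
by apply: ge0_ler_powR; rewrite ?nnegrE ?subr_ge0 ?(ltW q1) ?(ltW m0).
Qed.

(** If [B] is at most [eta * A] the first term on the right suffices; otherwise [A] is less
    than [B / eta] and the second one does. *)
Lemma young_powR q eta A B : 1 < q -> 0 < eta -> 0 <= A -> 0 <= B ->
  A `^ (q - 1) * B <= eta * A `^ q + eta `^ (1 - q) * B `^ q.
Proof.
move=> q1 e0 A0 B0; have q0 : 0 < q by exact: lt_trans q1.
have qm : 0 <= q - 1 by rewrite subr_ge0 ltW.
have [h|h] := leP B (eta * A).
  rewrite -[leLHS]addr0 lerD ?mulr_ge0 ?powR_ge0//.
  by rewrite -(mulr_powRB1 A0 q0) mulrA [leRHS]mulrC ler_wpM2l ?powR_ge0.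
rewrite -[leLHS]add0r lerD ?mulr_ge0 ?powR_ge0 ?(ltW e0)//.
rewrite -(mulr_powRB1 B0 q0) mulrA [leRHS](_ : _ = (eta `^ (1 - q) * B `^ (q - 1)) * B); last by ring.
apply: ler_wpM2r => //.
have -> : eta `^ (1 - q) = eta^-1 `^ (q - 1).
  by rewrite -(powR_inv1 (ltW e0)) -powRrM mulN1r opprB.
rewrite mulrC -powRM ?invr_ge0 ?(ltW e0)//.
apply: ge0_ler_powR; rewrite ?nnegrE ?divr_ge0 ?(ltW e0)//.
by rewrite ler_pdivlMr// mulrC ltW.
Qed.

Lemma powRD2 q A B : 0 < q -> 0 <= A -> 0 <= B ->
  (A + B) `^ q <= 2 `^ q * (A `^ q + B `^ q).
Proof.
move=> q0 A0 B0; wlog AB : A B A0 B0 / A <= B.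
  move=> h; have [AB|/ltW AB] := leP A B; first exact: h.
  by rewrite addrC [X in _ * X]addrC; exact: h.
rewrite mulrDr ler_wpDl ?mulr_ge0 ?powR_ge0// -powRM//.
by apply: ge0_ler_powR; rewrite ?nnegrE ?addr_ge0 ?mulr_ge0 ?(ltW q0)//; lra.
Qed.

End powr.

(** * Hardy's inequality *)

Section hardy.
Context {R : realType} {d : nat}.
Notation T := 'rV[C R]_d.
Notation I := (@ix d).
Implicit Types (u : T -> R) (x z : T).

Lemma bmc_sum_sqr (D : I -> T -> R) : (forall i, bmc (D i)) ->
  bmc (fun z => Num.sqrt (\sum_i D i z ^+ 2)).
Proof.
move=> h.
have hs : bmc (fun z => \sum_i D i z ^+ 2).
  apply: bmc_sum => i; have [mi [N hN]] := h i.
  have N0 : 0 <= N by rewrite (le_trans _ (hN 0).1).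
  split.
    exact: (measurable_funX 2 mi).
  exists (Num.max N (N ^+ 2)) => z; split.
    by rewrite normrX le_max lerXn2r ?nnegrE ?orbT// (hN z).1.
  by rewrite gt_max => /andP[k _]; rewrite (hN z).2// expr0n.
case: hs => ms [N hN]; split.
  exact: (measurableT_comp (continuous_measurable_fun (@sqrt_continuous R)) ms).
exists (Num.max N (Num.sqrt N)) => z; split.
  rewrite ger0_norm ?sqrtr_ge0// le_max; apply/orP; right; apply: ler_wsqrtr.
  by rewrite (le_trans (ler_norm _))// (hN z).1.
by rewrite gt_max => /andP[k _]; rewrite (hN z).2// sqrtr0.
Qed.

Lemma bmc_gn M u : lip u -> bsupp M u -> bmc (gradient_norm u).
Proof.
move=> lu bu; have := bmc_sum_sqr (fun i => bmc_grad_co lu bu i).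
by under eq_fun do rewrite -gradient_normE.
Qed.

Lemma gn_ge0 u z : 0 <= gradient_norm u z.
Proof. exact: sqrtr_ge0. Qed.

Lemma bmc_powR f q : 0 < q -> (forall z, 0 <= f z) -> bmc f ->
  bmc (fun z : T => f z `^ q).
Proof.
move=> q0 f0 [mf [M hM]]; split.
  exact: (measurableT_comp (measurable_powR q) mf).
exists (Num.max M (M `^ q)) => z; split.
  rewrite ger0_norm ?powR_ge0// le_max; apply/orP; right.
  have fM : f z <= M by rewrite (le_trans (ler_norm _))// (hM z).1.
  by apply: ge0_ler_powR; rewrite ?nnegrE ?(ltW q0)// (le_trans (f0 z)).
by rewrite gt_max => /andP[h _]; rewrite (hM z).2// powR0// gt_eqF.
Qed.

Lemma lip_comp01 f (phi : R -> R) k : 0 < k -> lip f -> (forall z : T, 0 <= f z <= 1) ->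
  (forall s t, 0 <= s <= 1 -> 0 <= t <= 1 -> `|phi s - phi t| <= k * `|s - t|) ->
  lip (fun z => phi (f z)).
Proof.
move=> k0 [l l0 fl] f01 h; exists (k * l); first exact: mulr_gt0.
by move=> y z; rewrite (le_trans (h _ _ (f01 y) (f01 z)))// -mulrA ler_wpM2l ?(ltW k0).
Qed.

Variables (x : T) (e q M : R) (u : T -> R).
Hypotheses (e0 : 0 < e) (q1 : 1 < q) (q2d : q < (2 * d)%:R).
Hypotheses (lu : lip u) (bu : bsupp M u) (u01 : forall z, 0 <= u z <= 1).

Let q0 : 0 < q. Proof. exact: lt_trans q1. Qed.

Let S := reg_sqdist x e.
Let S0 z : 0 < S z. Proof. exact: reg_sqdist_gt0. Qed.

Let U z := u z `^ q.
Let w z := S z `^ (- (q / 2)).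

Let w0 z : 0 < w z. Proof. exact: powR_gt0. Qed.

Let U0 z : 0 <= U z. Proof. exact: powR_ge0. Qed.

Let lU : lip U.
Proof. exact: (lip_comp01 q0 lu u01 (fun s t => @powR_lip01 R q s t q1)). Qed.

Let bU : bsupp M U.
Proof. by move=> z /bu uz; rewrite /U uz powR0// gt_eqF. Qed.

Let lw : loclip w.
Proof.
have ha : - (q / 2) <= 1 by have := q0; lra.
have e2 := e2_gt0 e0.
apply: (@loclip_comp R d _ (fun s => s `^ (- (q / 2))) (e ^+ 2) (`|- (q / 2)| * (e ^+ 2) `^ (- (q / 2) - 1))).
- exact: loclip_reg_sqdist.
- by rewrite mulr_gt0 ?powR_gt0// normr_gt0 oppr_eq0 gt_eqF// divr_gt0.
- exact: reg_sqdist_ge.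
- by move=> s t; exact: powR_lip_ge.
Qed.

Let hw k z : has_pder (ev k) w z (- q * kcoord x k z * (w z / S z)).
Proof.
have -> : - q * kcoord x k z * (w z / S z) = (- (q / 2) * S z `^ (- (q / 2) - 1)) * (2 * kcoord x k z).
  rewrite powRB ?(gt_eqF (S0 z)) ?implybT// powRr1 ?(ltW (S0 z))// -/(w z).
  by field; rewrite gt_eqF.
apply: (@has_pder_comp _ _ _ S z _ (fun s => s `^ (- (q / 2)))); first exact: has_pder_reg_sqdist.
exact: is_derive1_powR.
Qed.

Let g i z := kcoord x i z * w z.
Let g' i z := kcoord x i z * (- q * kcoord x i z * (w z / S z)) + w z * 1.

Let lg i : loclip (g i). Proof. by apply: loclipM => //; exact: loclip_kcoord. Qed.

Let lg' i : loclip (g' i).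
Proof.
have lS : loclip (fun z => (S z)^-1).
  by apply: (@loclipV _ _ _ (e ^+ 2)); [exact: exprn_gt0|exact: reg_sqdist_ge|exact: loclip_reg_sqdist].
have lX := loclip_kcoord x i.
apply: loclipD; last by apply: loclipM => //; exact: loclip_cst.
apply: loclipM => //; apply: loclipM; last exact: loclipM.
by apply: loclipM => //; exact: loclip_cst.
Qed.

Let hg i z : has_pder (ev i) (g i) z (g' i z).
Proof.
apply: has_pderM; last exact: hw.
have h : has_pder (ev i) (kcoord x i) z (i == i)%:R by exact: has_pder_kcoord.
by rewrite eqxx in h.
Qed.

Let ibpU i : intg (fun z => g i z * grad_co U i z) = - intg (fun z => g' i z * U z).
Proof.
have h z : has_pder (ev i) (g i) z (g' i z) by exact: hg.
exact: (ibp lU bU (lg i) h (loclip_measurable (lg' i)) (loclip_bounded (lg' i))).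
Qed.

Let sum_g' z : ((2 * d)%:R - q) * w z <= \sum_i g' i z.
Proof.
rewrite big_split/= sumr_const card_prod card_ord card_bool mulr1 -[w z *+ _]mulr_natl (mulnC d).
have -> : \sum_i kcoord x i z * (- q * kcoord x i z * (w z / S z)) = - q * (w z / S z) * (S z - e ^+ 2).
  rewrite /S /reg_sqdist addrK mulr_sumr; apply: eq_bigr => i _; ring.
rewrite mulrBl [leLHS]addrC lerD2r mulNr mulNr lerN2.
have -> : q * w z = q * (w z / S z) * S z by field; rewrite gt_eqF.
apply: ler_wpM2l; last by rewrite gerBl (ltW (e2_gt0 e0)).
by apply: mulr_ge0; [exact: ltW|apply: divr_ge0; exact: ltW].
Qed.

Let bUU : bmc U := bmc_lip lU bU.

Lemma bmc_hardy : bmc (fun z => w z * U z).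
Proof. exact: (bmcM bUU (loclip_measurable lw) (loclip_bounded lw)). Qed.

(** The field [kcoord i * w] has divergence at least [(2d - q) * w].  Integration by parts
    moves the derivative to [u ^ q], and Young's inequality separates the factor
    (u / |z - x|)^(q - 1) from the gradient of [u]. *)
Lemma hardy_aux eta : 0 < eta ->
  ((2 * d)%:R - q) * intg (fun z => w z * U z) <=
  q * (eta * intg (fun z => w z * U z) +
       eta `^ (1 - q) * intg (fun z => gradient_norm u z `^ q)).
Proof.
move=> eta0.
have bgn : bmc (fun z => gradient_norm u z `^ q).
  by apply: bmc_powR => //; [exact: gn_ge0|exact: bmc_gn bu].
have bwU := bmc_hardy.
have bgU i : bmc (fun z => g i z * grad_co U i z).
  by apply: bmcM; [exact: bmc_grad_co bU i|exact: loclip_measurable|exact: loclip_bounded].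
have bg'U i : bmc (fun z => g' i z * U z).
  by apply: bmcM => //; [exact: loclip_measurable|exact: loclip_bounded].
rewrite -[leLHS](intgZ _ bwU).
apply: (@le_trans _ _ (intg (fun z => \sum_i g' i z * U z))).
  apply: le_intg; [exact: bmcZ|exact: bmc_sum|move=> z].
  by rewrite -mulr_suml mulrA ler_wpM2r.
rewrite intg_sum//.
have -> : \sum_i intg (fun z => g' i z * U z) = intg (fun z => \sum_i - 1 * (g i z * grad_co U i z)).
  rewrite intg_sum; last by move=> i; exact: bmcZ.
  by apply: eq_bigr => i _; rewrite intgZ// ibpU mulN1r opprK.
rewrite -(intgZ eta bwU) -(intgZ _ bgn) -intgD; [|exact: bmcZ|exact: bmcZ].
rewrite -intgZ; last by apply: bmcD; exact: bmcZ.
apply: le_intg_ae.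
- by apply: bmc_sum => i; exact: bmcZ.
- by apply: bmcZ; apply: bmcD; exact: bmcZ.
have [k k0 uk] := lu; have [l l0 Ul] := lU.
have h1 : {ae leb R d, forall z, forall i, pderivable (ev i) u z}.
  by apply: ae_fin => i; exact: lip_ae_pderivable uk.
have h2 : {ae leb R d, forall z, forall i, pderivable (ev i) U z}.
  by apply: ae_fin => i; exact: lip_ae_pderivable Ul.
apply: aeS2 h1 h2 => z hu hU.
have u0 : 0 <= u z by case/andP: (u01 z).
have ddU i : grad_co U i z = q * u z `^ (q - 1) * grad_co u i z.
  move: u0; rewrite le_eqVlt => /orP[/eqP uz|uz].
    rewrite -uz powR0 ?subr_eq0 ?gt_eqF// mulr0 mul0r.
    apply: (@has_pder_min _ _ (ev i) U z); [by []| |exact: has_pder_pderivable].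
    by rewrite /U -uz powR0// gt_eqF.
  apply: has_pder_der.
  apply: (@has_pder_comp _ _ (ev i) u z _ (fun s => s `^ q)); first exact: has_pder_pderivable.
  exact: is_derive1_powR.
have Sz := S0 z.
pose A := u z / Num.sqrt (S z).
have A0 : 0 <= A by rewrite divr_ge0 ?sqrtr_ge0.
have sS0 : 0 < Num.sqrt (S z) by rewrite sqrtr_gt0.
have AE r : 0 <= r -> A `^ r = u z `^ r * S z `^ (- (r / 2)).
  move=> r0; rewrite /A powRM ?invr_ge0 ?(ltW sS0)//; congr (_ * _).
  rewrite -powR12_sqrt ?(ltW Sz)// -powRN -powRrM; congr (_ `^ _); lra.
have step : \sum_i - 1 * (g i z * grad_co U i z) <= q * (A `^ (q - 1) * gradient_norm u z).
  under eq_bigr => i _.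
    rewrite ddU /g (_ : -1 * (kcoord x i z * w z * (q * u z `^ (q - 1) * grad_co u i z)) =
      (q * u z `^ (q - 1) * w z) * (- kcoord x i z * grad_co u i z)); last by ring.
    over.
  rewrite -mulr_sumr.
  have cs : \sum_i - kcoord x i z * grad_co u i z <= Num.sqrt (S z) * gradient_norm u z.
    rewrite (le_trans (cauchy_schwarz_sum _ _))// gradient_normE.
    apply: ler_wpM2r; first exact: sqrtr_ge0.
    apply: ler_wsqrtr; under eq_bigr do rewrite sqrrN.
    by rewrite /S /reg_sqdist lerDl exprn_ge0// ltW.
  have c0 : 0 <= q * u z `^ (q - 1) * w z.
    by rewrite mulr_ge0 ?mulr_ge0 ?powR_ge0// ltW.
  apply: (le_trans (ler_wpM2l c0 cs)).
  rewrite AE ?subr_ge0 ?(ltW q1)// -!mulrA ler_wpM2l ?(ltW q0)// ler_wpM2l ?powR_ge0//.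
  rewrite mulrA ler_wpM2r ?gn_ge0// /w -powR12_sqrt ?(ltW Sz)// -powRD ?(gt_eqF Sz) ?implybT//.
  by rewrite le_eqVlt; apply/orP; left; apply/eqP; congr (_ `^ _); lra.
apply: (le_trans step); apply: ler_wpM2l; first exact: ltW.
have := young_powR q1 eta0 A0 (gn_ge0 u z).
by rewrite (AE q (ltW q0)) [U z](_ : _ = u z `^ q)// (mulrC (w z)).
Qed.

Definition hardyC : R := 2 * q / ((2 * d)%:R - q) * (((2 * d)%:R - q) / (2 * q)) `^ (1 - q).

(** The parameter [eta] of Young's inequality is chosen to absorb half of the left-hand
    side.  This step needs [q < 2d], that is p > 2d/(2d-1). *)
Lemma hardy : intg (fun z => w z * U z) <= hardyC * intg (fun z => gradient_norm u z `^ q).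
Proof.
pose c := (2 * d)%:R - q; have c0 : 0 < c by rewrite subr_gt0.
pose eta := c / (2 * q).
have eta0 : 0 < eta by rewrite divr_gt0// mulr_gt0.
have := hardy_aux eta0; rewrite -/c.
move: (intg _) (intg _) => Z Y h.
rewrite /hardyC -/c -/eta.
have e1 : q * eta = c / 2 by rewrite /eta; field; rewrite gt_eqF.
have e2 : q * (eta * Y) = c / 2 * Y by rewrite mulrA e1.
move: h; rewrite mulrDr e2 => h.
have h2 : c * Y <= 2 * (q * (eta `^ (1 - q) * Z)) by lra.
have -> : 2 * q / c * eta `^ (1 - q) * Z = 2 * (q * (eta `^ (1 - q) * Z)) / c.
  by field; rewrite gt_eqF.
by rewrite ler_pdivlMr// mulrC.
Qed.

End hardy.

(** * Gradients and cutoff functions *)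

Section cutoffs.
Context {R : realType} {d : nat}.
Notation T := 'rV[C R]_d.
Notation I := (@ix d).
Implicit Types (u f g : T -> R) (x z : T).

Definition clamp (t : R) : R := Num.max 0 (Num.min 1 t).

Lemma clamp01 t : 0 <= clamp t <= 1.
Proof. by rewrite /clamp le_max lexx/= ge_max ler01 ge_min lexx. Qed.

Lemma clamp_lip s t : `|clamp s - clamp t| <= `|s - t|.
Proof.
have h := ler_norm (s - t); have h' := ler_norm (- (s - t)); rewrite normrN in h'.
rewrite ler_norml /clamp.
have m1 : Num.max 0 1 = 1 :> R by apply/max_idPr.
by case: (leP 1 s) => ?; case: (leP 1 t) => ?; rewrite ?m1;
  case: (leP 0 s) => ?; case: (leP 0 t) => ?; apply/andP; split; lra.
Qed.

Lemma clamp_ge1 t : 1 <= t -> clamp t = 1.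
Proof. by move=> h; rewrite /clamp (min_idPl h); apply/max_idPr. Qed.

Lemma clamp_le0 t : t <= 0 -> clamp t = 0.
Proof.
by move=> h; rewrite /clamp (min_idPr _) ?(le_trans h)//; apply/max_idPl.
Qed.

Lemma lip_clamp f : lip f -> lip (fun z => clamp (f z)).
Proof.
by move=> lf; apply: (lip_comp ltr01 lf) => s t; rewrite mul1r; exact: clamp_lip.
Qed.

Lemma lip_dist x : lip (fun z : T => enorm (z - x)).
Proof.
exists 1 => // y z; rewrite mul1r (le_trans (ler_dist_enorm _ _))//.
by rewrite opprB addrA subrK.
Qed.

Lemma gn_le_lip k f z : lipk k f -> 0 <= k -> (forall i, pderivable (ev i) f z) ->
  gradient_norm f z <= (2 * d)%:R * k.
Proof.
move=> fk k0 df; rewrite gradient_normE.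
pose D i := real_derive f z (ev i).
have hD i : `|D i| <= k by have := has_pder_lip fk (has_pder_pderivable (df i)); rewrite enorm_ev mulr1.
have s0 : 0 <= \sum_i `|D i| by apply: sumr_ge0.
rewrite (@le_trans _ _ (\sum_i `|D i|))//.
  rewrite -[leRHS]ger0_norm// -sqrtr_sqr ler_wsqrtr//.
  rewrite expr2 mulr_suml; apply: ler_sum => i _.
  rewrite -(real_normK (num_real (real_derive _ _ _))) expr2 ler_wpM2l// (bigD1 i)//= lerDl; exact: sumr_ge0.
rewrite (le_trans (ler_sum _ (fun i _ => hD i)))// sumr_const mulr_natl.
by rewrite card_prod card_ord card_bool mulnC.
Qed.

Lemma gnM f g z : (forall i, pderivable (ev i) f z) -> (forall i, pderivable (ev i) g z) ->
  gradient_norm (fun y => f y * g y) z <=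
  `|f z| * gradient_norm g z + `|g z| * gradient_norm f z.
Proof.
move=> df dg; rewrite !gradient_normE.
under eq_bigr => i _ do rewrite (has_pder_der (has_pderM (has_pder_pderivable (df i)) (has_pder_pderivable (dg i)))).
rewrite (le_trans (sqrt_sum_triangle _ _))// lerD//.
  under eq_bigr do rewrite exprMn.
  by rewrite -mulr_sumr sqrtrM ?sqr_ge0// sqrtr_sqr.
under eq_bigr do rewrite exprMn.
by rewrite -mulr_sumr sqrtrM ?sqr_ge0// sqrtr_sqr.
Qed.

Lemma gn_comp_le f g z : (forall y, `|f y - f z| <= `|g y - g z|) ->
  (forall i, pderivable (ev i) f z) -> (forall i, pderivable (ev i) g z) ->
  gradient_norm f z <= gradient_norm g z.
Proof.
move=> h df dg; rewrite !gradient_normE ler_wsqrtr//; apply: ler_sum => i _.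
rewrite -(real_normK (num_real (real_derive f z (ev i)))) -(real_normK (num_real (real_derive g z (ev i)))).
rewrite lerXn2r ?nnegrE//; exact: (has_pder_le h (has_pder_pderivable (df i)) (has_pder_pderivable (dg i))).
Qed.

Lemma gn_near f z e : 0 < e -> (forall y, enorm (y - z) < e -> f y = f z) ->
  gradient_norm f z = 0.
Proof.
move=> e0 h; rewrite gradient_normE big1 ?sqrtr0// => i _.
rewrite (@der_near _ _ (ev i) f (fun=> f z) z e e0 h) (has_pder_der (has_pder_cst _ _ _)).
by rewrite expr0n.
Qed.

(** Almost everywhere the gradient of a maximum is the gradient of the larger function;
    this is what makes the energies of a finite maximum add up. *)
Lemma gn_max f g z : (forall i, pderivable (ev i) f z) -> (forall i, pderivable (ev i) g z) ->
  (forall i, pderivable (ev i) (fun y => Num.max (f y) (g y)) z) ->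
  gradient_norm (fun y => Num.max (f y) (g y)) z =
    if g z <= f z then gradient_norm f z else gradient_norm g z.
Proof.
move=> df dg dm; rewrite !gradient_normE.
have E i := has_pder_max (has_pder_pderivable (df i)) (has_pder_pderivable (dg i)) (has_pder_pderivable (dm i)).
under eq_bigr do rewrite E.
by case: ifP.
Qed.

Lemma gn_min0 f z : (forall y, 0 <= f y) -> f z = 0 -> (forall i, pderivable (ev i) f z) ->
  gradient_norm f z = 0.
Proof.
move=> f0 fz df; rewrite gradient_normE big1 ?sqrtr0// => i _.
by rewrite (has_pder_min f0 fz (has_pder_pderivable (df i))) expr0n.
Qed.

Lemma lip_ae_all f : lip f -> {ae leb R d, forall z, forall i, pderivable (ev i) f z}.
Proof. by move=> [k k0 fk]; apply: ae_fin => i; exact: lip_ae_pderivable fk. Qed.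

(** A piecewise affine function of the distance to [x]: the slopes [2 ^+ n.+2] and [2 ^+ n]
    make it vanish below 2^-(n+2) and above 2^(1-n), with the shell between 2^-(n+1) and
    2^-n where it is 1. *)
Definition dyadic_cutoff (x : T) (n : nat) z : R :=
  clamp (Num.min (2 ^+ n.+2 * enorm (z - x) - 1) (2 - 2 ^+ n * enorm (z - x))).

Lemma dyadic_cutoff01 x n z : 0 <= dyadic_cutoff x n z <= 1. Proof. exact: clamp01. Qed.

Lemma dyadic_cutoff_lip x n : lipk (2 ^+ n.+2) (dyadic_cutoff x n).
Proof.
move=> y z; rewrite (le_trans (clamp_lip _ _))//.
have h : `|enorm (y - x) - enorm (z - x)| <= enorm (y - z).
  by rewrite (le_trans (ler_dist_enorm _ _))// opprB addrA subrK.
have P0 : 0 < 2 ^+ n :> R by rewrite exprn_gt0.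
rewrite (@le_trans _ _ (2 ^+ n.+2 * `|enorm (y - x) - enorm (z - x)|))//; last first.
  by rewrite ler_wpM2l// exprn_ge0.
rewrite -[X in _ <= X * _](gtr0_norm (exprn_gt0 n.+2 (ltr0n R 2))) -normrM.
rewrite !exprS; move: P0 (enorm (y - x)) (enorm (z - x)); move: (2 ^+ n) => P P0 s t.
wlog st : s t / s <= t.
  move=> H; have [st|/ltW st] := leP s t; first exact: H.
  by rewrite distrC -[leRHS]normrN -[X in _ <= `|X|]mulrN opprB; exact: H.
have Pst : P * s <= P * t by rewrite ler_wpM2l// ltW.
rewrite (ler0_norm (x := 2 * (2 * P) * (s - t))); last first.
  by rewrite mulr_ge0_le0 ?subr_le0// ?mulr_ge0 ?(ltW P0).
rewrite ler_norml.
by case: (leP (2 * (2 * P) * s - 1) (2 - P * s)) => ?;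
  case: (leP (2 * (2 * P) * t - 1) (2 - P * t)) => ?; apply/andP; split; lra.
Qed.

Lemma dyadic_cutoff_in x n z : 2 ^- n.+1 <= enorm (z - x) <= 2 ^- n -> dyadic_cutoff x n z = 1.
Proof.
move=> /andP[h1 h2]; apply: clamp_ge1.
have P0 : 0 < 2 ^+ n :> R by rewrite exprn_gt0.
rewrite le_min; apply/andP; split.
  have : 2 ^+ n.+1 * 2 ^- n.+1 <= 2 ^+ n.+1 * enorm (z - x) by rewrite ler_wpM2l// exprn_ge0.
  rewrite mulfV ?expf_neq0// [2 ^+ n.+2]exprS -mulrA.
  by move: (2 ^+ n.+1 * _) => t ?; lra.
have : 2 ^+ n * enorm (z - x) <= 2 ^+ n * 2 ^- n by rewrite ler_wpM2l// exprn_ge0.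
rewrite mulfV ?expf_neq0//.
by move: (2 ^+ n * _) => t ?; lra.
Qed.

Lemma dyadic_cutoff_small x n z : enorm (z - x) <= 2 ^- n.+2 -> dyadic_cutoff x n z = 0.
Proof.
move=> h; apply: clamp_le0; rewrite ge_min; apply/orP; left.
have : 2 ^+ n.+2 * enorm (z - x) <= 2 ^+ n.+2 * 2 ^- n.+2 by rewrite ler_wpM2l// exprn_ge0.
by rewrite mulfV ?expf_neq0// subr_le0.
Qed.

Lemma dyadic_cutoff_large x n z : 2 * 2 ^- n <= enorm (z - x) -> dyadic_cutoff x n z = 0.
Proof.
move=> h; apply: clamp_le0; rewrite ge_min; apply/orP; right.
have : 2 ^+ n * (2 * 2 ^- n) <= 2 ^+ n * enorm (z - x) by rewrite ler_wpM2l// exprn_ge0.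
by rewrite mulrCA mulfV ?expf_neq0// mulr1 subr_le0.
Qed.

Lemma tri_lt x y z (c : R) : enorm (y - z) < c - enorm (z - x) -> enorm (y - x) < c.
Proof.
move=> h; apply: (le_lt_trans (ler_enormB3 y x z)).
by rewrite -ltrBrDr.
Qed.

Lemma tri_gt x y z (c : R) : enorm (y - z) < enorm (z - x) - c -> c < enorm (y - x).
Proof.
move=> h; have h' := ler_enormB3 z x y; rewrite (enormBC z y) in h'.
by rewrite -(ltrD2l (enorm (y - z))) (lt_le_trans _ h')// -ltrBrDr.
Qed.

End cutoffs.

(** * Capacity inside one dyadic shell *)

Section shell.
Context {R : realType} {d : nat}.
Notation T := 'rV[C R]_d.
Implicit Types (u f g : T -> R) (x z : T).

Definition shellC (q : R) : R :=
  2 `^ q * (1 + ((2 * d)%:R * 4 * 3) `^ q * hardyC (R := R) (d := d) q).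

Lemma gn_dyadic_cutoff x n z : (forall i, pderivable (ev i) (dyadic_cutoff x n) z) ->
  gradient_norm (dyadic_cutoff x n) z <= (2 * d)%:R * 4 * 2 ^+ n.
Proof.
move=> h; rewrite (le_trans (gn_le_lip (@dyadic_cutoff_lip R d x n) _ h)) ?exprn_ge0//.
by rewrite !exprS -!mulrA ler_wpM2l// !mulrA -natrM.
Qed.

(** With [e = 2^-n] the regularised distance is comparable to 2^-n on the support of the
    cutoff, so its gradient can be absorbed by the Hardy weight. *)
Lemma scale_bound x n z (q : R) : 0 < q -> enorm (z - x) <= 2 * 2 ^- n ->
  (2 ^+ n) `^ q <= 3 `^ q * reg_sqdist x (2 ^- n) z `^ (- (q / 2)).
Proof.
move=> q0 h.
have P0 : 0 < 2 ^+ n :> R by rewrite exprn_gt0.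
have e0 : 0 < 2 ^- n :> R by rewrite invr_gt0.
have S0 := reg_sqdist_gt0 x e0 z.
have hS : reg_sqdist x (2 ^- n) z <= (3 * 2 ^- n) ^+ 2.
  rewrite reg_sqdistE; have := enorm_ge0 (z - x); move: h e0.
  by move: (2 ^- n) (enorm _) => e r h e0 r0; nra.
have : reg_sqdist x (2 ^- n) z `^ (q / 2) <= (3 * 2 ^- n) `^ q.
  have -> : (3 * 2 ^- n) `^ q = ((3 * 2 ^- n) ^+ 2) `^ (q / 2) :> R.
    have E0 : 0 <= 3 * 2 ^- n :> R by rewrite mulr_ge0// ltW.
    by rewrite -(powR_mulrn 2 E0) -powRrM mulrCA divff ?mulr1.
  by rewrite ge0_ler_powR// ?nnegrE ?divr_ge0 ?(ltW q0) ?(ltW S0) ?sqr_ge0.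
have PV : (2 ^- n : R) `^ q = ((2 ^+ n) `^ q)^-1.
  apply: (mulIf (x := (2 ^+ n : R) `^ q)); first by rewrite gt_eqF// powR_gt0.
  rewrite mulVf ?gt_eqF ?powR_gt0// -powRM ?(ltW e0) ?(ltW P0)//.
  by rewrite mulVf ?gt_eqF// powR1.
rewrite powRN powRM ?(ltW e0)// PV.
have A0 : 0 < reg_sqdist x (2 ^- n) z `^ (q / 2) by exact: powR_gt0.
have B0 : 0 < (2 ^+ n : R) `^ q by exact: powR_gt0.
have C0 : 0 < (3 : R) `^ q by exact: powR_gt0.
move: A0 B0 C0; move: (_ `^ (q / 2)) (_ `^ q) (3 `^ q) => A B c A0 B0 c0.
by rewrite ler_pdivlMr// ler_pdivlMr// mulrC.
Qed.

Lemma shell_alg (c h I0 Iw Iu t : R) : 0 <= c -> 0 <= h -> Iw <= h * I0 ->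
  I0 <= Iu -> Iu <= t -> I0 + c * Iw <= (1 + c * h) * t.
Proof.
move=> c0 h0 hw h1 h2; have h3 := le_trans h1 h2.
have h4 : c * Iw <= c * (h * t) by rewrite ler_wpM2l// (le_trans hw)// ler_wpM2l.
by rewrite mulrDl mul1r -mulrA lerD.
Qed.

(** A competitor for the capacity of [K], truncated to [0, 1] and multiplied by the dyadic
    cutoff.  The gradient of the cutoff costs 2^n times the competitor, and Hardy's
    inequality bounds the corresponding integral by the energy of the competitor. *)
Lemma exists_shell_function x n q (K : set T) (t : R) : 1 < q -> q < (2 * d)%:R ->
  (capacity_compact q K < t%:E)%E ->
  exists W : T -> R, [/\ lip W, forall z, 0 <= W z <= 1,
    forall z, enorm (z - x) <= 2 ^- n.+2 \/ 2 * 2 ^- n <= enorm (z - x) -> W z = 0,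
    forall z, K z -> 2 ^- n.+1 <= enorm (z - x) <= 2 ^- n -> W z = 1 &
    intg (fun z => gradient_norm W z `^ q) <= shellC q * t].
Proof.
move=> q1 q2d /ereal_inf_lt[_ [u [/lipschitz_lip lu /compact_support_bsupp [M bu] uK] <-]] ut.
have q0 : 0 < q by exact: lt_trans q1.
pose u0 z := clamp (u z).
have l0 : lip u0 by exact: lip_clamp.
have b0 : bsupp M u0 by move=> z /bu; rewrite /u0 => ->; rewrite clamp_le0.
have u01 z : 0 <= u0 z <= 1 by exact: clamp01.
have ld : lip (dyadic_cutoff x n) by exists (2 ^+ n.+2); [rewrite exprn_gt0|exact: dyadic_cutoff_lip].
pose W z := dyadic_cutoff x n z * u0 z.
have lW : lip W by apply: (lipM_bsupp l0 b0); exact: lip_loclip.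
have bW : bsupp M W by exact: bsuppMl.
exists W; split => //.
- move=> z; have /andP[a0 a1] := dyadic_cutoff01 x n z; have /andP[c0 c1] := u01 z.
  by rewrite mulr_ge0//= mulr_ile1.
- by move=> z [/dyadic_cutoff_small|/dyadic_cutoff_large] h; rewrite /W h mul0r.
- by move=> z Kz h; rewrite /W dyadic_cutoff_in// mul1r /u0 clamp_ge1// uK.
have e0 : 0 < 2 ^- n :> R by rewrite invr_gt0 exprn_gt0.
have hh := hardy x e0 q1 q2d l0 b0 u01.
have bg v : lip v -> bsupp M v -> bmc (fun z => gradient_norm v z `^ q).
  by move=> lv bv; apply: bmc_powR => //; [exact: gn_ge0|exact: bmc_gn bv].
have ut' : intg (fun z => gradient_norm u z `^ q) < t.
  rewrite -lte_fin; apply: le_lt_trans ut.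
  by rewrite -(intgE (bg _ lu bu)).
have gu : intg (fun z => gradient_norm u0 z `^ q) <= intg (fun z => gradient_norm u z `^ q).
  apply: le_intg_ae; [exact: bg|exact: bg|].
  apply: aeS2 (lip_ae_all l0) (lip_ae_all lu) => z h1 h2.
  rewrite ge0_ler_powR// ?(ltW q0) ?nnegrE ?gn_ge0//.
  by apply: gn_comp_le => // y; exact: clamp_lip.
pose c : R := ((2 * d)%:R * 4 * 3) `^ q.
pose wu z := reg_sqdist x (2 ^- n) z `^ (- (q / 2)) * u0 z `^ q.
have bwu : bmc wu by exact: (bmc_hardy x e0 q1 l0 b0 u01).
have hW : intg (fun z => gradient_norm W z `^ q) <=
    intg (fun z => 2 `^ q * (gradient_norm u0 z `^ q + c * wu z)).
  apply: le_intg_ae; [exact: bg|by apply: bmcZ; apply: bmcD; [exact: bg|exact: bmcZ]|].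
  apply: aeS2 (lip_ae_all l0) (lip_ae_all ld) => z h1 h2.
  have /andP[a0 a1] := dyadic_cutoff01 x n z; have /andP[c0 c1] := u01 z.
  pose B := u0 z * gradient_norm (dyadic_cutoff x n) z.
  have B0 : 0 <= B by rewrite mulr_ge0// gn_ge0.
  have gW : gradient_norm W z <= gradient_norm u0 z + B.
    rewrite (le_trans (gnM h2 h1))// (ger0_norm a0) (ger0_norm c0) lerD2r.
    by rewrite ler_piMl// gn_ge0.
  rewrite (le_trans (y := (gradient_norm u0 z + B) `^ q))//.
    by rewrite ge0_ler_powR// ?(ltW q0) ?nnegrE ?addr_ge0 ?gn_ge0.
  rewrite (le_trans (powRD2 q0 (gn_ge0 _ _) B0))// ler_wpM2l ?powR_ge0// lerD2l.
  have [hr|hr] := leP (enorm (z - x)) (2 * 2 ^- n).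
    have Bc : B <= u0 z * ((2 * d)%:R * 4 * 2 ^+ n) by rewrite ler_wpM2l// gn_dyadic_cutoff.
    rewrite (le_trans (y := (u0 z * ((2 * d)%:R * 4 * 2 ^+ n)) `^ q))//.
      by rewrite ge0_ler_powR// ?(ltW q0) ?nnegrE ?(le_trans B0 Bc).
    rewrite !powRM// ?mulr_ge0// ?exprn_ge0// /c /wu !powRM ?mulr_ge0//.
    have := scale_bound q0 hr; have := powR_ge0 (u0 z) q; have := powR_ge0 ((2 * d)%:R : R) q.
    have := powR_ge0 (4 : R) q.
    move: (_ `^ q) (_ `^ q) (4 `^ q) (_ `^ (- (q / 2))) ((2 ^+ n) `^ q) (3 `^ q).
    move=> a b f s P t3 f0 b0' a0' hP.
    rewrite [leRHS](_ : _ = a * (b * f * (t3 * s))) ?ler_wpM2l ?mulr_ge0//; ring.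
  have -> : B = 0.
    rewrite /B (@gn_near _ _ _ z (enorm (z - x) - 2 * 2 ^- n)) ?mulr0 ?subr_gt0//.
    move=> y hy; rewrite (dyadic_cutoff_large (ltW hr)) dyadic_cutoff_large//.
    exact: ltW (tri_gt hy).
  rewrite powR0 ?gt_eqF// mulr_ge0 ?powR_ge0// mulr_ge0 ?powR_ge0//.
rewrite (le_trans hW)// intgZ; last by apply: bmcD; [exact: bg|exact: bmcZ].
rewrite intgD; [|exact: bg|exact: bmcZ].
rewrite intgZ// /shellC -mulrA ler_wpM2l ?powR_ge0//.
have H0 : 0 <= hardyC (R := R) (d := d) q.
  rewrite /hardyC mulr_ge0 ?powR_ge0// divr_ge0 ?subr_ge0 ?(ltW q2d)//.
  by rewrite mulr_ge0// ltW.
have c0 : 0 <= c by exact: powR_ge0.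
exact: (shell_alg c0 H0 hh gu (ltW ut')).
Qed.

End shell.

(** * Capacities and the weight of the pole *)

Section capacities.
Context {R : realType} {d : nat}.
Notation T := 'rV[C R]_d.
Implicit Types (u f g : T -> R) (x z : T) (K E : set T).

Lemma capacity_compact_ge0 q K : (0 <= capacity_compact q K)%E.
Proof.
apply: le_ereal_inf_tmp => _ [u _ <-]; apply: integral_ge0 => z _.
by rewrite lee_fin powR_ge0.
Qed.

Lemma capacity_compact_mono q K K' : K `<=` K' ->
  (capacity_compact q K <= capacity_compact q K')%E.
Proof.
move=> KK; apply: ereal_inf_le_tmp => _ [u [lu bu uK] <-]; exists u => //.
by split => // z /KK; exact: uK.
Qed.

Lemma le_capacity q K E : compact K -> K `<=` E ->
  (capacity_compact q K <= capacity q E)%E.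
Proof.
move=> cK KE; rewrite /capacity; case: pselect => cE.
  exact: capacity_compact_mono.
by apply: ereal_sup_ubound; exists K.
Qed.

Lemma capacity_ge0 q E : (0 <= capacity q E)%E.
Proof.
apply: le_trans (capacity_compact_ge0 q set0) (le_capacity q _ _) => //.
exact: compact0.
Qed.

(** Compact subsets of the open annulus minus [U], exhausting it as [de] tends to 0;
    the capacity of a set that is not compact sees only its compact subsets. *)
Definition dyadic_core (U : set T) x n (de : R) : set T :=
  [set z | ~ U z /\ 2 ^- n.+1 + de <= enorm (z - x) <= 2 ^- n - de].

Lemma compact_core U x n de : open U -> compact (dyadic_core U x n de).
Proof.
move=> /open_eopen oU; apply: (@closed_bounded_compact _ _ _ (2 ^- n - de + enorm x)).
  move=> z nz; have D y : enorm (y - x) <= enorm (y - z) + enorm (z - x) by exact: ler_enormB3.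
  have D' y : enorm (z - x) <= enorm (y - z) + enorm (y - x).
    by rewrite -(enormBC z); exact: ler_enormB3.
  have [Uz|nUz] := pselect (U z).
    by have [e e0 h] := oU z Uz; exists e => // y /h Uy [].
  have [lo|lo] := ltP (enorm (z - x)) (2 ^- n.+1 + de).
    exists (2 ^- n.+1 + de - enorm (z - x)); first by rewrite subr_gt0.
    by move=> y hy [_ /andP[+ _]]; apply/negP; rewrite -ltNge (le_lt_trans (D y))// -ltrBrDr.
  have [hi|hi] := ltP (2 ^- n - de) (enorm (z - x)).
    exists (enorm (z - x) - (2 ^- n - de)); first by rewrite subr_gt0.
    move=> y hy [_ /andP[_]]; apply/negP; rewrite -ltNge.
    rewrite -(ltrD2l (enorm (y - z))) (lt_le_trans _ (D' y))//.
    by rewrite -ltrBrDr.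
  by exfalso; apply: nz; rewrite /dyadic_core/= lo hi.
move=> z [_ /andP[_ h]]; rewrite -{1}(subrK x z) (le_trans (ler_enormD _ _))// lerD2r.
exact: h.
Qed.

Lemma core_annulus U x n de : 0 < de -> dyadic_core U x n de `<=` annulus x n `\` U.
Proof.
move=> de0 z [nU /andP[h1 h2]]; split => //; rewrite /annulus/=.
by rewrite (lt_le_trans _ h1) ?ltrDl// (le_lt_trans h2)// gtrDl oppr_lt0.
Qed.

(** The factor |z - x|^(1-2d) of the representation formula, made bounded by freezing it at
    distances below [rho]. *)
Definition pole_weight x (rho : R) z : R := ((Num.max rho (enorm (z - x)))^-1) ^+ (2 * d).-1.

Lemma pole_weight_ge0 x rho z : 0 < rho -> 0 <= pole_weight x rho z.
Proof. by move=> r0; rewrite exprn_ge0// invr_ge0 le_max (ltW r0). Qed.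

Lemma pole_weight_le x rho z r : 0 < rho -> 0 < r -> r <= rho \/ r <= enorm (z - x) ->
  pole_weight x rho z <= r^-1 ^+ (2 * d).-1.
Proof.
move=> r0 s0 h; have m0 : 0 < Num.max rho (enorm (z - x)) by rewrite lt_max r0.
rewrite lerXn2r ?nnegrE ?invr_ge0 ?(ltW s0) ?(ltW m0)//.
rewrite lef_pV2 ?posrE// le_max.
by case: h => ->; rewrite ?orbT.
Qed.

Lemma loclip_pole_weight x rho : 0 < rho -> loclip (pole_weight x rho).
Proof.
move=> r0; apply: loclipX; apply: (loclipV r0).
  by move=> z; rewrite le_max lexx.
by apply: lip_loclip; apply: lip_max; [exact: lip_cst|exact: lip_dist].
Qed.

Lemma bmc_weighted_gn x rho q M u : 0 < rho -> 0 < q -> lip u -> bsupp M u ->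
  bmc (fun z => (pole_weight x rho z * gradient_norm u z) `^ q).
Proof.
move=> r0 q0 lu bu; apply: bmc_powR => //.
  by move=> z; rewrite mulr_ge0 ?gn_ge0 ?pole_weight_ge0.
have lo := loclip_pole_weight x r0.
by apply: bmcM; [exact: bmc_gn bu|exact: loclip_measurable|exact: loclip_bounded].
Qed.

(** By [gn_max] the integrand on the left is almost everywhere one of the two integrands
    on the right. *)
Lemma weighted_gn_max x rho q M u g : 0 < rho -> 0 < q -> lip u -> bsupp M u ->
  lip g -> bsupp M g ->
  intg (fun z => (pole_weight x rho z * gradient_norm (fun y => Num.max (u y) (g y)) z) `^ q) <=
  intg (fun z => (pole_weight x rho z * gradient_norm u z) `^ q) +
  intg (fun z => (pole_weight x rho z * gradient_norm g z) `^ q).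
Proof.
move=> r0 q0 lu bu lg bg.
have lm : lip (fun y => Num.max (u y) (g y)) by exact: lip_max.
have bm : bsupp M (fun y => Num.max (u y) (g y)).
  by move=> z Mz; rewrite bu// bg// maxxx.
have B f : lip f -> bsupp M f -> bmc (fun z => (pole_weight x rho z * gradient_norm f z) `^ q).
  by move=> lf bf; exact: bmc_weighted_gn bf.
rewrite -intgD; [|exact: B|exact: B].
apply: le_intg_ae; [exact: B|by apply: bmcD; exact: B|].
apply: aeS2 (lip_ae_all lm) (aeS2 (fun z a b => conj a b) (lip_ae_all lu) (lip_ae_all lg)).
move=> z h1 [h2 h3]; rewrite (gn_max h2 h3 h1).
by case: ifP => _; [rewrite lerDl|rewrite lerDr]; exact: powR_ge0.
Qed.

Lemma weighted_gn_shell x rho q M W r : 0 < rho -> 0 < q -> lip W -> bsupp M W -> 0 < r ->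
  (forall z, enorm (z - x) <= r -> W z = 0) ->
  intg (fun z => (pole_weight x rho z * gradient_norm W z) `^ q) <=
  (r^-1 ^+ (2 * d).-1) `^ q * intg (fun z => gradient_norm W z `^ q).
Proof.
move=> rho0 q0 lW bW r0 W0.
have r1 : 0 <= r^-1 ^+ (2 * d).-1 by rewrite exprn_ge0// invr_ge0 ltW.
have B : bmc (fun z => gradient_norm W z `^ q).
  by apply: bmc_powR => //; [exact: gn_ge0|exact: bmc_gn bW].
rewrite -intgZ//; apply: le_intg; [exact: bmc_weighted_gn bW|exact: bmcZ|].
move=> z; have [hr|hr] := leP r (enorm (z - x)).
  rewrite -powRM ?gn_ge0// ge0_ler_powR ?(ltW q0) ?nnegrE ?mulr_ge0 ?gn_ge0 ?pole_weight_ge0//.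
  by rewrite ler_wpM2r ?gn_ge0// pole_weight_le//; right.
rewrite (@gn_near _ _ _ z (r - enorm (z - x))) ?subr_gt0//; last first.
  move=> y hy; rewrite (W0 _ (ltW hr)) W0//.
  by rewrite (le_trans (ler_enormB3 y x z))// -lerBrDr ltW.
by rewrite mulr0 powR0 ?gt_eqF// mulr0.
Qed.

End capacities.

(** * The barrier *)

Section barrier.
Context {R : realType} {d : nat}.
Notation T := 'rV[C R]_d.
Variables (x : T) (q : R) (U : set T).
Hypotheses (d1 : (1 <= d)%N) (q1 : 1 < q) (q2d : q < (2 * d)%:R) (oU : open U).

Definition series_weight (n : nat) : R := 2 `^ (n%:R * (2 * d%:R - 1) * q).

Lemma series_weight_gt0 n : 0 < series_weight n. Proof. exact: powR_gt0. Qed.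

(** The pole weight at the inner edge 2^-(n+2) of the support of the n-th shell function is,
    to the power [q], a constant multiple of the coefficient of the series. *)
Lemma series_weight_shift n : ((2 ^- n.+2)^-1 ^+ (2 * d).-1) `^ q = series_weight 2 * series_weight n.
Proof.
rewrite invrK -exprM -powR_mulrn// -powRrM /series_weight -powRD ?pnatr_eq0 ?implybT//; congr powR.
rewrite natrM -subn1 natrB ?muln_gt0// natrM -mulrDl -mulrDl; congr (_ * _ * _).
by rewrite -natrD.
Qed.

Lemma shellC_ge0 : 0 <= shellC (R := R) (d := d) q.
Proof.
have q0 : 0 < q by exact: lt_trans q1.
have H0 : 0 <= hardyC (R := R) (d := d) q.
  rewrite /hardyC mulr_ge0 ?powR_ge0// divr_ge0 ?subr_ge0 ?(ltW q2d)//.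
  by rewrite mulr_ge0// ltW.
by rewrite /shellC mulr_ge0 ?powR_ge0// addr_ge0// mulr_ge0 ?powR_ge0.
Qed.

(** The maximum of the shell functions of the first [N] shells. *)
Lemma barrier_step (t : nat -> R) (de rho : R) : 0 < de -> 0 < rho ->
  (forall n, (0 < n)%N -> (capacity q (annulus x n `\` U) < (t n)%:E)%E) ->
  forall N, exists v : T -> R, [/\ lip v, forall z, 0 <= v z <= 1,
    forall z, enorm (z - x) <= 2 ^- N.+2 \/ 1 <= enorm (z - x) -> v z = 0,
    forall n z, (0 < n <= N)%N -> dyadic_core U x n de z -> v z = 1 &
    intg (fun z => (pole_weight x rho z * gradient_norm v z) `^ q) <=
      series_weight 2 * shellC (R := R) (d := d) q * \sum_(1 <= n < N.+1) series_weight n * t n].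
Proof.
move=> de0 rho0 ht; have q0 : 0 < q by exact: lt_trans q1.
elim=> [|N [v [lv v01 v0 v1 vI]]].
  exists (fun=> 0); split => //.
  - exact: lip_cst.
  - by move=> z; rewrite lexx ler01.
  - by move=> n z /andP[+ n0]; rewrite ltnNge n0.
  - rewrite big_geq// mulr0 (_ : (fun z => _) = fun=> 0).
      by rewrite /intg /Rintegral integral0_eq.
    apply/funext => z; rewrite (@gn_near _ _ _ z 1)// mulr0 powR0// gt_eqF//.
have tN := le_lt_trans (le_capacity q (@compact_core _ _ U x N.+1 de oU) (@core_annulus _ _ U x N.+1 de de0)) (ht N.+1 isT).
have [W [lW W01 W0 W1 WI]] := exists_shell_function x N.+1 q1 q2d tN.
have two1 : 2 * 2 ^- N.+1 <= 1 :> R.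
  by rewrite exprS invfM mulrA divff// mul1r invf_le1// exprn_ege1// ler1n.
have mono : 2 ^- N.+3 <= 2 ^- N.+2 :> R.
  by rewrite lef_pV2 ?posrE ?exprn_gt0// ler_eXn2l// ltr1n.
have big z : enorm x + 1 < enorm z -> 1 <= enorm (z - x).
  move=> h; have := ler_enormD (z - x) x; rewrite subrK => h'.
  by rewrite -(lerD2r (enorm x)) (le_trans _ h')// addrC ltW.
have bv : bsupp (enorm x + 1) v by move=> z /big h; apply: v0; right.
have bW : bsupp (enorm x + 1) W.
  by move=> z /big h; apply: W0; right; exact: le_trans two1 h.
exists (fun z => Num.max (v z) (W z)); split.
- exact: lip_max.
- move=> z; have /andP[a0 a1] := v01 z; have /andP[c0 c1] := W01 z.
  by rewrite le_max a0/= ge_max a1.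
- move=> z h; rewrite v0 ?W0 ?maxxx//.
    by case: h => h; [left|right; exact: le_trans two1 h].
  by case: h => h; [left; exact: le_trans mono|right].
- move=> n z /andP[n0 nN] hz.
  have /andP[a0 a1] := v01 z; have /andP[c0 c1] := W01 z.
  move: nN; rewrite leq_eqVlt => /predU1P[nE|nN].
    subst n; rewrite W1//; first by apply/max_idPr.
    case: hz => _ /andP[h1 h2]; rewrite (le_trans _ h1) ?lerDl ?(ltW de0)//.
    by rewrite (le_trans h2)// gerDl oppr_le0 (ltW de0).
  by rewrite (v1 n)// ?n0//; apply/max_idPl.
- apply: le_trans (weighted_gn_max x rho0 q0 lv bv lW bW) _.
  rewrite big_nat_recr//= mulrDr; apply: lerD; first exact: vI.
  have r0 : 0 < 2 ^- N.+3 :> R by rewrite invr_gt0 exprn_gt0.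
  have Wr z : enorm (z - x) <= 2 ^- N.+3 -> W z = 0 by move=> h; apply: W0; left.
  have := weighted_gn_shell rho0 q0 lW bW r0 Wr; rewrite series_weight_shift => hs.
  apply: le_trans hs _; move: WI; have := series_weight_gt0 2; have := series_weight_gt0 N.+1.
  move: (series_weight 2) (series_weight _) (intg _) (shellC _) => a b I s b0 a0 h.
  by rewrite [leRHS](_ : _ = a * b * (s * t N.+1)) ?ler_wpM2l ?mulr_ge0 ?(ltW a0) ?(ltW b0)//; ring.
Qed.

Lemma sum_geom N : \sum_(1 <= n < N.+1) 2 ^- n <= 1 :> R.
Proof.
suff -> : \sum_(1 <= n < N.+1) 2 ^- n = 1 - 2 ^- N :> R by rewrite gerBl invr_ge0 exprn_ge0.
elim: N => [|N IH]; first by rewrite big_geq// expr0 invr1 subrr.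
rewrite big_nat_recr//= IH exprS invfM.
have : (2 : R) ^+ N != 0 by rewrite expf_neq0.
by move: (2 ^+ N) => y y0; field.
Qed.

Hypothesis hsum : (\sum_(1 <= n <oo)
     (2 `^ (n%:R * (2 * d%:R - 1) * q))%:E * capacity q (annulus x n `\` U)
   < +oo)%E.

(** The constant does not depend on the number of shells, on the distance [de] kept from
    the spheres or on the freezing radius [rho] of the weight; this uniformity is what the
    convergence of the series provides. *)
Lemma barrier : exists2 S : R, 0 <= S & forall de rho N, 0 < de -> 0 < rho ->
  exists v : T -> R, [/\ lip v, forall z, 0 <= v z <= 1,
    forall z, enorm (z - x) <= 2 ^- N.+2 \/ 1 <= enorm (z - x) -> v z = 0,
    forall n z, (0 < n <= N)%N -> dyadic_core U x n de z -> v z = 1 &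
    intg (fun z => (pole_weight x rho z * gradient_norm v z) `^ q) <= S].
Proof.
pose F n : \bar R := ((series_weight n)%:E * capacity q (annulus x n `\` U))%E.
have F0 n : (0 <= F n)%E by rewrite mule_ge0 ?capacity_ge0// lee_fin ltW ?series_weight_gt0.
have part N : (\sum_(1 <= n < N.+1) F n <= \sum_(1 <= n <oo) F n)%E.
  exact: nneseries_lim_ge.
have Fs : (\sum_(1 <= n <oo) F n)%E \is a fin_num.
  by rewrite ge0_fin_numE// nneseries_ge0.
have cf n : (0 < n)%N -> capacity q (annulus x n `\` U) \is a fin_num.
  move=> n0; rewrite ge0_fin_numE ?capacity_ge0// ltey; apply/eqP => ce.
  have := le_lt_trans (part n) hsum; rewrite big_nat_recr//= {2}/F ce.
  rewrite gt0_muley ?lte_fin ?series_weight_gt0// addey; first by rewrite ltxx.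
  by rewrite gt_eqF// (lt_le_trans ltNy0)// sume_ge0.
(* Each capacity is enlarged by a term of a convergent series, so that the infimum
   defining it is strictly below [t n]. *)
pose t n := fine (capacity q (annulus x n `\` U)) + (series_weight n)^-1 * 2 ^- n.
have tp n : 0 < (series_weight n)^-1 * 2 ^- n by rewrite mulr_gt0 ?invr_gt0 ?series_weight_gt0 ?exprn_gt0.
have ht n : (0 < n)%N -> (capacity q (annulus x n `\` U) < (t n)%:E)%E.
  by move=> n0; rewrite -[X in (X < _)%E]fineK ?cf// lte_fin ltrDl tp.
pose S := series_weight 2 * shellC (R := R) (d := d) q * (fine (\sum_(1 <= n <oo) F n)%E + 1).
have w0 : 0 <= series_weight 2 * shellC (R := R) (d := d) q by rewrite mulr_ge0 ?shellC_ge0 ?(ltW (series_weight_gt0 _)).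
exists S.
  by rewrite mulr_ge0// addr_ge0// fine_ge0// nneseries_ge0.
move=> de rho N de0 rho0; have [v [h1 h2 h3 h4 h5]] := barrier_step de0 rho0 ht N.
exists v; split => //; apply: le_trans h5 _; rewrite ler_wpM2l//.
have -> : \sum_(1 <= n < N.+1) series_weight n * t n =
    \sum_(1 <= n < N.+1) series_weight n * fine (capacity q (annulus x n `\` U)) + \sum_(1 <= n < N.+1) 2 ^- n.
  rewrite -big_split/=; apply: eq_bigr => n _.
  by rewrite mulrDr mulrA divff ?mul1r// gt_eqF ?series_weight_gt0.
apply: lerD; last exact: sum_geom.
rewrite -lee_fin fineK// (le_trans _ (part N))// -sumEFin big_nat [leRHS]big_nat.
apply: lee_sum => n /andP[n0 _]; rewrite /F EFinM fineK// cf//.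
Qed.

End barrier.

(** * Thin spherical layers *)

Section layers.
Context {R : realType} {d : nat}.
Notation T := 'rV[C R]_d.
Notation mu := (leb R d).
Implicit Types (x z : T) (A : set T).

Lemma bmc_indic A M : measurable A -> (forall z, A z -> enorm z <= M) ->
  bmc (\1_A : T -> R).
Proof.
move=> mA hA; split; first exact: measurable_indic.
exists (Num.max 1 M) => z; split.
  by rewrite le_max indicE; case: (_ \in _); rewrite ?normr1 ?normr0 ?lexx ?ler01.
rewrite gt_max => /andP[_ h]; rewrite indicE memNset// => /hA.
by rewrite leNgt h.
Qed.

Lemma leb_indic A : measurable A -> bmc (\1_A : T -> R) ->
  mu A = (intg (\1_A : T -> R))%:E.
Proof. by move=> mA bA; rewrite -(intgE bA) integral_indic// setIT. Qed.

Lemma measurable_dist x : measurable_fun setT (fun z : T => enorm (z - x) : measurableTypeR R).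
Proof. exact: loclip_measurable (lip_loclip (lip_dist x)). Qed.

Definition layer x (s de : R) : set T := [set z | `|enorm (z - x) - s| <= de].

Lemma measurable_layer x s de : measurable (layer x s de).
Proof.
have -> : layer x s de = setT `&` (fun z => enorm (z - x) : measurableTypeR R) @^-1` `[s - de, s + de]%classic.
  by rewrite setTI; apply/seteqP; split => z; rewrite /layer/= in_itv/= ler_distl.
by apply: measurable_dist => //; exact: measurable_itv.
Qed.

Lemma layer_bounded x s de z : layer x s de z -> enorm z <= s + de + enorm x.
Proof.
rewrite /layer/= ler_distl => /andP[_ h].
by rewrite -{1}(subrK x z) (le_trans (ler_enormD _ _))// lerD2r.
Qed.

Lemma enorm2_line (w : T) t i : enorm (w + rs t (ev i)) ^+ 2 =
  enorm w ^+ 2 + (2 * t * co i w + t ^+ 2).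
Proof.
rewrite !enorm2 (bigD1 i)//= [in RHS](bigD1 i)//= coD co_rs co_ev eqxx mulr1.
have -> : \sum_(j | j != i) co j (w + rs t (ev i)) ^+ 2 = \sum_(j | j != i) co j w ^+ 2.
  by apply: eq_bigr => j ji; rewrite coD co_rs co_ev (negbTE ji) mulr0 addr0.
move: (\sum_(_ | _) _) => S; ring.
Qed.

(** A line parallel to a coordinate axis meets a sphere in at most two points. *)
Lemma sphere_null x s : (0 < d)%N -> mu (layer x s 0) = 0%E.
Proof.
move=> d0; pose i : @ix d := (Ordinal d0, false).
apply: (@null_lines R d _ (ev i) (measurable_layer x s 0)) => z.
pose w := z - x; pose D := s ^+ 2 - enorm w ^+ 2 + co i w ^+ 2.
pose B : set R := [set - co i w + Num.sqrt D] `|` [set - co i w - Num.sqrt D].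
have B0 : lebesgue_measure (B : set (measurableTypeR R)) = 0%E.
  apply: countable_lebesgue_measure0; apply: finite_set_countable.
  by rewrite finite_setU; split; exact: finite_set1.
have mB : measurable (B : set (measurableTypeR R)).
  by apply: measurableU; exact: measurable_set1.
exists B; split => //= t /= /contrapT; rewrite /layer/= normr_le0 subr_eq0 => /eqP h.
have : (t + co i w) ^+ 2 = D.
  rewrite /D -h (_ : z + rs t (ev i) - x = w + rs t (ev i)); last by rewrite /w addrAC.
  by rewrite enorm2_line; ring.
move=> hD; have : `|t + co i w| = Num.sqrt D by rewrite -hD sqrtr_sqr.
have [h0|/ltW h0] := leP 0 (t + co i w).
  by rewrite ger0_norm// => E; left; rewrite /= -E; ring.
by rewrite ler0_norm// => E; right; rewrite /= -E; ring.
Qed.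

(** Continuity from above of the measure, along layers that shrink to a null sphere. *)
Lemma thin_layer x s e : (0 < d)%N -> 0 < e ->
  exists2 de, 0 < de & intg (\1_(layer x s de) : T -> R) <= e.
Proof.
move=> d0 e0; pose F n := layer x s n.+1%:R^-1.
have bF n : bmc (\1_(F n) : T -> R).
  by apply: bmc_indic; [exact: measurable_layer|move=> z; exact: layer_bounded].
have capF : \bigcap_n F n = layer x s 0.
  apply/seteqP; split => z /= h; last by move=> n _; rewrite /F /layer/= (le_trans h).
  rewrite /layer/= leNgt; apply/negP => h0.
  pose n := Num.trunc (`|enorm (z - x) - s|^-1).
  have := h n I; rewrite /F /layer/= leNgt => /negP; apply.
  rewrite -[ltRHS]invrK ltf_pV2 ?posrE ?invr_gt0//; exact: truncnS_gt.
have fF n : mu (F n) = (intg (\1_(F n) : T -> R))%:E.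
  by apply: leb_indic => //; exact: measurable_layer.
have H : mu \o F @ \oo --> 0%E.
  rewrite -(sphere_null x s d0) -capF; apply: nonincreasing_cvg_mu.
  - exact: (eq_ind_r (fun y => (y < +oo)%E) (ltry _) (fF 0%N)).
  - by move=> n; exact: measurable_layer.
  - by rewrite capF; exact: measurable_layer.
  - move=> n m nm; apply/subsetPset => z; rewrite /F /layer/= => h; apply: le_trans h _.
    by rewrite lef_pV2 ?posrE// ler_nat.
have /fine_cvgP [_] := H.
move=> /cvgrPdist_le/(_ e e0) [n _ /(_ n (leqnn n))] /=.
rewrite sub0r normrN => h; exists n.+1%:R^-1; first by rewrite invr_gt0.
have hn : fine (mu (F n)) = intg (\1_(F n) : T -> R) by rewrite fF.
by rewrite -[leLHS]hn; exact: le_trans (ler_norm _) h.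
Qed.

End layers.

(** * The test function *)

Section testfun.
Context {R : realType} {d : nat}.
Notation T := 'rV[C R]_d.
Implicit Types (u f g v tau : T -> R) (x z : T).

Lemma shell_index (r : R) N : 2 ^- N.+1 < r -> r <= 2^-1 ->
  exists2 n, (0 < n <= N)%N & 2 ^- n.+1 < r <= 2 ^- n.
Proof.
elim: N => [|N IH] h r2; first by move: h; rewrite expr1 ltNge r2.
have [hr|hr] := ltP (2 ^- N.+1) r.
  by have [n /andP[n0 nN] hn] := IH hr r2; exists n; rewrite // n0/= (leq_trans nN).
by exists N.+1; rewrite ?leqnn// h hr.
Qed.

Lemma thin_layers x N e : (0 < d)%N -> 0 < e -> exists2 de : R, 0 < de &
  forall n, (n < N)%N -> intg (\1_(layer x (2 ^- n) de) : T -> R) <= e.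
Proof.
move=> d0 e0; elim: N => [|N [de de0 h]]; first by exists 1.
have [de' de'0 h'] := thin_layer x (2 ^- N) d0 e0.
have bl s k : bmc (\1_(layer x s k) : T -> R).
  by apply: bmc_indic; [exact: measurable_layer|move=> z; exact: layer_bounded].
have mono s k k' : k <= k' ->
    intg (\1_(layer x s k) : T -> R) <= intg (\1_(layer x s k') : T -> R).
  move=> kk; apply: le_intg; [exact: bl|exact: bl|move=> z].
  rewrite !indicE; have [hz|nz] := pselect (layer x s k z).
    rewrite !mem_set//; exact: le_trans hz kk.
  by rewrite memNset.
exists (Num.min de de'); first by rewrite lt_min de0.
move=> n; rewrite ltnS leq_eqVlt => /predU1P[->|nN].
  by rewrite (le_trans _ h')// mono// ge_min lexx orbT.
by rewrite (le_trans _ (h n nN))// mono// ge_min lexx.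
Qed.

(** Localisation near the pole: 1 within distance 1/4 and 0 from distance 1/2 on. *)
Definition ball_cutoff x z : R := clamp (2 - 4 * enorm (z - x)).

Lemma ball_cutoff_lip x : lipk 4 (ball_cutoff x).
Proof.
move=> y z; rewrite (le_trans (clamp_lip _ _))//.
rewrite (_ : _ - _ = 4 * (enorm (z - x) - enorm (y - x))); last by ring.
rewrite normrM ger0_norm// ler_wpM2l// (le_trans (ler_dist_enorm _ _))//.
by rewrite enormBC opprB addrA subrK.
Qed.

Lemma ball_cutoff_in x z : enorm (z - x) <= 4^-1 -> ball_cutoff x z = 1.
Proof. by move=> h; apply: clamp_ge1; move: h; move: (enorm _) => r h; lra. Qed.

Lemma ball_cutoff_out x z : 2^-1 <= enorm (z - x) -> ball_cutoff x z = 0.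
Proof. by move=> h; apply: clamp_le0; move: h; move: (enorm _) => r h; lra. Qed.

Definition ball_cutoffC : R := 4 ^+ (2 * d).-1 * ((2 * d)%:R * 4).

Lemma weighted_gn_ball_cutoff x rho z : 0 < rho -> (forall i, pderivable (ev i) (ball_cutoff x) z) ->
  pole_weight x rho z * gradient_norm (ball_cutoff x) z <= ball_cutoffC * \1_(cube d 1 : set T) (z - x).
Proof.
move=> r0 dth; have C0 : 0 <= ball_cutoffC by rewrite mulr_ge0// exprn_ge0.
have I0 : 0 <= ball_cutoffC * \1_(cube d 1 : set T) (z - x).
  by rewrite mulr_ge0// indicE; case: (_ \in _).
have [h|h] := ltP (enorm (z - x)) 4^-1.
  rewrite (@gn_near _ _ _ z (4^-1 - enorm (z - x))) ?subr_gt0 ?mulr0//.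
  by move=> y /tri_lt/ltW hy; rewrite !ball_cutoff_in// ltW.
have [h2|h2] := ltP 2^-1 (enorm (z - x)).
  rewrite (@gn_near _ _ _ z (enorm (z - x) - 2^-1)) ?subr_gt0 ?mulr0//.
  by move=> y /tri_gt/ltW hy; rewrite !ball_cutoff_out// ltW.
rewrite indicE mem_set; last first.
  move=> i; rewrite (le_trans (co_le_enorm _ _))// (le_trans h2)//.
  by rewrite invf_le1// ler1n.
rewrite mulr1 /ball_cutoffC ler_pM ?pole_weight_ge0 ?gn_ge0//.
  by rewrite (le_trans (pole_weight_le r0 _ (or_intror h)))// invrK.
exact: (gn_le_lip (@ball_cutoff_lip x) _ dth).
Qed.

(** Dropping the regularisation increases the kernel, and |z - x|^(-2d) times |z - x| is the
    pole weight. *)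
Lemma kernel_le_pole_weight x e rho z : (0 < d)%N -> 0 < e -> 0 < rho -> rho <= enorm (z - x) ->
  reg_kernel x e z * enorm (z - x) <= pole_weight x rho z.
Proof.
move=> d0 e0 r0 hr; have s0 : 0 < enorm (z - x) by exact: lt_le_trans hr.
rewrite /pole_weight (max_idPr hr) /reg_kernel reg_sqdistE; move: s0; move: (enorm _) => s s0.
have dE : (2 * d)%N = (2 * d).-1.+1 by rewrite prednK// muln_gt0.
have h : s ^+ 2 ^+ d <= (s ^+ 2 + e ^+ 2) ^+ d.
  by rewrite lerXn2r ?nnegrE ?addr_ge0 ?sqr_ge0// lerDl sqr_ge0.
have h' : ((s ^+ 2 + e ^+ 2) ^+ d)^-1 <= (s ^+ 2 ^+ d)^-1.
  rewrite lef_pV2 ?posrE// ?exprn_gt0//.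
  by rewrite addr_gt0// exprn_gt0.
rewrite (le_trans (ler_wpM2r (ltW s0) h'))// -exprM {1}dE exprS invfM exprVn.
by rewrite mulrAC mulVf ?mul1r// gt_eqF.
Qed.

(** The first factor localises near [x], the factor [tau] to the region where the analytic
    function is defined, and [1 - v] removes the complement of [U]. *)
Definition test_fun x tau v z : R := ball_cutoff x z * (tau z * (1 - v z)).

Section test_fun.
Variables (x : T) (tau v : T -> R) (k : R).
Hypotheses (k0 : 0 < k) (ltau : lipk k tau) (tau01 : forall z, 0 <= tau z <= 1).
Hypotheses (lv : lip v) (v01 : forall z, 0 <= v z <= 1).
Notation ph := (test_fun x tau v).

Lemma ball_cutoff_bsupp : bsupp (enorm x + 1) (ball_cutoff x).
Proof.
move=> z h; have := ler_enormD (z - x) x; rewrite subrK => h'.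
apply: ball_cutoff_out; have : 1 <= enorm (z - x).
  by rewrite -(lerD2r (enorm x)) (le_trans _ h')// addrC ltW.
by apply: le_trans; rewrite invf_le1// ler1n.
Qed.

Lemma lip_ball_cutoff : lip (ball_cutoff x).
Proof. by exists 4; last exact: ball_cutoff_lip. Qed.

Lemma lip_tau : lip tau. Proof. by exists k. Qed.

Lemma lip_1v : lip (fun z => 1 - v z).
Proof. by apply: lipD; [exact: lip_cst|exact: lipN]. Qed.

Lemma test_fun_lip : lip ph.
Proof.
rewrite (_ : ph = fun z => (tau z * (1 - v z)) * ball_cutoff x z); last first.
  by apply/funext => z; rewrite mulrC.
apply: (lipM_bsupp lip_ball_cutoff ball_cutoff_bsupp).
by apply: loclipM; apply: lip_loclip; [exact: lip_tau|exact: lip_1v].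
Qed.

Lemma test_fun_bsupp : bsupp (enorm x + 1) ph.
Proof. by move=> z /ball_cutoff_bsupp h; rewrite /test_fun h mul0r. Qed.

Lemma test_fun01 z : 0 <= ph z <= 1.
Proof.
have /andP[a0 a1] := tau01 z; have /andP[b0 b1] := v01 z.
have /andP[c0 c1] := clamp01 (2 - 4 * enorm (z - x)).
have w0 : 0 <= 1 - v z by rewrite subr_ge0.
have w1 : 1 - v z <= 1 by rewrite gerBl.
by rewrite !mulr_ge0//= mulr_ile1 ?mulr_ile1 ?mulr_ge0.
Qed.

Lemma test_fun_gn z : (forall i, pderivable (ev i) (ball_cutoff x) z) -> (forall i, pderivable (ev i) tau z) ->
  (forall i, pderivable (ev i) v z) ->
  gradient_norm ph z <= gradient_norm (ball_cutoff x) z + gradient_norm tau z + gradient_norm v z.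
Proof.
move=> d1 d2 d3.
have d4 i : pderivable (ev i) (fun z => 1 - v z) z.
  exact: has_pderW (has_pderB (has_pder_cst _ _ _) (has_pder_pderivable (d3 i))).
have d5 i : pderivable (ev i) (fun z => tau z * (1 - v z)) z.
  exact: has_pderW (has_pderM (has_pder_pderivable (d2 i)) (has_pder_pderivable (d4 i))).
have g4 : gradient_norm (fun z => 1 - v z) z <= gradient_norm v z.
  apply: gn_comp_le => // y.
  by rewrite (_ : 1 - v y - (1 - v z) = - (v y - v z)) ?normrN//; ring.
have /andP[a0 a1] := tau01 z; have /andP[b0 b1] := v01 z.
have /andP[c0 c1] := clamp01 (2 - 4 * enorm (z - x)).
have w0 : 0 <= 1 - v z by rewrite subr_ge0.
have w1 : 1 - v z <= 1 by rewrite gerBl.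
have cut1 (c g : R) : 0 <= c -> c <= 1 -> 0 <= g -> `|c| * g <= g.
  by move=> h1 h2 g0; rewrite ger0_norm// ler_piMl.
have g0 f : 0 <= gradient_norm f z by exact: gn_ge0.
have t1 : 0 <= tau z * (1 - v z) by rewrite mulr_ge0.
have t2 : tau z * (1 - v z) <= 1 by rewrite mulr_ile1.
apply: le_trans (gnM d1 d5) _.
apply: le_trans (lerD (cut1 _ _ c0 c1 (g0 _)) (cut1 _ _ t1 t2 (g0 _))) _.
rewrite [leLHS]addrC -addrA lerD2l.
apply: le_trans (gnM d2 d4) _.
apply: le_trans (lerD (cut1 _ _ a0 a1 (g0 _)) (cut1 _ _ w0 w1 (g0 _))) _.
by rewrite [leLHS]addrC lerD2l.
Qed.

End test_fun.
End testfun.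

(** * Pointwise estimate of the flux *)

Section fluxest.
Context {R : realType} {d : nat}.
Notation T := 'rV[C R]_d.
Variables (x : T) (p q : R) (U : set T).
Hypotheses (d1 : (0 < d)%N) (q1 : 1 < q) (pq : (p - 1) * (q - 1) = 1).

(** The scale [s] makes Young's inequality homogeneous: with [s] at least the p-norm of [F],
    the integral of the right-hand side is at most a multiple of [s]. *)
Lemma young_scaled (s F H : R) : 0 < s -> 0 <= F -> 0 <= H ->
  F * H <= s * ((F / s) `^ p + H `^ q).
Proof.
move=> s0 F0 H0; have Fs0 : 0 <= F / s by rewrite divr_ge0// ltW.
have := @young_powR R q 1 ((F / s) `^ (p - 1)) H q1 ltr01 (powR_ge0 _ _) H0.
rewrite -!powRrM pq powRr1// powR1 !mul1r.
have -> : (p - 1) * q = p by move: pq; rewrite mulrBr mulr1 => /(canRL (subrK _)) ->; ring.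
move=> h; have -> : F * H = s * (F / s * H) by field; rewrite gt_eqF.
by rewrite ler_wpM2l// ltW.
Qed.

Lemma young_one (lam h : R) : 0 < lam -> 0 <= h ->
  h <= lam + lam `^ (1 - q) * h `^ q.
Proof.
move=> l0 h0; have := @young_powR R q lam 1 h q1 l0 ler01 h0.
by rewrite !powR1 mul1r mulr1.
Qed.

Variables (a b tau FU : T -> R) (M k : R).
Hypotheses (aM : forall z, `|a z| <= M) (bM : forall z, `|b z| <= M).
Hypotheses (aF : forall z, U z -> `|a z| <= FU z) (bF : forall z, U z -> `|b z| <= FU z).
Hypothesis FU0 : forall z, 0 <= FU z.
Hypotheses (k0 : 0 < k) (ltau : lipk k tau) (tau01 : forall z, 0 <= tau z <= 1).
Hypothesis tauU : forall z, U z -> exists2 r, 0 < r & forall y, enorm (y - z) < r -> tau y = 1.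
Variables (N : nat) (de : R) (v : T -> R).
Let rho : R := 2 ^- N.+2.
Hypothesis taux : forall y, enorm (y - x) < rho -> tau y = 1.
Hypotheses (lv : lip v) (v01 : forall z, 0 <= v z <= 1).
Hypothesis v0 : forall z, enorm (z - x) <= 2 ^- N.+2 \/ 1 <= enorm (z - x) -> v z = 0.
Hypothesis v1 : forall n z, (0 < n <= N)%N -> dyadic_core U x n de z -> v z = 1.

(** A sum of indicator functions, at least 1 on the part of the complement of [U] that the
    barrier does not control: the ball of radius 2^-(N+1), and the layers about the spheres
    of dyadic radius. *)
Definition bad_weight z : R := 1 * \1_(cube d (2 ^- N.+1) : set T) (z - x) +
  \sum_(n < N.+2) \1_(layer x (2 ^- n) de) z.

Lemma bad_weight_ge0 z : 0 <= bad_weight z.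
Proof.
rewrite /bad_weight addr_ge0//.
by apply: sumr_ge0 => n _; rewrite indicE; case: (_ \in _).
Qed.

Lemma bad_weight_small z : enorm (z - x) <= 2 ^- N.+1 -> 1 <= bad_weight z.
Proof.
move=> h; rewrite /bad_weight mul1r indicE mem_set; last first.
  by move=> i; exact: le_trans (co_le_enorm _ _) h.
by rewrite lerDl; apply: sumr_ge0 => n _; rewrite indicE; case: (_ \in _).
Qed.

Lemma bad_weight_layer z n : (n < N.+2)%N -> layer x (2 ^- n) de z -> 1 <= bad_weight z.
Proof.
move=> nN h; rewrite /bad_weight mul1r (bigD1 (Ordinal nN))//= indicE [X in _ + (X + _)]indicE.
rewrite (mem_set h) addrCA lerDl addr_ge0//.
by apply: sumr_ge0 => i _; rewrite indicE; case: (_ \in _).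
Qed.

(** Outside the bad set, a point of the complement of [U] near [x] lies in one of the
    sets on which the barrier is 1. *)
Lemma bad_or_core z : ~ U z -> enorm (z - x) <= 2^-1 -> 1 <= bad_weight z \/ v z = 1.
Proof.
move=> nU r2; have [/bad_weight_small|hr] := leP (enorm (z - x)) (2 ^- N.+1); first by left.
have [n /andP[n0 nN] /andP[h1 h2]] := shell_index hr r2.
have [hn|nn] := pselect (layer x (2 ^- n) de z).
  by left; apply: bad_weight_layer hn; rewrite ltnS (leq_trans nN).
have [hn|nn'] := pselect (layer x (2 ^- n.+1) de z).
  by left; apply: bad_weight_layer hn; rewrite !ltnS.
right; apply: (@v1 n); first by rewrite n0.
split => //.
move: nn nn' => /negP; rewrite -ltNge => nn /negP; rewrite -ltNge => nn'.
apply/andP; split.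
  by move: nn'; rewrite ger0_norm ?subr_ge0 ?(ltW h1)// ltrBrDl => /ltW.
by move: nn; rewrite ler0_norm ?subr_le0// opprB ltrBrDr -ltrBrDl => /ltW; rewrite lerBrDr addrC -lerBrDr.
Qed.

Notation ph := (test_fun x tau v).
Let h z := pole_weight x rho z * gradient_norm v z.
(** Bound for the kernel times the gradient of the test function on [U], where [tau] is
    locally constant. *)
Definition fluxH z := h z + ball_cutoffC (R := R) (d := d) * \1_(cube d 1 : set T) (z - x).
(** Bound for the kernel times the gradients of [tau] and of the ball cutoff on the bad set. *)
Definition fluxW : R := rho^-1 ^+ (2 * d).-1 * ((2 * d)%:R * (4 + k)).

Let rho0 : 0 < rho. Proof. by rewrite invr_gt0 exprn_gt0. Qed.

Let rho4 : rho <= 4^-1.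
Proof.
rewrite /rho lef_pV2 ?posrE ?exprn_gt0// !exprS mulrA -natrM ler_peMr//.
by rewrite exprn_ege1// ler1n.
Qed.

Let h0 z : 0 <= h z. Proof. by rewrite mulr_ge0 ?pole_weight_ge0 ?gn_ge0. Qed.

Lemma fluxH_ge0 z : 0 <= fluxH z.
Proof.
have C0 : 0 <= ball_cutoffC (R := R) (d := d) by rewrite /ball_cutoffC mulr_ge0// exprn_ge0.
have I0 : 0 <= \1_(cube d 1 : set T) (z - x) :> R by rewrite indicE; case: (_ \in _).
by apply: addr_ge0; [exact: h0|exact: mulr_ge0].
Qed.

Lemma fluxW_ge0 : 0 <= fluxW.
Proof.
apply: mulr_ge0; first by apply: exprn_ge0; rewrite invr_ge0; exact: ltW rho0.
by apply: mulr_ge0 => //; apply: addr_ge0 => //; exact: ltW.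
Qed.

(** Within distance [rho] of [x] the test function is 1.  On [U] the cutoff [tau] is locally
    1.  Elsewhere the test function vanishes off the bad set, and a nonnegative function
    has zero gradient where it vanishes. *)
Lemma kernel_cases e z : 0 < e ->
  (forall i, pderivable (ev i) (ball_cutoff x) z) -> (forall i, pderivable (ev i) tau z) ->
  (forall i, pderivable (ev i) v z) -> (forall i, pderivable (ev i) ph z) ->
  let Q := reg_kernel x e z * enorm (z - x) * gradient_norm ph z in
  [\/ Q = 0, U z /\ Q <= fluxH z | 1 <= bad_weight z /\ Q <= fluxW + h z].
Proof.
move=> e0 hth hta hv hph Q.
have [hr|hr] := ltP (enorm (z - x)) rho.
  constructor 1; rewrite /Q (@gn_near _ _ _ z (rho - enorm (z - x))) ?subr_gt0 ?mulr0//.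
  have one y : enorm (y - x) < rho -> ph y = 1.
    move=> hy; rewrite /test_fun taux// v0 ?subr0; last by left; exact: ltW.
    by rewrite ball_cutoff_in ?mulr1// (le_trans (ltW hy)).
  by move=> y /tri_lt hy; rewrite !one.
have g0 f : 0 <= gradient_norm f z by exact: gn_ge0.
have o0 := pole_weight_ge0 x z rho0.
have Qo : Q <= pole_weight x rho z * gradient_norm ph z by rewrite ler_wpM2r// kernel_le_pole_weight.
have Qs : Q <= pole_weight x rho z * (gradient_norm (ball_cutoff x) z + gradient_norm tau z) + h z.
  rewrite (le_trans Qo)// /h -mulrDr ler_wpM2l//.
  exact: (test_fun_gn tau01 v01 hth hta hv).
have [Uz|nU] := pselect (U z).
  constructor 2; split => //; have [r r0 hr'] := tauU Uz.
  have tz : gradient_norm tau z = 0.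
    by apply: (gn_near r0) => y /hr' ->; rewrite hr'// subrr enorm0.
  by move: Qs; rewrite tz addr0 addrC => /le_trans; apply; rewrite lerD2l weighted_gn_ball_cutoff.
have zero : ph z = 0 -> Q = 0.
  move=> pz; rewrite /Q (gn_min0 _ pz hph) ?mulr0// => y.
  by have /andP[] := test_fun01 x tau01 v01 y.
have [r2|r2] := leP (enorm (z - x)) 2^-1; last first.
  by constructor 1; apply: zero; rewrite /test_fun ball_cutoff_out ?mul0r// ltW.
have [hb|hv1] := bad_or_core nU r2; last first.
  by constructor 1; apply: zero; rewrite /test_fun hv1 subrr !mulr0.
constructor 3; split => //; rewrite (le_trans Qs)// lerD2r /fluxW ler_pM//.
- by rewrite addr_ge0.
- by apply: pole_weight_le => //; left.
- rewrite mulrDr lerD//; first exact: (gn_le_lip (@ball_cutoff_lip _ _ x) _ hth).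
  exact: (gn_le_lip ltau (ltW k0) hta).
Qed.

(** The first term is the contribution of [U].  In the second one the gradient of the
    barrier, which is not bounded, has been split by [young_one] into [lam] on the bad set
    and a term whose integral is small for large [lam]. *)
Definition fluxB (s lam : R) z : R :=
  2 * s * ((FU z / s) `^ p + fluxH z `^ q) +
  2 * M * ((fluxW + lam) * bad_weight z + lam `^ (1 - q) * h z `^ q).

Lemma flux_le e s lam : 0 < e -> 0 < s -> 0 < lam ->
  {ae leb R d, forall z, `|flux x e a b ph z| <= fluxB s lam z}.
Proof.
move=> e0 s0 lam0.
have lph : lip ph by exact: (test_fun_lip x k0 ltau lv).
have lta : lip tau by exact: (lip_tau k0 ltau).
apply: aeS2 (aeS2 (fun z u w => conj u w) (lip_ae_all (lip_ball_cutoff x)) (lip_ae_all lta))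
  (aeS2 (fun z u w => conj u w) (lip_ae_all lv) (lip_ae_all lph)).
move=> z [hth hta] [hv hph].
have M0 : 0 <= M by exact: le_trans (normr_ge0 _) (aM z).
have A0 : 0 <= 2 * s * ((FU z / s) `^ p + fluxH z `^ q).
  by rewrite mulr_ge0 ?mulr_ge0 ?(ltW s0)// addr_ge0// powR_ge0.
have B0 : 0 <= 2 * M * ((fluxW + lam) * bad_weight z + lam `^ (1 - q) * h z `^ q).
  rewrite mulr_ge0 ?mulr_ge0// addr_ge0// mulr_ge0 ?powR_ge0 ?bad_weight_ge0//.
  by rewrite addr_ge0 ?fluxW_ge0 ?(ltW lam0).
have [Q0|[Uz Qz]|[hb Qz]] := kernel_cases e0 hth hta hv hph.
- by rewrite (le_trans (flux_bound x ph e0 (aM z) (bM z)))// Q0 !mulr0 addr_ge0.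
- rewrite (le_trans (flux_bound x ph e0 (aF Uz) (bF Uz)))// ler_wpDr//.
  rewrite -(mulrA 2 s) ler_wpM2l//; apply: le_trans (young_scaled s0 (FU0 z) (fluxH_ge0 z)).
  by rewrite ler_wpM2l.
- rewrite (le_trans (flux_bound x ph e0 (aM z) (bM z)))// ler_wpDl//.
  rewrite -(mulrA 2 M) ler_wpM2l// ler_wpM2l//.
  have hy := young_one lam0 (h0 z).
  rewrite (le_trans Qz)// (le_trans (lerD (lexx _) hy))// addrA lerD2r.
  by rewrite ler_peMr// addr_ge0 ?fluxW_ge0 ?(ltW lam0).
Qed.

End fluxest.

(** * Integrated estimate of the flux *)

Section upper.
Context {R : realType} {d : nat}.
Notation T := 'rV[C R]_d.
Variables (x : T) (p q : R) (U : set T).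
Hypotheses (d1 : (0 < d)%N) (q1 : 1 < q) (p1 : 1 < p) (pq : (p - 1) * (q - 1) = 1).
Variable S : R.
Hypothesis S0 : 0 <= S.

Definition fluxC : R := 2 `^ q * (S + ball_cutoffC (R := R) (d := d) `^ q * 2 ^+ (2 * d)).

Lemma pow_small (c : R) : 0 < c -> exists N, 2 ^- N <= c.
Proof.
move=> c0; exists (Num.trunc c^-1).+1.
rewrite -[leRHS]invrK lef_pV2 ?posrE ?exprn_gt0 ?invr_gt0//.
have h : c^-1 < (Num.trunc c^-1).+1%:R by exact: truncnS_gt.
rewrite (le_trans (ltW h))// -natrX ler_nat; exact: ltnW (ltn_expl _ _).
Qed.

Lemma intg_bad_weight N : exists2 de : R, 0 < de &
  bmc (bad_weight x N de) /\ intg (bad_weight x N de) <= 2 * (2 ^- N) ^+ (2 * d).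
Proof.
have e0 : 0 < (2 ^- N) ^+ (2 * d) / N.+2%:R :> R.
  by rewrite divr_gt0// exprn_gt0// invr_gt0 exprn_gt0.
have [de de0 hde] := thin_layers x N.+2 d1 e0; exists de => //.
have bl (n : 'I_N.+2) : bmc (\1_(layer x (2 ^- n) de) : T -> R).
  by apply: bmc_indic; [exact: measurable_layer|move=> z; exact: layer_bounded].
have bc : bmc (fun z => 1 * \1_(cube d (2 ^- N.+1) : set T) (z - x) : R).
  exact: bmc_indic_cube.
have bs : bmc (fun z => \sum_(n < N.+2) \1_(layer x (2 ^- n) de) z : R) by exact: bmc_sum.
split; first exact: bmcD.
rewrite intgD//= intg_indic_cube ?invr_ge0 ?exprn_ge0// intg_sum//.
have -> : 2 * 2 ^- N.+1 = 2 ^- N :> R by rewrite exprS invfM mulrA divff ?mul1r.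
rewrite mul1r mulrDl mul1r lerD2l.
rewrite (le_trans (ler_sum _ (fun (n : 'I_N.+2) _ => hde n (ltn_ord n))))//.
rewrite sumr_const card_ord -[leLHS]mulr_natr.
by rewrite divfK// pnatr_eq0.
Qed.

Lemma intg_fluxH N v M : 0 < q -> lip v -> bsupp M v ->
  intg (fun z => (pole_weight x (2 ^- N.+2) z * gradient_norm v z) `^ q) <= S ->
  bmc (fun z => fluxH x N v z `^ q) /\ intg (fun z => fluxH x N v z `^ q) <= fluxC.
Proof.
move=> q0 lv bv hS; have r0 : 0 < 2 ^- N.+2 :> R by rewrite invr_gt0 exprn_gt0.
have C0 : 0 <= ball_cutoffC (R := R) (d := d) by rewrite /ball_cutoffC mulr_ge0// exprn_ge0.
have bh : bmc (fun z => pole_weight x (2 ^- N.+2) z * gradient_norm v z).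
  have lo := @loclip_pole_weight _ _ x _ r0.
  by apply: bmcM; [exact: bmc_gn bv|exact: loclip_measurable|exact: loclip_bounded].
have bq := bmc_weighted_gn x r0 q0 lv bv.
have bc c : bmc (fun z => c * \1_(cube d 1 : set T) (z - x) : R) by exact: bmc_indic_cube.
have bF : bmc (fun z => fluxH x N v z `^ q).
  by apply: bmc_powR => // [z|]; [exact: fluxH_ge0|exact: bmcD].
split => //.
have hB : bmc (fun z => 2 `^ q * ((pole_weight x (2 ^- N.+2) z * gradient_norm v z) `^ q +
   ball_cutoffC (R := R) (d := d) `^ q * \1_(cube d 1 : set T) (z - x))).
  by apply: bmcZ; exact: bmcD.
apply: le_trans (le_intg bF hB _) _ => [z|].
  have I0 : 0 <= \1_(cube d 1 : set T) (z - x) :> R by rewrite indicE; case: (_ \in _).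
  rewrite (le_trans (powRD2 q0 _ _))//.
  - by rewrite mulr_ge0 ?pole_weight_ge0 ?gn_ge0.
  - exact: mulr_ge0.
  rewrite ler_wpM2l ?powR_ge0// lerD2l powRM// ler_wpM2l ?powR_ge0//.
  by rewrite indicE; case: (_ \in _); rewrite ?powR1// powR0// gt_eqF.
rewrite intgZ; last exact: bmcD.
rewrite intgD// ler_wpM2l ?powR_ge0// lerD//.
by rewrite intg_indic_cube// mulr1.
Qed.

Variables (a b tau FU : T -> R) (M k r0 s : R).
Hypotheses (la : locb a) (lb : locb b).
Hypotheses (aM : forall z, `|a z| <= M) (bM : forall z, `|b z| <= M).
Hypotheses (aF : forall z, U z -> `|a z| <= FU z) (bF : forall z, U z -> `|b z| <= FU z).
Hypotheses (FU0 : forall z, 0 <= FU z) (bFU : bmc FU).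
Hypotheses (s0 : 0 < s) (FUs : intg (fun z => FU z `^ p) <= s `^ p).
Hypotheses (k0 : 0 < k) (ltau : lipk k tau) (tau01 : forall z, 0 <= tau z <= 1).
Hypothesis tauU : forall z, U z -> exists2 r, 0 < r & forall y, enorm (y - z) < r -> tau y = 1.
Hypotheses (r00 : 0 < r0) (taux : forall y, enorm (y - x) < r0 -> tau y = 1).
Hypothesis HCR : forall z, CR a b z \/
  (exists2 r, 0 < r & forall y, enorm (y - z) < r -> tau y = 0).
Hypothesis Hbar : forall de rho N, 0 < de -> 0 < rho ->
  exists v : T -> R, [/\ lip v, forall z, 0 <= v z <= 1,
    forall z, enorm (z - x) <= 2 ^- N.+2 \/ 1 <= enorm (z - x) -> v z = 0,
    forall n z, (0 < n <= N)%N -> dyadic_core U x n de z -> v z = 1 &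
    intg (fun z => (pole_weight x rho z * gradient_norm v z) `^ q) <= S].

Let M0 : 0 <= M. Proof. exact: le_trans (normr_ge0 _) (aM 0). Qed.

Lemma flux_intg N lam : 0 < lam -> 2 ^- N.+2 <= r0 -> exists f : T -> R,
  [/\ lip f, bsupp (enorm x + 1) f, forall z, 0 <= f z <= 1,
    forall y, enorm (y - x) < 2 ^- N.+2 -> f y = 1 /\
    forall z, 2^-1 <= enorm (z - x) -> f z = 0 &
    forall e, 0 < e -> intg (fun z => a z * (f z * chi x e z)) <=
     2 * s * (1 + fluxC) + 2 * M * ((fluxW (R := R) (d := d) k N + lam) * (2 * (2 ^- N) ^+ (2 * d))
       + lam `^ (1 - q) * S)].
Proof.
move=> lam0 hN; have q0 : 0 < q by exact: lt_trans q1.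
have rho0 : 0 < 2 ^- N.+2 :> R by rewrite invr_gt0 exprn_gt0.
have [de de0 [bbd hbd]] := intg_bad_weight N.
have [v [lv v01 v0 v1 vS]] := Hbar N de0 rho0.
have tx y : enorm (y - x) < 2 ^- N.+2 -> tau y = 1 by move=> h; apply: taux; exact: lt_le_trans hN.
have rho4 : 2 ^- N.+2 <= 4^-1 :> R.
  rewrite lef_pV2 ?posrE ?exprn_gt0// !exprS mulrA -natrM ler_peMr//.
  by rewrite exprn_ege1// ler1n.
have bv : bsupp (enorm x + 1) v.
  move=> z h; apply: v0; right; have := ler_enormD (z - x) x; rewrite subrK => h'.
  by rewrite -(lerD2r (enorm x)) (le_trans _ h')// addrC ltW.
have lf : lip (test_fun x tau v) by exact: (test_fun_lip x k0 ltau lv).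
have bf : bsupp (enorm x + 1) (test_fun x tau v) by exact: test_fun_bsupp.
exists (test_fun x tau v); split => //.
- exact: test_fun01.
- move=> y hy; split; last by move=> z hz; rewrite /test_fun ball_cutoff_out ?mul0r.
  rewrite /test_fun tx// v0 ?subr0; last by left; exact: ltW.
  by rewrite ball_cutoff_in ?mulr1// (le_trans (ltW hy)).
move=> e e0.
have HH z : CR a b z \/ (exists2 r, 0 < r & forall y, enorm (y - z) < r -> test_fun x tau v y = 0).
  have [h|[r r1 h]] := HCR z; first by left.
  by right; exists r => // y /h ty; rewrite /test_fun ty mul0r mulr0.
rewrite (repr_kernel x e0 la lb lf bf HH).
have bfl := bmc_flux x e0 la lb lf bf.
rewrite (le_trans (ler_norm _))// normrN (le_trans (intg_norm bfl))//.
have [bH hH] := intg_fluxH q0 lv bv vS.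
have bq := bmc_weighted_gn x rho0 q0 lv bv.
have bFs : bmc (fun z => (FU z / s) `^ p).
  apply: bmc_powR; first exact: lt_trans p1.
    by move=> z; rewrite divr_ge0// ltW.
  by under eq_fun do rewrite mulrC; exact: bmcZ.
have hFs : intg (fun z => (FU z / s) `^ p) <= 1.
  have bFp : bmc (fun z => FU z `^ p) by apply: bmc_powR => //; exact: lt_trans p1.
  have -> : (fun z => (FU z / s) `^ p) = fun z => (s `^ p)^-1 * FU z `^ p.
    apply/funext => z; rewrite powRM ?invr_ge0 ?(ltW s0)// mulrC; congr (_ * _).
    apply: (mulIf (x := s `^ p)); first by rewrite gt_eqF// powR_gt0.
    rewrite mulVf ?gt_eqF ?powR_gt0// -powRM ?invr_ge0 ?(ltW s0)//.
    by rewrite mulVf ?gt_eqF// powR1.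
  by rewrite intgZ// ler_pdivrMl ?powR_gt0// mulr1.
have b1 : bmc (fun z => 2 * s * ((FU z / s) `^ p + fluxH x N v z `^ q)).
  by apply: bmcZ; exact: bmcD.
have b2 : bmc (fun z => (fluxW (R := R) (d := d) k N + lam) * bad_weight x N de z +
   lam `^ (1 - q) * (pole_weight x (2 ^- N.+2) z * gradient_norm v z) `^ q).
  by apply: bmcD; exact: bmcZ.
have b3 := bmcZ (2 * M) b2.
have bB : bmc (fluxB x p q FU M k N de v s lam) by exact: bmcD b1 b3.
have bN : bmc (fun z => `|flux x e a b (test_fun x tau v) z|).
  case: (bfl) => mf [K hK]; split; first exact: measurableT_comp.
  exists K => z; have [h1 h2] := hK z; rewrite normr_id; split => //.
  by move=> /h2 ->; rewrite normr0.
have := le_intg_ae bN bB (flux_le d1 q1 pq aM bM aF bF FU0 k0 ltau tau01 tauU tx lv v01 v0 v1 e0 s0 lam0).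
move=> h; apply: le_trans h _.
rewrite /fluxB (intgD b1 b3); apply: lerD.
  rewrite intgZ; last exact: bmcD.
  rewrite intgD// ler_wpM2l ?mulr_ge0 ?(ltW s0)//; exact: lerD.
rewrite intgZ// ler_wpM2l ?mulr_ge0//.
rewrite intgD; [|exact: bmcZ|exact: bmcZ].
rewrite !intgZ//; apply: lerD; rewrite ler_wpM2l ?powR_ge0//.
by rewrite addr_ge0 ?(ltW lam0)//; exact: fluxW_ge0.
Qed.

(** The weight 2^((N+2)(2d-1)) on the bad set is outweighed by the volume 2^(-2dN), with a
    factor 2^-N to spare. *)
Lemma upper_arith N lam : 0 <= lam ->
  (fluxW (R := R) (d := d) k N + lam) * (2 * (2 ^- N) ^+ (2 * d)) <=
  2 * (4 ^+ (2 * d).-1 * ((2 * d)%:R * (4 + k)) + lam) * 2 ^- N.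
Proof.
move=> l0; have y0 : 0 < 2 ^- N :> R by rewrite invr_gt0 exprn_gt0.
have y1 : 2 ^- N <= 1 :> R by rewrite invf_le1 ?exprn_gt0// exprn_ege1// ler1n.
have dE : (2 * d)%N = (2 * d).-1.+1 by rewrite prednK// muln_gt0.
have hW : fluxW (R := R) (d := d) k N * (2 ^- N) ^+ (2 * d) =
   4 ^+ (2 * d).-1 * ((2 * d)%:R * (4 + k)) * 2 ^- N.
  rewrite /fluxW; set c := (2 * d)%:R * (4 + k).
  have -> : (2 ^- N.+2)^-1 = 4 * (2 ^- N)^-1 :> R.
    by rewrite !invrK !exprS mulrA -natrM.
  rewrite {2}dE; move: (2 * d).-1 c y0; move: (2 ^- N) => y n c y0.
  have : y ^+ n != 0 by rewrite expf_neq0// gt_eqF.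
  rewrite exprMn exprVn exprS; move: (y ^+ n) (4 ^+ n) => z f z0; by field.
have hl : lam * (2 ^- N) ^+ (2 * d) <= lam * 2 ^- N.
  rewrite ler_wpM2l// {1}dE exprS ler_piMr ?(ltW y0)// exprn_ile1// ltW.
rewrite mulrCA -mulrA ler_wpM2l// mulrDl hW mulrDl lerD2l.
exact: hl.
Qed.

(** The contribution of the bad set involves the bound [M] and the slope [k], which depend
    on the analytic function; it becomes arbitrarily small with [lam] and then [N] large,
    and only the term with [s] remains. *)
Lemma exists_test_fun eps : 0 < eps -> exists (f : T -> R) (r1 : R),
  [/\ lip f, bsupp (enorm x + 1) f, forall z, 0 <= f z <= 1, 0 < r1 &
    [/\ forall y, enorm (y - x) < r1 -> f y = 1,
    forall z, 2^-1 <= enorm (z - x) -> f z = 0 &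
    forall e, 0 < e -> intg (fun z => a z * (f z * chi x e z)) <=
     2 * s * (1 + fluxC) + eps]].
Proof.
move=> eps0; pose c := eps / 2 / (2 * M * S + 1).
have MS0 : 0 <= 2 * M * S by rewrite !mulr_ge0.
have c0 : 0 < c by rewrite !divr_gt0// ltr_wpDl.
have q10 : 1 - q != 0 by rewrite lt_eqF// subr_lt0.
(* With this choice 2 M lam^(1-q) S is at most eps / 2. *)
pose lam := c `^ (1 - q)^-1.
have lam0 : 0 < lam by exact: powR_gt0.
have lamE : lam `^ (1 - q) = c by rewrite -powRrM mulVf// powRr1// ltW.
pose B := 2 * M * (2 * (4 ^+ (2 * d).-1 * ((2 * d)%:R * (4 + k)) + lam)).
have B0 : 0 <= B.
  by rewrite !(mulr_ge0, addr_ge0) ?exprn_ge0 ?(ltW k0) ?(ltW lam0).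
have m0 : 0 < Num.min r0 (eps / 2 / (B + 1)).
  by rewrite lt_min r00 !divr_gt0// ltr_wpDl.
have [N hN] := pow_small m0.
move: hN; rewrite le_min => /andP[hN1 hN2].
have hN : 2 ^- N.+2 <= r0.
  apply: le_trans hN1; rewrite lef_pV2 ?posrE ?exprn_gt0// ler_eXn2l ?ltr1n//.
  by rewrite (leq_trans (leqnSn _)).
have [f [f1 f2 f3 f4 f5]] := flux_intg lam0 hN.
have y0 : 0 < 2 ^- N.+2 :> R by rewrite invr_gt0 exprn_gt0.
exists f, (2 ^- N.+2); split => //; split.
- by move=> y /f4 [].
- by have [|_] := f4 x; rewrite ?subrr ?enorm0.
move=> e e0; apply: le_trans (f5 e e0) _; rewrite lerD2l lamE.
have h1 : 2 * M * ((fluxW (R := R) (d := d) k N + lam) * (2 * (2 ^- N) ^+ (2 * d))) <= eps / 2.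
  apply: le_trans (ler_wpM2l _ (upper_arith N (ltW lam0))) _; first by rewrite mulr_ge0.
  apply: (le_trans (y := B * 2 ^- N)); first by rewrite /B -!mulrA.
  apply: le_trans (ler_wpM2l B0 hN2) _.
  rewrite mulrCA ler_piMr ?divr_ge0 ?(ltW eps0)// ler_pdivrMr ?ltr_wpDl// mul1r.
  by rewrite lerDl.
have h2 : 2 * M * (c * S) <= eps / 2.
  have -> : 2 * M * (c * S) = eps / 2 * (2 * M * S / (2 * M * S + 1)).
    by rewrite /c; field; rewrite gt_eqF// ltr_wpDl.
  rewrite ler_piMr ?divr_ge0 ?(ltW eps0)// ler_pdivrMr ?ltr_wpDl// mul1r.
  by rewrite lerDl.
by rewrite mulrDr (le_trans (lerD h1 h2))// -splitr.
Qed.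

End upper.

(** * Mass of the kernel near the pole *)

Section lower.
Context {R : realType} {d : nat}.
Notation T := 'rV[C R]_d.
Implicit Types (x z : T) (a f : T -> R).

(** The value of d (2 e^2)^(-d), a lower bound of [chi] on the cube of half-side e/(2d), times
    the volume (e/d)^(2d) of that cube. *)
Definition massC : R := d%:R * (2 * d%:R ^+ 2) ^- d.

Lemma massC_gt0 : (0 < d)%N -> 0 < massC.
Proof.
by move=> d1; rewrite /massC mulr_gt0 ?ltr0n// invr_gt0 exprn_gt0// mulr_gt0// exprn_gt0// ltr0n.
Qed.

Lemma chi_ge x (e : R) z : (0 < d)%N -> 0 < e -> enorm (z - x) <= e ->
  d%:R * (2 * e ^+ 2) ^- d <= chi x e z.
Proof.
move=> d1 e0 h; have s0 := reg_sqdist_gt0 x e0 z; have e2 : 0 < e ^+ 2 by rewrite exprn_gt0.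
have hS : reg_sqdist x e z <= 2 * e ^+ 2.
  rewrite reg_sqdistE mulrDl mul1r lerD2r lerXn2r ?nnegrE ?enorm_ge0//; exact: ltW.
rewrite /chi /reg_kernel.
have -> : 2 * d%:R * e ^+ 2 * (reg_sqdist x e z ^+ d)^-1 / reg_sqdist x e z =
   d%:R * (reg_sqdist x e z ^+ d)^-1 * (2 * e ^+ 2 / reg_sqdist x e z) by ring.
have e22 : 0 <= 2 * e ^+ 2 by rewrite mulr_ge0// ltW.
have g0 : 0 <= d%:R * (reg_sqdist x e z ^+ d)^-1 by rewrite mulr_ge0// invr_ge0 exprn_ge0// ltW.
rewrite (le_trans (y := d%:R * (reg_sqdist x e z ^+ d)^-1))//.
  rewrite ler_wpM2l// lef_pV2 ?posrE ?exprn_gt0 ?mulr_gt0//.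
  by rewrite lerXn2r ?nnegrE ?(ltW s0).
by rewrite ler_peMr// ler_pdivlMr// mul1r.
Qed.

Lemma chi_ge0 x e z : 0 < e -> 0 <= chi x e z.
Proof.
move=> e0; have s0 := reg_sqdist_gt0 x e0 z; have g0 := reg_kernel_gt0 x e0 z.
by rewrite /chi divr_ge0 ?(ltW s0)// !mulr_ge0 ?(ltW g0)// ltW.
Qed.

Lemma chi_le x (e r : R) z : 0 < e -> 0 < r -> r <= enorm (z - x) ->
  chi x e z <= 2 * d%:R * (r ^+ 2) ^- d.+1 * e ^+ 2.
Proof.
move=> e0 r0 h; have s0 := reg_sqdist_gt0 x e0 z; have e2 : 0 < e ^+ 2 by rewrite exprn_gt0.
have r2 : 0 < r ^+ 2 by rewrite exprn_gt0.
have hS : r ^+ 2 <= reg_sqdist x e z.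
  rewrite reg_sqdistE (le_trans (y := enorm (z - x) ^+ 2)) ?lerDl ?(ltW e2)//.
  by rewrite lerXn2r ?nnegrE ?enorm_ge0// ltW.
rewrite /chi /reg_kernel.
have -> : 2 * d%:R * e ^+ 2 * (reg_sqdist x e z ^+ d)^-1 / reg_sqdist x e z =
   2 * d%:R * (reg_sqdist x e z ^+ d.+1)^-1 * e ^+ 2 by rewrite (exprS (reg_sqdist x e z)) invfM; ring.
rewrite ler_wpM2r ?(ltW e2)// ler_wpM2l ?mulr_ge0//.
rewrite lef_pV2 ?posrE ?exprn_gt0//.
by rewrite lerXn2r ?nnegrE ?(ltW s0) ?(ltW r2).
Qed.

(** Near the pole the integrand is at least half of [a x] times [chi], whose mass does not
    depend on [e]; away from the pole [chi] is of order [e ^+ 2]. *)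
Lemma mass_lower x a f M Ms r1 eps : (0 < d)%N -> locb a -> (forall z, `|a z| <= M) ->
  (forall e, 0 < e -> exists2 r, 0 < r & forall y, enorm (y - x) < r -> `|a y - a x| < e) ->
  lip f -> bsupp Ms f -> (forall z, 0 <= f z <= 1) -> 0 < r1 ->
  (forall y, enorm (y - x) < r1 -> f y = 1) ->
  (forall z, 2^-1 <= enorm (z - x) -> f z = 0) -> 0 < a x -> 0 < eps ->
  exists2 e, 0 < e & a x / 2 * massC <= intg (fun z => a z * (f z * chi x e z)) + eps.
Proof.
move=> d1 la aM ca lf bf f01 r10 f1 f0 ax eps0.
have ax2 : 0 < a x / 2 by rewrite divr_gt0.
have [r3 r30 hr3] := ca _ ax2.
pose r := Num.min r1 r3; have r0 : 0 < r by rewrite lt_min r10.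
have M0 : 0 <= M by exact: le_trans (normr_ge0 _) (aM x).
pose D := 2 * d%:R * (r ^+ 2) ^- d.+1.
have D0 : 0 <= D by rewrite !mulr_ge0// invr_ge0 !exprn_ge0// ltW.
have MD0 : 0 <= M * D * 2 ^+ (2 * d) by rewrite mulr_ge0 ?exprn_ge0 ?(mulr_ge0 M0 D0).
pose e := Num.min (r / 2) (Num.min 1 (eps / (M * D * 2 ^+ (2 * d) + 1))).
have e0 : 0 < e by rewrite !lt_min !divr_gt0//= ?ltr01// ltr_wpDl.
have er : e < r.
  by rewrite (le_lt_trans (y := r / 2)) ?ge_min ?lexx// ltr_pdivrMr// ltr_pMr// ltr1n.
have e1 : e <= 1 by rewrite !ge_min lexx orbT.
have e2 : e <= eps / (M * D * 2 ^+ (2 * d) + 1) by rewrite !ge_min lexx !orbT.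
exists e => //.
have [d2 de0] : 0 < (2 * d)%:R :> R /\ 0 <= e / (2 * d)%:R.
  by rewrite ltr0n muln_gt0 d1 divr_ge0// ltW.
pose c1 := a x / 2 * (d%:R * (2 * e ^+ 2) ^- d).
have c10 : 0 <= c1.
  by rewrite mulr_ge0 ?(ltW ax2)// mulr_ge0// invr_ge0 exprn_ge0// mulr_ge0// sqr_ge0.
have bL : bmc (fun z => c1 * \1_(cube d (e / (2 * d)%:R) : set T) (z - x)) by exact: bmc_indic_cube.
have bU : bmc (fun z => M * D * e ^+ 2 * \1_(cube d 1 : set T) (z - x)) by exact: bmc_indic_cube.
have := le_intg (bmcB bL bU) (bmc_lhs x e0 la lf bf) _.
rewrite intgB// !intg_indic_cube// => h.
have {h}h : c1 * (2 * (e / (2 * d)%:R)) ^+ (2 * d) - M * D * e ^+ 2 * (2 * 1) ^+ (2 * d) <=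
    intg (fun z => a z * (f z * chi x e z)).
  apply: h => z.
  have ch0 := chi_ge0 x z e0.
  have /andP[fz0 fz1] := f01 z.
  have IU : 0 <= M * D * e ^+ 2 * \1_(cube d 1 : set T) (z - x).
    apply: mulr_ge0; last by rewrite indicE; case: (_ \in _).
    by apply: mulr_ge0; [exact: mulr_ge0|exact: sqr_ge0].
  have [hr|hr] := ltP (enorm (z - x)) r.
    have zr1 : enorm (z - x) < r1 by rewrite (lt_le_trans hr)// ge_min lexx.
    have zr3 : enorm (z - x) < r3 by rewrite (lt_le_trans hr)// ge_min lexx orbT.
    have az : a x / 2 <= a z.
      have := hr3 _ zr3; rewrite ltr_distl => /andP[+ _] => /ltW; apply: le_trans.
      by rewrite {2}(splitr (a x)) addrK.
    rewrite f1// mul1r lerBlDr ler_wpDr//.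
    apply: (le_trans (y := a x / 2 * chi x e z)); last by rewrite ler_wpM2r.
    rewrite /c1 -mulrA ler_wpM2l ?(ltW ax2)// indicE.
    have [hc|hc] := pselect ((cube d (e / (2 * d)%:R) : set T) (z - x)); last first.
      by rewrite memNset// mulr0.
    rewrite mem_set// mulr1 chi_ge//.
    by rewrite (le_trans (enorm_le_max hc))// mulrC divfK// gt_eqF.
  rewrite indicE memNset ?mulr0 ?sub0r; last first.
    move=> hc; have := le_lt_trans (enorm_le_max hc); rewrite mulrC divfK ?gt_eqF//.
    by move=> /(_ r er); rewrite ltNge hr.
  have [h2|h2] := leP 2^-1 (enorm (z - x)).
    by rewrite f0// mul0r mulr0 oppr_le0.
  rewrite indicE mem_set; last first.
    move=> i; rewrite (le_trans (co_le_enorm _ _))// (le_trans (ltW h2))//.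
    by rewrite invf_le1// ler1n.
  rewrite mulr1 lerNl (le_trans (ler_norm _))// normrN normrM -mulrA ler_pM//.
  rewrite ger0_norm; last exact: mulr_ge0.
  by apply: le_trans (chi_le e0 r0 hr); rewrite ler_piMl.
have hc : c1 * (2 * (e / (2 * d)%:R)) ^+ (2 * d) = a x / 2 * massC.
  rewrite /c1 /massC -!mulrA; congr (_ * (_ * (_ * _))).
  rewrite natrM !exprM.
  have -> : (2 * (e / (2%:R * d%:R))) ^+ 2 = e ^+ 2 / d%:R ^+ 2 :> R.
    by field; rewrite pnatr_eq0 -lt0n.
  rewrite -!exprVn -exprMn; congr (_ ^+ _).
  by field; rewrite (gt_eqF e0) pnatr_eq0 -lt0n d1.
rewrite hc mulr1 in h.
rewrite -lerBlDr (le_trans _ h)// lerD2l lerN2.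
have E : M * D * e ^+ 2 * 2 ^+ (2 * d) = M * D * 2 ^+ (2 * d) * (e * e) by ring.
rewrite E (le_trans (y := M * D * 2 ^+ (2 * d) * e))//.
  by rewrite ler_wpM2l// ler_piMr// ltW.
rewrite (le_trans (ler_wpM2l MD0 e2))// mulrCA ler_piMr ?(ltW eps0)//.
by rewrite ler_pdivrMr ?ltr_wpDl// mul1r lerDl.
Qed.

End lower.

(** * Bound for the value at the point *)

Section pointvalue.
Context {R : realType} {d : nat}.
Notation T := 'rV[C R]_d.
Implicit Types (x z : T) (a b tau FU : T -> R) (U W : set T).

Lemma lin_approx_cont a al z : lin_approx a al z ->
  forall e, 0 < e -> exists2 r, 0 < r & forall y, enorm (y - z) < r -> `|a y - a z| < e.
Proof.
move=> h e e0; have [r r0 hr] := h 1 ltr01.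
pose L := \sum_i `|al i| + 1; have L0 : 0 < L by rewrite ltr_wpDl// sumr_ge0.
exists (Num.min r (e / L)); first by rewrite lt_min r0 divr_gt0.
move=> y; rewrite lt_min => /andP[/hr h1]; rewrite ltr_pdivlMr// mulrC => h2.
apply: le_lt_trans h2; rewrite mulrDl.
have hl : `|lin al (y - z)| <= (\sum_i `|al i|) * enorm (y - z).
  rewrite /lin mulr_suml (le_trans (ler_norm_sum _ _ _))//.
  by apply: ler_sum => i _; rewrite normrM ler_wpM2l// co_le_enorm.
rewrite -[a y - a z](subrK (lin al (y - z))) addrC (le_trans (ler_normD _ _))//.
exact: lerD.
Qed.

(** [FU] stands for the modulus of the analytic function on [U] and 0 elsewhere, and [M] for
    a bound of its extension by 0. *)
Definition admissible U FU M tau a b : Prop :=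
  [/\ locb a /\ locb b, forall z, `|a z| <= M, forall z, `|b z| <= M,
    forall z, U z -> `|a z| <= FU z /\ `|b z| <= FU z &
    forall z, CR a b z \/
      (exists2 r, 0 < r & forall y, enorm (y - z) < r -> tau y = 0)].

Lemma admissible_rot U FU M tau a b :
  admissible U FU M tau a b -> admissible U FU M tau b (fun z => - a z).
Proof.
move=> [[la lb] aM bM F H]; split.
- by split => //; exact: locbN.
- by [].
- by move=> z; rewrite normrN.
- by move=> z /F []; rewrite normrN.
- by move=> z; have [/CR_rot h|h] := H z; [left|right].
Qed.

Section bound.
Variables (x : T) (p q : R) (U : set T).
Hypotheses (d1 : (0 < d)%N) (q1 : 1 < q) (p1 : 1 < p) (pq : (p - 1) * (q - 1) = 1).
Variable S : R.
Hypothesis S0 : 0 <= S.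
Variables (tau FU : T -> R) (M k r0 s : R).
Hypotheses (FU0 : forall z, 0 <= FU z) (bFU : bmc FU).
Hypotheses (s0 : 0 < s) (FUs : intg (fun z => FU z `^ p) <= s `^ p).
Hypotheses (k0 : 0 < k) (ltau : lipk k tau) (tau01 : forall z, 0 <= tau z <= 1).
Hypothesis tauU : forall z, U z -> exists2 r, 0 < r & forall y, enorm (y - z) < r -> tau y = 1.
Hypotheses (r00 : 0 < r0) (taux : forall y, enorm (y - x) < r0 -> tau y = 1).
Hypothesis Hbar : forall de rho N, 0 < de -> 0 < rho ->
  exists v : T -> R, [/\ lip v, forall z, 0 <= v z <= 1,
    forall z, enorm (z - x) <= 2 ^- N.+2 \/ 1 <= enorm (z - x) -> v z = 0,
    forall n z, (0 < n <= N)%N -> dyadic_core U x n de z -> v z = 1 &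
    intg (fun z => (pole_weight x rho z * gradient_norm v z) `^ q) <= S].

Definition pointC : R := 4 * (1 + fluxC (d := d) q S) / massC (R := R) (d := d).

Lemma pointC_ge0 : 0 <= pointC.
Proof.
rewrite divr_ge0 ?(ltW (massC_gt0 _ d1))// mulr_ge0// addr_ge0//.
by rewrite mulr_ge0 ?powR_ge0// addr_ge0// mulr_ge0 ?powR_ge0 ?exprn_ge0.
Qed.

Lemma point_le a b : admissible U FU M tau a b -> a x <= pointC * s.
Proof.
move=> [[la lb] aM bM F H]; have m0 := @massC_gt0 R d d1.
have [ax|ax] := leP (a x) 0.
  by rewrite (le_trans ax)// mulr_ge0 ?pointC_ge0// ltW.
have ca : forall e, 0 < e -> exists2 r, 0 < r & forall y, enorm (y - x) < r -> `|a y - a x| < e.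
  have [[al [be [h _ _ _]]]|[r rr0 hr]] := H x; first exact: lin_approx_cont h.
  have := hr x; rewrite subrr enorm0 => /(_ rr0) t0.
  have := taux (y := x); rewrite subrr enorm0 => /(_ r00); rewrite t0 => /eqP.
  by rewrite eq_sym oner_eq0.
have aF z (Uz : U z) := (F z Uz).1; have bF z (Uz : U z) := (F z Uz).2.
suff h : a x / 2 * massC (R := R) (d := d) <= 2 * s * (1 + fluxC (d := d) q S).
  rewrite /pointC mulrAC ler_pdivlMr//.
  have -> : a x * massC (R := R) (d := d) = 2 * (a x / 2 * massC (R := R) (d := d)) by field.
  have -> : 4 * (1 + fluxC (d := d) q S) * s = 2 * (2 * s * (1 + fluxC (d := d) q S)) by ring.
  by rewrite ler_wpM2l.
apply/ler_addgt0Pr => eps eps0; have eps2 : 0 < eps / 2 by rewrite divr_gt0.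
have [f [r1 [lf bf f01 r10 [f1 f0 up]]]] := exists_test_fun d1 q1 p1 pq S0 la lb aM bM aF bF
  FU0 bFU s0 FUs k0 ltau tau01 tauU r00 taux H Hbar eps2.
have [e e0 lo] := mass_lower d1 la aM ca lf bf f01 r10 f1 f0 ax eps2.
apply: le_trans lo _; rewrite [X in _ <= _ + X](splitr eps) addrA lerD2r.
exact: up.
Qed.

(** The one-sided bound [point_le] applies to the four pairs obtained by rotation, whose
    first components are [a], [b], [- a] and [- b]. *)
Lemma point_norm_le a b : admissible U FU M tau a b -> `|a x| <= pointC * s /\ `|b x| <= pointC * s.
Proof.
move=> h; have h1 := point_le h.
have hb := admissible_rot h; have h2 := point_le hb.
have hc := admissible_rot hb; have h3 := point_le hc.
have hd := admissible_rot hc; have h4 := point_le hd.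
by split; rewrite ler_norml lerNl; apply/andP.
Qed.

End bound.

Definition dist U z : R := inf [set enorm (z - w) | w in U].

Section dist.
Variable U : set T.
Hypothesis U0 : U !=set0.

Let hinf z : has_inf [set enorm (z - w) | w in U].
Proof.
case: U0 => w Uw; split; first by exists (enorm (z - w)); exists w.
by exists 0 => _ [y _ <-]; exact: enorm_ge0.
Qed.

Lemma dist_le z w : U w -> dist U z <= enorm (z - w).
Proof. by move=> Uw; apply: ge_inf; [exact: (hinf z).2|exists w]. Qed.

Lemma dist_ge z r : (forall w, U w -> r <= enorm (z - w)) -> r <= dist U z.
Proof.
move=> h; apply: lb_le_inf; first exact: (hinf z).1.
by move=> _ [w Uw <-]; exact: h.
Qed.

Lemma dist_leD y z : dist U y <= enorm (y - z) + dist U z.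
Proof.
rewrite -lerBlDl; apply: dist_ge => w Uw; rewrite lerBlDl.
exact: le_trans (dist_le y Uw) (ler_enormB3 y w z).
Qed.

Lemma dist_lip y z : `|dist U y - dist U z| <= enorm (y - z).
Proof.
rewrite ler_norml; apply/andP; split; last by rewrite lerBlDr; exact: dist_leD.
by rewrite lerNl opprB lerBlDr enormBC; exact: dist_leD.
Qed.

Lemma dist_closure z r : closure U z -> 0 < r -> dist U z <= r.
Proof.
move=> /closure_enorm h r0; have [w Uw hw] := h r r0.
by rewrite (le_trans (dist_le z Uw))// enormBC ltW.
Qed.

Variable eta : R.
Hypothesis eta0 : 0 < eta.

(** The constants 3 and 4 give the value 1 up to distance [eta / 2] of [U] and 0 from
    distance [3 * eta / 4] on, with a margin at both ends. *)
Definition collar z : R := clamp (3 - 4 / eta * dist U z).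

Lemma collar_lip : lipk (4 / eta) collar.
Proof.
move=> y z; have e4 : 0 <= 4 / eta by rewrite divr_ge0// ltW.
apply: le_trans (clamp_lip _ _) _.
have -> : 3 - 4 / eta * dist U y - (3 - 4 / eta * dist U z) = 4 / eta * (dist U z - dist U y) by ring.
by rewrite normrM ger0_norm// ler_wpM2l// enormBC dist_lip.
Qed.

Lemma collar1 z w : closure U w -> enorm (z - w) < eta / 4 -> collar z = 1.
Proof.
move=> Uw h; apply: clamp_ge1.
have e4 : 0 < eta / 4 by rewrite divr_gt0.
have hd : dist U z <= eta / 2.
  have hw := dist_closure Uw e4; have hz := dist_leD z w.
  rewrite (le_trans hz)// (le_trans (lerD (ltW h) hw))// -mulrDr.
  by rewrite ler_wpM2l ?(ltW eta0)// (_ : 4^-1 + 4^-1 = 2^-1 :> R)//; field.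
have : 4 / eta * dist U z <= 4 / eta * (eta / 2) by rewrite ler_wpM2l// divr_ge0// ltW.
have -> : 4 / eta * (eta / 2) = 2 by field; rewrite gt_eqF.
by move: (_ * _) => t; lra.
Qed.

Lemma collar0 z : (forall w, U w -> eta <= enorm (z - w)) ->
  forall y, enorm (y - z) < eta / 4 -> collar y = 0.
Proof.
move=> h y hy; apply: clamp_le0.
have hd : eta * (3 / 4) <= dist U y.
  have h1 := dist_ge h; have h2 := dist_leD z y; rewrite (enormBC z y) in h2.
  have : eta <= enorm (y - z) + dist U y by exact: le_trans h2.
  by move: (enorm _) hy (dist U y) => t ht u hu; lra.
have : 4 / eta * (eta * (3 / 4)) <= 4 / eta * dist U y by rewrite ler_wpM2l// divr_ge0// ltW.
have -> : 4 / eta * (eta * (3 / 4)) = 3 by field; rewrite gt_eqF.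
by move: (_ * dist U y) => t; lra.
Qed.

End dist.

(** The part of a superlevel set inside [W] is open, and outside [W] the function is 0. *)
Lemma measurable_cut W (g : T -> R) : eopen W ->
  (forall z, W z -> forall e, 0 < e ->
     exists2 r, 0 < r & forall y, enorm (y - z) < r -> `|g y - g z| < e) ->
  measurable_fun [set: T] ((fun z => \1_W z * g z) : T -> measurableTypeR R).
Proof.
move=> oW cg; apply: (measurability _ (RGenOInfty.measurableE R)) => //.
move=> _ [_ [c ->] <-]; rewrite setTI.
have oA : eopen [set z | W z /\ c < g z].
  move=> z [Wz cz]; have [r r0 hr] := oW z Wz.
  have gc0 : 0 < g z - c by rewrite subr_gt0.
  have [s s0 hs] := cg z Wz _ gc0.
  exists (Num.min r s); first by rewrite lt_min r0.
  move=> y; rewrite lt_min => /andP[/hr Wy /hs]; rewrite ltr_distl => /andP[+ _].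
  by rewrite opprB addrC subrK.
have mW := eopen_measurable oW.
have -> : (fun z => \1_W z * g z) @^-1` `]c, +oo[%classic =
    [set z | W z /\ c < g z] `|` (~` W `&` [set _ | c < 0]).
  apply/seteqP; split => z /=; rewrite in_itv/= andbT.
    have [Wz|nW] := pselect (W z); first by rewrite indicE mem_set// mul1r; left.
    by rewrite indicE memNset// mul0r; right.
  by case=> [[Wz h]|[nW h]]; [rewrite indicE mem_set// mul1r|rewrite indicE memNset// mul0r].
apply: measurableU; first exact: eopen_measurable.
apply: measurableI; first exact: measurableC.
have [h|h] := ltP c 0; first by rewrite (_ : [set _ | _] = setT)//; apply/seteqP.
by rewrite (_ : [set _ | _] = set0)//; apply/seteqP; split.
Qed.

End pointvalue.

(** * Analytic functions near the closure of a bounded set *)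

Section final.
Context {R : realType} {d : nat}.
Notation T := 'rV[C R]_d.
Implicit Types (x z : T) (U V : set T) (f : T -> C R).

Lemma sqr_absr (t : R) : `|t| ^+ 2 = t ^+ 2.
Proof. exact: real_normK (num_real t). Qed.

Lemma Re_le_cabs (c : C R) : `|complex.Re c| <= cabs c.
Proof.
rewrite -(ger0_norm (cabs_ge0 c)) -ler_sqr ?nnegrE// !sqr_absr cabs2 lerDl.
exact: sqr_ge0.
Qed.

Lemma Im_le_cabs (c : C R) : `|complex.Im c| <= cabs c.
Proof.
rewrite -(ger0_norm (cabs_ge0 c)) -ler_sqr ?nnegrE// !sqr_absr cabs2 lerDr.
exact: sqr_ge0.
Qed.

Lemma cabs_le_sum (c : C R) : cabs c <= `|complex.Re c| + `|complex.Im c|.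
Proof.
rewrite -(ger0_norm (cabs_ge0 c)) -[leRHS]ger0_norm ?addr_ge0//.
rewrite -ler_sqr ?nnegrE// !sqr_absr cabs2 sqrrD !sqr_absr.
by rewrite addrAC lerDl mulrn_wge0// mulr_ge0.
Qed.

Lemma differentiable_cont f z : differentiable f z -> forall e, 0 < e ->
  exists2 r, 0 < r & forall y, enorm (y - z) < r ->
    `|complex.Re (f y) - complex.Re (f z)| < e /\ `|complex.Im (f y) - complex.Im (f z)| < e.
Proof.
move=> /differentiable_lin [al [be [ha hb _ _]]] e e0.
have [r r0 hr] := lin_approx_cont ha e0; have [s s0 hs] := lin_approx_cont hb e0.
exists (Num.min r s); first by rewrite lt_min r0.
by move=> y; rewrite lt_min => /andP[/hr ? /hs ?].
Qed.

(** Compactness of the closure gives one radius that serves both as a distance to the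
    boundary of the domain of analyticity and, by its inverse, as a bound of the function. *)
Lemma uniform_analytic U V f : open V -> closure U `<=` V -> bounded_set U ->
  (forall z, V z -> differentiable f z) ->
  exists2 eta, 0 < eta & forall z w, closure U z -> enorm (w - z) < eta ->
    V w /\ cabs (f w) <= eta^-1.
Proof.
move=> oV UV /bounded_set_enorm [B UB] df.
pose P e z := 0 < e -> forall w, enorm (w - z) < e -> V w /\ cabs (f w) <= e^-1.
have [||e e0 h] := @uniform_nbhd _ _ (closure U) P (compact_closure_bounded UB).
- move=> e e' z ee h e'0 w hw; have e0 := lt_le_trans e'0 ee.
  have [Vw fw] := h e0 w (lt_le_trans hw ee); split => //.
  by rewrite (le_trans fw)// lef_pV2 ?posrE.
- move=> z /UV Vz.
  have [r r0 hr] := open_eopen oV Vz.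
  have [s s0 hs] := differentiable_cont (df z Vz) ltr01.
  pose K := `|complex.Re (f z)| + 1 + (`|complex.Im (f z)| + 1).
  have K0 : 0 < K by apply: addr_gt0; rewrite ltr_wpDl.
  pose e := Num.min K^-1 (Num.min (r / 2) (s / 2)).
  have e0 : 0 < e by rewrite !lt_min invr_gt0 K0 !divr_gt0.
  exists e => // w hw _ y hy.
  have hyz : enorm (y - z) < e + e.
    by rewrite (le_lt_trans (ler_enormB3 y z w))// ltrD.
  have er : e + e <= r.
    by rewrite [leRHS](splitr r) lerD// /e !ge_min lexx !orbT.
  have es : e + e <= s.
    by rewrite [leRHS](splitr s) lerD// /e !ge_min lexx !orbT.
  split; first by apply: hr; exact: lt_le_trans er.
  have [h1 h2] := hs y (lt_le_trans hyz es).
  have hK : cabs (f y) <= K.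
    rewrite (le_trans (cabs_le_sum _))// lerD//.
      rewrite -[complex.Re (f y)](subrK (complex.Re (f z))) addrC (le_trans (ler_normD _ _))// lerD2l.
      exact: ltW.
    rewrite -[complex.Im (f y)](subrK (complex.Im (f z))) addrC (le_trans (ler_normD _ _))// lerD2l.
    exact: ltW.
  by rewrite (le_trans hK)// -[leLHS]invrK lef_pV2 ?posrE ?invr_gt0// /e ge_min lexx.
exists e; [exact: e0|move=> z w Uz; exact: (h z Uz e0 w)].
Qed.

Lemma lin_approx_near (a a' : T -> R) al z (r : R) : 0 < r ->
  (forall y, enorm (y - z) < r -> a' y = a y) -> lin_approx a al z -> lin_approx a' al z.
Proof.
move=> r0 h ha e e0; have [s s0 hs] := ha e e0.
exists (Num.min r s); first by rewrite lt_min r0.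
move=> y; rewrite lt_min => /andP[/h -> /hs]; rewrite (h z) ?subrr ?enorm0//.
Qed.

Section data.
Variables (U V : set T) (f : T -> C R) (eta : R).
Hypotheses (oU : open U) (bU : bounded_set U) (U0 : U !=set0).
Hypothesis df : forall z, V z -> differentiable f z.
Hypotheses (eta0 : 0 < eta) (hV : forall z w, closure U z -> enorm (w - z) < eta ->
    V w /\ cabs (f w) <= eta^-1).

(** The analytic function is extended by 0 outside this neighbourhood of [U], which
    contains the support of [collar]. *)
Definition nbd : set T := [set z | exists2 w, U w & enorm (z - w) < eta].

Lemma eopen_nbd : eopen nbd.
Proof.
move=> z [w Uw h]; exists (eta - enorm (z - w)); first by rewrite subr_gt0.
by move=> y /tri_lt hy; exists w.
Qed.

Lemma nbdV z : nbd z -> V z /\ cabs (f z) <= eta^-1.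
Proof. by case=> w Uw; apply: hV; exact: subset_closure. Qed.

Lemma sub_nbd : U `<=` nbd.
Proof. by move=> z Uz; exists z => //; rewrite subrr enorm0. Qed.

Definition extRe z : R := \1_nbd z * complex.Re (f z).
Definition extIm z : R := \1_nbd z * complex.Im (f z).

Lemma ext_in z : nbd z -> extRe z = complex.Re (f z) /\ extIm z = complex.Im (f z).
Proof. by move=> h; rewrite /extRe /extIm indicE mem_set// !mul1r. Qed.

Lemma ext_out z : ~ nbd z -> extRe z = 0 /\ extIm z = 0.
Proof. by move=> h; rewrite /extRe /extIm indicE memNset// !mul0r. Qed.

Lemma ext_bound z : `|extRe z| <= eta^-1 /\ `|extIm z| <= eta^-1.
Proof.
have [h|h] := pselect (nbd z).
  have [-> ->] := ext_in h; have [_ hc] := nbdV h.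
  by split; apply: le_trans hc; [exact: Re_le_cabs|exact: Im_le_cabs].
by have [-> ->] := ext_out h; rewrite normr0 invr_ge0 ltW.
Qed.

Lemma ext_locb : locb extRe /\ locb extIm.
Proof.
split; split; try by move=> r; exists eta^-1 => z _; have [] := ext_bound z.
  apply: measurable_cut; first exact: eopen_nbd.
  move=> z /nbdV[Vz _] e e0; have [r r0 h] := differentiable_cont (df Vz) e0.
  by exists r => // y /h [].
apply: measurable_cut; first exact: eopen_nbd.
move=> z /nbdV[Vz _] e e0; have [r r0 h] := differentiable_cont (df Vz) e0.
by exists r => // y /h [].
Qed.

Lemma ext_CR z : CR extRe extIm z \/
  (exists2 r, 0 < r & forall y, enorm (y - z) < r -> collar U eta y = 0).
Proof.
have [h|h] := pselect (nbd z).
  left; have [Vz _] := nbdV h; have [r r0 hr] := eopen_nbd h.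
  have [al [be [ha hb h1 h2]]] := differentiable_lin (df Vz).
  exists al, be; split => //.
    by apply: (lin_approx_near r0 _ ha) => y /hr /ext_in [].
  by apply: (lin_approx_near r0 _ hb) => y /hr /ext_in [].
right; exists (eta / 4); first by rewrite divr_gt0.
apply: collar0 => // w Uw; rewrite leNgt; apply/negP => hw; apply: h.
by exists w.
Qed.

Lemma ext_meas : measurable_fun [set: T]
  ((fun z => \1_U z * Num.sqrt (extRe z ^+ 2 + extIm z ^+ 2)) : T -> measurableTypeR R).
Proof.
have [[ma _] [mb _]] := ext_locb.
apply: measurable_funM.
  by apply: measurable_indic; apply: eopen_measurable; exact: open_eopen.
have ms : measurable_fun [set: T] ((fun z => extRe z ^+ 2 + extIm z ^+ 2) : T -> measurableTypeR R).
  by apply: measurable_funD; exact: measurable_funX.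
exact: (measurableT_comp (continuous_measurable_fun (@sqrt_continuous R)) ms).
Qed.

Lemma cabs_restrict z :
  ((fun y => cabs (f y)) \_ U) z = \1_U z * Num.sqrt (extRe z ^+ 2 + extIm z ^+ 2).
Proof.
rewrite patchE indicE; case: ifPn => [/set_mem h|h]; last by rewrite mul0r.
have [-> ->] := ext_in (sub_nbd h).
by rewrite -cabs2 sqrtr_sqr mul1r ger0_norm// cabs_ge0.
Qed.

Notation FU := ((fun y => cabs (f y)) \_ U).

Lemma cabs_restrict_ge0 z : 0 <= FU z.
Proof. by rewrite cabs_restrict mulr_ge0 ?sqrtr_ge0// indicE. Qed.

Lemma cabs_restrict_bmc : bmc (FU : T -> R).
Proof.
split.
  rewrite (_ : FU = (fun z => \1_U z * Num.sqrt (extRe z ^+ 2 + extIm z ^+ 2))); last first.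
    by apply/funext => z; exact: cabs_restrict.
  exact: ext_meas.
have [B hB] := bounded_set_enorm bU.
exists (Num.max eta^-1 B) => z; rewrite patchE; case: ifPn => [/set_mem h|h].
  split.
    by rewrite ger0_norm ?cabs_ge0// le_max (nbdV (sub_nbd h)).2.
  by rewrite gt_max => /andP[_]; rewrite ltNge hB.
by rewrite normr0 le_max invr_ge0 (ltW eta0).
Qed.

Lemma data_admissible : admissible U FU eta^-1 (collar U eta) extRe extIm.
Proof.
split; [exact: ext_locb|by move=> z; have [] := ext_bound z|by move=> z; have [] := ext_bound z| |exact: ext_CR].
move=> z Uz; have [-> ->] := ext_in (sub_nbd Uz); rewrite patchE mem_set//.
by split; [exact: Re_le_cabs|exact: Im_le_cabs].
Qed.

Lemma Lp_normE p : 0 < p -> Lp_norm U p f = ((intg (fun z => FU z `^ p)) `^ p^-1)%:E.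
Proof.
move=> p0; rewrite /Lp_norm unlock /Lnorm.
have b : bmc (fun z => FU z `^ p).
  by apply: bmc_powR => //; [exact: cabs_restrict_ge0|exact: cabs_restrict_bmc].
rewrite -poweR_EFin; congr (_ `^ _)%E; rewrite -(intgE b).
apply: eq_integral => z _; rewrite /comp abse_EFin ger0_norm ?poweR_EFin//.
exact: cabs_restrict_ge0.
Qed.

End data.

End final.

(** * Bounded point evaluations *)

(** The condition on [p] says exactly that the conjugate exponent is less than 2d. *)
Lemma exponents (R : realType) (d : nat) (p q : R) : (1 <= d)%N ->
  2 * d%:R / (2 * d%:R - 1) < p -> q = p / (p - 1) ->
  [/\ 1 < p, 1 < q, q < (2 * d)%:R & (p - 1) * (q - 1) = 1].
Proof.
move=> d1 hp qE; have D1 : 1 <= d%:R :> R by rewrite ler1n.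
move: hp; rewrite natrM; move: (d%:R : R) D1 => D D1 hp.
have E0 : 0 < 2 * D - 1 by lra.
have {}hp : 2 * D < p * (2 * D - 1) by rewrite -ltr_pdivrMr.
have p1 : 1 < p.
  rewrite ltNge; apply/negP => p1; have : p * (2 * D - 1) <= 1 * (2 * D - 1) by rewrite ler_wpM2r// ltW.
  by lra.
have p0 : 0 < p - 1 by lra.
have q1 : q - 1 = (p - 1)^-1 by rewrite qE; field; rewrite gt_eqF.
split => //.
- by rewrite -subr_gt0 q1 invr_gt0.
- by rewrite qE ltr_pdivrMr//; lra.
- by rewrite q1 mulfV// gt_eqF.
Qed.

Theorem theorem2 (R : realType) (d : nat) (U : set 'rV[C R]_d)
    (x : 'rV[C R]_d) (p q : R) :
  (1 <= d)%N -> bounded_domain U -> closure U x ->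
  2 * d%:R / (2 * d%:R - 1) < p -> q = p / (p - 1) ->
  (\sum_(1 <= n <oo)
     (2 `^ (n%:R * (2 * d%:R - 1) * q))%:E * capacity q (annulus x n `\` U)
   < +oo)%E ->
  bounded_point_evaluation U p x.
Proof.
move=> d1 [U0 oU _ bU] Ux hp qE hsum.
have [p1 q1 q2d pq] := exponents d1 hp qE; have p0 : 0 < p by exact: lt_trans p1.
have [S S0 Hbar] := barrier d1 q1 q2d oU hsum.
have C0 := @pointC_ge0 R d q S S0.
exists (2 * pointC (d := d) q S + 1); first by rewrite ltr_wpDl// mulr_ge0.
move=> f [V [oV UV df]].
have [eta eta0 hV] := uniform_analytic oV UV bU df.
have eta4 : 0 < eta / 4 by rewrite divr_gt0.
have k0 : 0 < 4 / eta by rewrite divr_gt0.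
pose FU : 'rV[C R]_d -> R := (fun y => cabs (f y)) \_ U.
have bFU : bmc FU by exact: (cabs_restrict_bmc oU bU df eta0 hV).
have FU0 z : 0 <= FU z by exact: (cabs_restrict_ge0 U f eta0 z).
pose I := intg (fun z => FU z `^ p).
have I0 : 0 <= I by apply: intg_ge0 => z; exact: powR_ge0.
rewrite (Lp_normE oU bU df eta0 hV p0) -EFinM lee_fin -/FU -/I.
apply/ler_addgt0Pr => e e0.
have c1 : 0 < 2 * pointC (d := d) q S + 1 by rewrite ltr_wpDl// mulr_ge0.
pose s := I `^ p^-1 + e / (2 * pointC (d := d) q S + 1).
have s0 : 0 < s by rewrite ltr_wpDl ?powR_ge0// divr_gt0.
have Is : I <= s `^ p.
  have -> : I = (I `^ p^-1) `^ p by rewrite -powRrM mulVf ?gt_eqF// powRr1.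
  rewrite ge0_ler_powR ?nnegrE ?powR_ge0 ?(ltW p0) ?(ltW s0)//.
  by rewrite lerDl divr_ge0 ?(ltW e0) ?(ltW c1).
have tU z : U z -> exists2 r, 0 < r & forall y, enorm (y - z) < r -> collar U eta y = 1.
  by move=> Uz; exists (eta / 4) => // y; apply: (collar1 U0 eta0); exact: subset_closure.
have tx y : enorm (y - x) < eta / 4 -> collar U eta y = 1 by exact: (collar1 U0 eta0).
have adm := data_admissible U0 df eta0 hV.
have [ha hb] := point_norm_le d1 q1 p1 pq S0 FU0 bFU s0 Is k0 (collar_lip U0 eta0)
  (fun z => clamp01 _) tU eta4 tx Hbar adm.
have nx : nbd U eta x.
  by have [w Uw hw] := closure_enorm Ux eta0; exists w; rewrite // enormBC.
have [Ea Eb] := ext_in f nx; rewrite Ea in ha; rewrite Eb in hb.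
apply: le_trans (cabs_le_sum _) _; apply: le_trans (lerD ha hb) _.
have -> : (2 * pointC (d := d) q S + 1) * I `^ p^-1 + e = (2 * pointC (d := d) q S + 1) * s.
  by rewrite /s mulrDr [X in _ = _ + X]mulrC divfK ?gt_eqF//.
rewrite -mulrDl ler_wpM2r ?(ltW s0)//.
by rewrite [leRHS](_ : _ = pointC (d := d) q S + pointC (d := d) q S + 1) ?lerDl//; ring.
Qed.
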